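(* Let $\varepsilon>0$, $A\in[-1,1]$ and $\beta\ge 0$, and let $f_0\in\mathbb{A}_1$. Define $$\nu(t)=1-4\|f_0\|_{\mathbb{A}_1}t.$$ Then for every $0<T<(4\|f_0\|_{\mathbb{A}_1})^{-1}$ there exists a local-in-time solution $f=f(x,t)$, $x\in\mathbb{R}$, $t\in[0,T]$, of the equation $$-2\varepsilon f_t+\partial_1 f=A\,Hf+\beta\,H\partial_1^2 f-A\varepsilon\,\partial_1\big((Hf)\,f\big)$$ with initial data $f(\cdot,0)=f_0$, such that $$f\in L^\infty(0,T;\mathbb{A}_{\nu(t)}).$$
   Context: The spatial domain is $\mathbb{R}$ and functions are real-valued; $\partial_1$ is the derivative in the space variable $x$ and $f_t=\partial f/\partial t$. The Hilbert transform is $$Hf(x)=\frac1\pi\,\mathrm{P.V.}\int_{\mathbb{R}}\frac{f(y)}{x-y}\,dy,$$ equivalently the Fourier multiplier $\widehat{Hf}(n)=-i\,\mathrm{sgn}(n)\hat f(n)$. The Fourier transform is normalized as $\hat f(n)=\frac{1}{2\pi}\int_{\mathbb{R}}f(x)e^{-inx}\,dx$, so that $\widehat{fg}=\hat f*\hat g$. For $\nu\ge0$, $$\mathbb{A}_\nu=\{f\in L^2(\mathbb{R}) : e^{\nu|n|}\hat f(n)\in L^1(\mathbb{R})\},\qquad \|f\|_{\mathbb{A}_\nu}=\int_{\mathbb{R}}e^{\nu|n|}|\hat f(n)|\,dn.$$ The statement $f\in L^\infty(0,T;\mathbb{A}_{\nu(t)})$ means that $f(\cdot,t)\in\mathbb{A}_{\nu(t)}$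 for a.e. $t\in(0,T)$ and $\operatorname{ess\,sup}_{0<t<T}\|f(\cdot,t)\|_{\mathbb{A}_{\nu(t)}}<\infty$. Here $A$ is the Atwood number $A=(\rho^+-\rho^-)/(\rho^++\rho^-)$ of two fluids with densities $\rho^\pm\ge0$ (not both zero), so $A\in[-1,1]$; $\beta\ge0$ is a dimensionless surface tension parameter and $\varepsilon>0$ is a (small) parameter. If $f_0=0$, $(4\|f_0\|_{\mathbb{A}_1})^{-1}$ is read as $+\infty$. *)

(* Defs.v *)
From HB Require Import structures.
From mathcomp Require Import all_boot all_order all_algebra.
From mathcomp Require Import all_classical all_reals all_analysis.
From mathcomp Require Import ess_sup_inf complex.
Set Implicit Arguments.
Unset Strict Implicit.
Unset Printing Implicit Defensive.
Import Order.TTheory GRing.Theory Num.Theory.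
Import numFieldNormedType.Exports.
Import ComplexField.
Local Open Scope classical_set_scope.
Local Open Scope complex_scope.
Local Open Scope ring_scope.

Section fourier.
Context {R : realType}.
Local Notation mu := (@lebesgue_measure R).

(* (1 / 2pi) \int_{-N}^{N} f(x) e^{-inx} dx, split as
   e^{-inx} = cos (nx) - i sin (nx) *)
Definition fourier_trunc (f : R -> R) (N n : R) : R[i] :=
  ((2 * pi)^-1 * \int[mu]_(x in `[- N, N]) (f x * cos (n * x)))
  -i* ((2 * pi)^-1 * \int[mu]_(x in `[- N, N]) (f x * sin (n * x))).

(* g is a Fourier transform of the L^2 function f (Plancherel): the truncated
   transforms of f converge to g in L^2.  Such a g is unique up to a.e.
   equality. *)
Definition is_fourier (f : R -> R) (g : R -> R[i]) : Prop :=
  [/\ measurable_fun setT (fun n => complex.Re (g n)),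
      measurable_fun setT (fun n => complex.Im (g n)) &
      (\int[mu]_n (Normc.normc (g n - fourier_trunc f N n) ^+ 2)%:E)%E
        @[N --> +oo] --> 0%E].

(* A representative of the Fourier transform; meaningful for f in L^2. *)
Definition fourier (f : R -> R) : R -> R[i] :=
  xget (fun=> 0) [set g | is_fourier f g].

Definition wiener_norm (nu : R) (f : R -> R) : \bar R :=
  (\int[mu]_n (expR (nu * `|n|) * Normc.normc (fourier f n))%:E)%E.

Definition wiener (nu : R) (f : R -> R) : Prop :=
  f \in Lfun mu 2%:E /\
  mu.-integrable setT
    (fun n => (expR (nu * `|n|) * Normc.normc (fourier f n))%:E).

(* f in L^infty(0, T; A_{nu(t)}), for f : space -> time -> R. *)
Definition Linfty_wiener (T : R) (nu : R -> R) (f : R -> R -> R) : Prop :=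
  {ae mu, forall t, t \in `]0, T[ -> wiener (nu t) (f^~ t)} /\
  (ess_sup mu ((fun t => wiener_norm (nu t) (f^~ t)) \_ `]0%R, T[) < +oo)%E.

End fourier.

Section hilbert.
Context {R : realType}.
Local Notation mu := (@lebesgue_measure R).

Definition annulus (x : R) (p : R * R) : set R :=
  [set y | p.1 < `|x - y| < p.2].

Definition hilbert_trunc (f : R -> R) (x : R) (p : R * R) : R :=
  pi^-1 * \int[mu]_(y in annulus x p) (f y / (x - y)).

(* The principal value is taken both at y = x and at infinity: the inner
   radius tends to 0 and the outer radius to +oo, independently. *)
Definition pv_filter : set_system (R * R) :=
  filter_prod (0 : R)^'+ (pinfty_nbhs R).

Definition hilbert (f : R -> R) (x : R) : R :=
  lim (hilbert_trunc f x @ pv_filter).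

(* The principal value defining [hilbert f x] exists. *)
Definition has_hilbert (f : R -> R) (x : R) : Prop :=
  (forall p : R * R, 0 < p.1 ->
     mu.-integrable (annulus x p) (fun y => (f y / (x - y))%:E)) /\
  cvg (hilbert_trunc f x @ pv_filter).

End hilbert.

Section equation.
Context {R : realType}.
Local Notation mu := (@lebesgue_measure R).

(* - 2 eps f_t + d_1 f = A H f + beta H d_1^2 f - A eps d_1 ((H f) f)
   at the point (x, t), all the terms being well defined there. *)
Definition wave_eq_at (eps A beta : R) (f : R -> R -> R) (x t : R) : Prop :=
  [/\ derivable (f x) t 1,
      (forall y, derivable (f^~ t) y 1 /\ derivable (derive1 (f^~ t)) y 1),
      (forall y, has_hilbert (f^~ t) y) /\
        has_hilbert (derive1 (derive1 (f^~ t))) x,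
      derivable (fun y => hilbert (f^~ t) y * f y t) x 1 &
      - (2 * eps) * derive1 (f x) t + derive1 (f^~ t) x
      = A * hilbert (f^~ t) x + beta * hilbert (derive1 (derive1 (f^~ t))) x
        - A * eps * derive1 (fun y => hilbert (f^~ t) y * f y t) x].

(* Classical solution on R x [0, T] with initial data f0; the latter is an
   element of L^2, hence only defined up to a.e. equality. *)
Definition wave_solution (eps A beta T : R) (f0 : R -> R) (f : R -> R -> R)
    : Prop :=
  [/\ {within [set p : R * R | 0 <= p.2 <= T],
        continuous (fun p : R * R => f p.1 p.2)},
      {ae mu, forall x, f x 0 = f0 x} &
      forall x t, 0 < t < T -> wave_eq_at eps A beta f x t].

End equation.

(* Main.v *)
Require Import Defs.
From HB Require Import structures.
From mathcomp Require Import all_boot all_order all_algebra.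
From mathcomp Require Import all_classical all_reals all_analysis.
From mathcomp Require Import measurable_realfun ess_sup_inf ring lra complex.
Set Implicit Arguments.
Unset Strict Implicit.
Unset Printing Implicit Defensive.
Import Order.TTheory GRing.Theory Num.Theory.
Import numFieldNormedType.Exports.
Local Open Scope classical_set_scope.
Local Open Scope ring_scope.

(** The equation decouples on the half line of positive frequencies.  Write
    the real solution as [f = 2 Re F] with [F x t] the integral over [n > 0]
    of [U t n * e^{inx}].  As [H e^{inx} = - i e^{inx}] for [n > 0], one has
    [H f = 2 Im F] and [f * H f = 4 Re F Im F = 2 Im (F ^ 2)] ([rsynth_sqr],
    [hilbert_rsynth]), so the quadratic term involves only the
    self-convolution of [U], and the equation becomes, for each [n > 0],
      [U_t = i * w n * U + (A n / 2) * (U * U)],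
      [w n = (n + A - beta * n ^ 2) / (2 * eps)].
    The dispersion relation [w] is real: it disappears from all estimates on
    passing to [V t n = e^{- i w t} U t n].

    What remains is the loss of one derivative, the factor [n].  On the half
    line [n = k + (n - k)] with both terms positive, hence the weight
    [e^{- (1 - lam t) n}] is multiplicative along a convolution ([wtM]), and
    its shrinking width pays for the factor [n]: the integral of
    [lam * n * e^{- (1 - lam s) n}] over [0 <= s <= t] is at most
    [e^{- (1 - lam t) n}] ([src_int_le]).  Consequently, if [M] satisfies
    [e^n |g0 n| + (2 lam)^-1 (M * M) n <= M n], the bound
    [|V t n| <= e^{- (1 - lam t) n} M n] is preserved by the Picard iteration
    of the Duhamel formula, and so are the bounds for its increments, which
    are summable.  Such an [M] of mass at most [2 m] exists as soon as
    [m + (2 lam)^-1 (2 m)^2 <= 2 m], where [m] is the norm of the initial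
    datum ([convolution_supersolution]); [lam = 4 m] is admissible, and this
    is the rate in [nu].  The bound by [M] is the claimed bound in the
    Wiener spaces.  For [t <= T] the width [1 - lam T] is positive, so
    all the [n ^ k U t n] are integrable uniformly in time and the solution
    is classical.  Membership in [L^2] propagates separately: in the symmetric
    convolution the factor [n] can be put on one of the two terms, where the
    weight absorbs it, while the other is measured in [L^2] ([srcZ_le]).

    Passing between functions and modes requires the [L^2] theory of the
    Fourier transform.  It is developed for the real Hartley transform,
    whose kernel [cas (n x) = cos (n x) + sin (n x)] is real and symmetric:
    the transform is self-adjoint and is [2 pi] times an involution.
    The Fejer pair (triangle, Fejer kernel) gives Bessel's inequality
    ([hartley_bessel]) and, because the translates of Fejer kernels are total
    in [L^2] ([fejer_orthogonal_eq0]), uniqueness and inversion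
    ([hartley_inversion], [hartley_recover]).  Even and odd parts of the
    Hartley transform are the real and imaginary parts of the Fourier
    transform ([hartley_lim_fourier], [fourier_hartley_lim]). *)

(** * Integration and square integrable functions *)

Section integration_tools.
Context d (T : measurableType d) (R : realType) (mu : {measure set T -> \bar R}).
Implicit Types (D : set T) (f g : T -> R).

Lemma integrable_dominated D f g : measurable D -> measurable_fun D f ->
  mu.-integrable D (EFin \o g) -> (forall x, D x -> `|f x| <= g x) ->
  mu.-integrable D (EFin \o f).
Proof.
move=> mD mf ig fg; apply: le_integrable ig => //.
  exact/measurable_EFinP.
by move=> x Dx /=; rewrite lee_fin (le_trans (fg x Dx))// ler_norm.
Qed.

Lemma integrable_measurable D f : mu.-integrable D (EFin \o f) ->
  measurable_fun D f.
Proof. by move=> /measurable_int/measurable_EFinP. Qed.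

Lemma intZl D (c : R) f : measurable D -> mu.-integrable D (EFin \o f) ->
  mu.-integrable D (EFin \o (fun x => c * f x)).
Proof. by move=> mD /(integrableZl mD c). Qed.

Lemma intD D f g : measurable D -> mu.-integrable D (EFin \o f) ->
  mu.-integrable D (EFin \o g) -> mu.-integrable D (EFin \o (fun x => f x + g x)).
Proof. by move=> mD /(integrableD mD) h /h. Qed.

Lemma intB D f g : measurable D -> mu.-integrable D (EFin \o f) ->
  mu.-integrable D (EFin \o g) -> mu.-integrable D (EFin \o (fun x => f x - g x)).
Proof. by move=> mD /(integrableB mD) h /h. Qed.

Lemma cvg_Rintegral_dominated D (f_ : nat -> T -> R) f g : measurable D ->
  (forall n, measurable_fun D (f_ n)) -> measurable_fun D f ->
  {ae mu, forall x, D x -> f_ n x @[n --> \oo] --> f x} ->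
  mu.-integrable D (EFin \o g) ->
  (forall n x, D x -> `|f_ n x| <= g x) ->
  \int[mu]_(x in D) f_ n x @[n --> \oo] --> \int[mu]_(x in D) f x.
Proof.
move=> mD mf_ mf cf ig fg; apply: fine_cvg.
have cEf : {ae mu, forall x, D x -> (f_ n x)%:E @[n --> \oo] --> (f x)%:E}.
  by apply: filterS cf => x cfx Dx; apply/cvg_EFin; [exact: nearW|exact: cfx].
have [igf _] := @dominated_convergence _ _ _ mu D mD (fun n x => (f_ n x)%:E)
  (EFin \o f) (EFin \o g) (fun n => (measurable_EFinP _ _).2 (mf_ n))
  ((measurable_EFinP _ _).2 mf) cEf ig (aeW _ (fun x n Dx => fg n x Dx)).
by rewrite fineK//; exact: integrable_fin_num.
Qed.

(** Fatou's lemma in the form used for passing from truncated to full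
    integrals: the bounds converge along with the integrands. *)
Lemma fatou_le (f_ : nat -> T -> R) f (C_ : nat -> R) C :
  (forall n, measurable_fun setT (f_ n)) -> (forall n x, 0 <= f_ n x) ->
  measurable_fun setT f -> {ae mu, forall x, f_ n x @[n --> \oo] --> f x} ->
  (forall n, \int[mu]_x (f_ n x)%:E <= (C_ n)%:E)%E -> C_ n @[n --> \oo] --> C ->
  (forall x, 0 <= f x) ->
  (\int[mu]_x (f x)%:E <= C%:E)%E.
Proof.
move=> mf_ f_0 mf cf fC cC f0.
have := @fatou _ _ _ mu setT measurableT (fun n x => (f_ n x)%:E)
  (fun n => (measurable_EFinP _ _).2 (mf_ n)) (fun n x _ => f_0 n x).
have cE : (C_ n)%:E @[n --> \oo] --> C%:E by apply/cvg_EFin => //; exact: nearW.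
have -> : (\int[mu]_x limn_einf (fun n => (f_ n x)%:E) = \int[mu]_x (f x)%:E)%E.
  apply: ge0_ae_eq_integral => //.
  - under eq_fun do rewrite -[limn_einf _]oppeK -limn_esupN.
    apply: measurableT_comp => //; apply: measurable_fun_limn_esup => n.
    by apply: measurableT_comp => //; exact/measurable_EFinP.
  - exact/measurable_EFinP.
  - move=> x _; rewrite limn_einf_lim; apply: lime_ge; first exact: is_cvg_einfs.
    by apply: nearW => n; apply: le_ereal_inf_tmp => _ [m _ <-]; rewrite lee_fin.
  - by move=> x _; rewrite lee_fin.
  apply: filterS cf => x cfx _.
  have cEx : (f_ n x)%:E @[n --> \oo] --> (f x)%:E by apply/cvg_EFin => //; exact: nearW.
  by have [-> _] := cvg_limn_einf_sup cEx.
move=> h; apply: (le_trans h).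
have [<- _] := cvg_limn_einf_sup cE; rewrite !limn_einf_lim.
apply: lee_lim; [exact: is_cvg_einfs|exact: is_cvg_einfs|].
apply: nearW => n; apply: le_ereal_inf_tmp => _ [m nm <-].
by apply: le_trans (fC m); apply: ereal_inf_lbound; exists m.
Qed.

(** Membership in [L^2] for a representative: values at points matter below,
    where functions defined by integrals are compared with classes. *)
Definition sqint f := measurable_fun setT f /\
  mu.-integrable setT (EFin \o (fun x => f x ^+ 2)).

Lemma sqintM f g : sqint f -> sqint g ->
  mu.-integrable setT (EFin \o (fun x => f x * g x)).
Proof.
move=> [mf if2] [mg ig2].
have := integrableD measurableT if2 ig2.
move=> /(@integrable_dominated setT (fun x => f x * g x) (fun x => f x ^+2 + g x ^+ 2)); apply => //.
  exact: measurable_funM.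
move=> x _; rewrite normrM -(real_normK (num_real (f x))) -(real_normK (num_real (g x))).
have := sqr_ge0 (`|f x| - `|g x|); have := normr_ge0 (f x); have := normr_ge0 (g x).
by move: (Num.norm _) (Num.norm _) => u v; nra.
Qed.

Lemma sqintD f g : sqint f -> sqint g -> sqint (fun x => f x + g x).
Proof.
move=> sf sg; have [[mf if2] [mg ig2]] := (sf, sg); split.
  exact: measurable_funD.
have := integrableD measurableT (integrableZl measurableT 2 if2) (integrableZl measurableT 2 ig2).
move=> /(@integrable_dominated setT (fun x => (f x + g x)^+2) (fun x => 2 * f x ^+2 + 2 * g x ^+ 2)); apply => //.
  by apply: measurable_funX; exact: measurable_funD.
move=> x _; rewrite ger0_norm ?sqr_ge0//.
by have := sqr_ge0 (f x - g x); nra.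
Qed.

Lemma sqintZ c f : sqint f -> sqint (fun x => c * f x).
Proof.
move=> [mf if2]; split; first exact: measurable_funM.
have := integrableZl measurableT (c ^+ 2) if2.
by apply: eq_integrable => // x _ /=; rewrite exprMn EFinM.
Qed.

Lemma sqintB f g : sqint f -> sqint g -> sqint (fun x => f x - g x).
Proof.
move=> sf /(sqintZ (-1)) sg; have := sqintD sf sg.
by under eq_fun do rewrite mulN1r.
Qed.

Lemma sqint_sq_ge0 f : (0 <= \int[mu]_x (f x ^+ 2))%R.
Proof. by apply: Rintegral_ge0 => x _; exact: sqr_ge0. Qed.

Lemma Rintegral_sqM_le f g (eta : R) : 0 < eta -> sqint f -> sqint g ->
  `|\int[mu]_x (f x * g x)| <= eta^-1 * \int[mu]_x (f x ^+ 2) + eta * \int[mu]_x (g x ^+ 2).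
Proof.
move=> e0 sf sg; have [[mf if2] [mg ig2]] := (sf, sg).
have ifg := sqintM sf sg.
apply: (le_trans (le_normr_Rintegral measurableT ifg)).
rewrite -RintegralZl// -RintegralZl// -RintegralD//=; first last.
- exact: intZl.
- exact: intZl.
apply: le_Rintegral => //.
- exact: integrable_norm.
- by apply: intD => //; exact: intZl.
move=> x _; rewrite normrM -[X in _ * X + _]real_normK ?num_real// -[X in _ + _ * X]real_normK ?num_real//.
move: (normr_ge0 (f x)) (normr_ge0 (g x)); move: `|f x| `|g x| => u v u0 v0.
rewrite -subr_ge0.
have -> : eta^-1 * u ^+ 2 + eta * v ^+ 2 - u * v = eta^-1 * ((u - eta * v)^+2 + u * (eta * v)).
  by field; rewrite gt_eqF.
by rewrite mulr_ge0 ?invr_ge0 ?(ltW e0)// addr_ge0 ?sqr_ge0// mulr_ge0// mulr_ge0// ltW.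
Qed.

(** Identities for the transforms are proved against one test function and
    for truncated functions; this passes to the limit in the truncation. *)
Lemma cvg_sqint_weak (F : set_system R) {FF : Filter F} (u : R -> T -> R) g :
  (\forall N \near F, sqint (u N)) -> sqint g ->
  \int[mu]_x (u N x ^+ 2) @[N --> F] --> 0 ->
  \int[mu]_x (u N x * g x) @[N --> F] --> 0.
Proof.
move=> su sg cu; apply/cvgrPdist_lt => e e0.
set G := \int[mu]_x (g x ^+ 2).
have G0 : 0 <= G by exact: sqint_sq_ge0.
pose eta := e / 2 / (G + 1).
have eta0 : 0 < eta by rewrite /eta !divr_gt0// ltr_wpDl.
have h0 : 0 < eta * (e / 2) by rewrite mulr_gt0// divr_gt0.
move/cvgrPdist_lt : cu => /(_ _ h0) cu.
near=> N; rewrite sub0r normrN.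
have uN : sqint (u N) by near: N.
apply: le_lt_trans (Rintegral_sqM_le eta0 uN sg) _.
have : `|0 - \int[mu]_x (u N x ^+ 2)| < eta * (e / 2) by near: N.
rewrite sub0r normrN ger0_norm ?sqint_sq_ge0// -/G => h.
have h1 : eta^-1 * \int[mu]_x (u N x ^+ 2) < e / 2.
  by rewrite mulrC ltr_pdivrMr// mulrC.
have h2 : eta * G <= e / 2.
  by rewrite /eta mulrAC ler_pdivrMr ?ltr_wpDl// ler_wpM2l ?divr_ge0 ?(ltW e0)// lerDl.
by have := ltr_leD h1 h2; rewrite -splitr.
Unshelve. all: by end_near. Qed.

End integration_tools.

Section parametric.
Context d d' (T : measurableType d) (U : measurableType d') (R : realType).
Variable m2 : {sigma_finite_measure set U -> \bar R}.

Lemma measurable_Rintegral_param (Phi : T * U -> R) :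
  measurable_fun setT Phi ->
  measurable_fun setT (fun x => \int[m2]_y Phi (x, y)).
Proof.
move=> mPhi; rewrite /Rintegral.
apply: (measurableT_comp (fine_measurable measurableT)).
rewrite (_ : (fun x => _) = (fun x => \int[m2]_y ((EFin \o Phi)^\+ (x, y)) - \int[m2]_y ((EFin \o Phi)^\- (x, y)))%E); last first.
  by apply/funext => x; rewrite integralE; congr (_ - _)%E; apply: eq_integral => y _; rewrite ?funeposE ?funenegE.
apply: emeasurable_funB.
- apply: (@measurable_fun_fubini_tonelli_F _ _ _ _ _ m2 ((EFin \o Phi)^\+)%E).
  + by apply: measurable_funepos; exact/measurable_EFinP.
  + by move=> z; exact: funepos_ge0.
- apply: (@measurable_fun_fubini_tonelli_F _ _ _ _ _ m2 ((EFin \o Phi)^\-)%E).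
  + by apply: measurable_funeneg; exact/measurable_EFinP.
  + by move=> z; exact: funeneg_ge0.
Qed.

End parametric.

Lemma EFin_Rintegral_le d (T : measurableType d) (R : realType)
    (mu : {measure set T -> \bar R}) (f : T -> R) : measurable_fun setT f ->
  ((\int[mu]_x f x)%:E <= \int[mu]_x `|(f x)%:E|)%E.
Proof.
move=> /measurable_EFinP mf; rewrite /Rintegral.
have h := le_abse_integral mu measurableT mf.
have [fn|] := boolP (\int[mu]_x (f x)%:E \is a fin_num)%E.
  by rewrite fineK//; apply: le_trans h; exact: lee_abs.
by rewrite fin_numEn => /orP[|] /eqP ->; exact: integral_ge0.
Qed.

Section Rfubini.
Context d d' (T : measurableType d) (U : measurableType d') (R : realType).
Variable m1 : {sigma_finite_measure set T -> \bar R}.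
Variable m2 : {sigma_finite_measure set U -> \bar R}.
Variable Phi : T * U -> R.
Hypothesis mPhi : measurable_fun setT Phi.
Hypothesis iPhi : (\int[m1]_x \int[m2]_y `|Phi (x, y)|%:E < +oo)%E.

Let iP : (m1 \x m2)%E.-integrable setT (EFin \o Phi).
Proof. by apply/integrable12ltyP => //; exact/measurable_EFinP. Qed.

Lemma ae_integrable_section :
  {ae m1, forall x, m2.-integrable setT (fun y => (Phi (x, y))%:E)}.
Proof. exact: ae_integrable1 iP. Qed.

Lemma Rintegral_fubini1 :
  \int[m1]_x \int[m2]_y Phi (x, y) = fine (\int[m1 \x m2]_z (Phi z)%:E)%E.
Proof.
rewrite -(integral12_prod_meas1 iP) /Rintegral; congr fine.
apply: ae_eq_integral => //.
- by apply/measurable_EFinP; exact: measurable_Rintegral_param.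
- by have /integrableP[] := integrable_fubini_F iP.
apply: filterS ae_integrable_section => x ix _ /=.
by rewrite fineK//; exact: integrable_fin_num.
Qed.

End Rfubini.

Section Rfubini2.
Context d d' (T : measurableType d) (U : measurableType d') (R : realType).
Variable m1 : {sigma_finite_measure set T -> \bar R}.
Variable m2 : {sigma_finite_measure set U -> \bar R}.
Variable Phi : T * U -> R.
Hypothesis mPhi : measurable_fun setT Phi.
Hypothesis iPhi : (\int[m1]_x \int[m2]_y `|Phi (x, y)|%:E < +oo)%E.

Let iP : (m1 \x m2)%E.-integrable setT (EFin \o Phi).
Proof. by apply/integrable12ltyP => //; exact/measurable_EFinP. Qed.

Lemma Rintegral_fubini :
  \int[m1]_x \int[m2]_y Phi (x, y) = \int[m2]_y \int[m1]_x Phi (x, y).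
Proof.
rewrite Rintegral_fubini1// -(integral21_prod_meas1 iP) /Rintegral; congr fine.
apply: ae_eq_integral => //.
- exact: (measurable_fubini_G iP).
- apply/measurable_EFinP.
  have := @measurable_Rintegral_param _ _ _ _ _ m1 (fun z : U * T => Phi (z.2, z.1)).
  apply; apply: measurableT_comp => //; exact: measurable_fun_pair.
apply: filterS (ae_integrable2 iP) => x ix _ /=.
by rewrite fineK//; exact: integrable_fin_num.
Qed.

End Rfubini2.

Section tensor.
Context d d' (T : measurableType d) (U : measurableType d') (R : realType).
Variable m1 : {measure set T -> \bar R}.
Variable m2 : {sigma_finite_measure set U -> \bar R}.

Lemma tensor_lty (Phi : T * U -> R) (u : T -> R) (v : U -> R) :
  measurable_fun setT Phi ->
  m1.-integrable setT (EFin \o u) -> m2.-integrable setT (EFin \o v) ->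
  (forall x y, `|Phi (x, y)| <= `|u x| * `|v y|) ->
  (\int[m1]_x \int[m2]_y `|Phi (x, y)|%:E < +oo)%E.
Proof.
move=> mPhi iu iv uv.
have mu := integrable_measurable iu; have mv := integrable_measurable iv.
have mv' : measurable_fun setT (fun y => `|v y|%:E).
  by apply/measurable_EFinP; exact: measurableT_comp.
have mu' : measurable_fun setT (fun y => `|u y|%:E).
  by apply/measurable_EFinP; exact: measurableT_comp.
have mP' : measurable_fun setT (fun z => `|Phi z|%:E).
  by apply/measurable_EFinP; exact: measurableT_comp.
apply: (@le_lt_trans _ _ (\int[m1]_x (`|u x|%:E * \int[m2]_y `|v y|%:E))%E).
  apply: ge0_le_integral => //.
  - by move=> x _; exact: integral_ge0.
  - exact: (@measurable_fun_fubini_tonelli_F _ _ _ _ _ m2 (fun z => `|Phi z|%:E)).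
  - by apply: emeasurable_funM.
  move=> x _; rewrite -ge0_integralZl//.
  apply: ge0_le_integral => //.
  - apply/measurable_EFinP; apply: measurableT_comp => //.
    exact: (measurableT_comp mPhi (measurable_fun_pair _ _)).
  - by apply: emeasurable_funM.
  by move=> y _; rewrite -EFinM lee_fin.
have /integrableP[_ iv'] := iv; have /integrableP[_ iu'] := iu.
rewrite ge0_integralZr//; last exact: integral_ge0.
by rewrite lte_mul_pinfty// ?integral_ge0// ge0_fin_numE// integral_ge0.
Qed.

End tensor.

Section lebesgue_invariance.
Context {R : realType}.
Local Notation mu := (@lebesgue_measure R).

Lemma leb_aeS (P Q : R -> Prop) : {ae mu, forall x, P x} ->
  (forall x, P x -> Q x) -> {ae mu, forall x, Q x}.
Proof. by move=> aP PQ; apply: (@filterS _ _ (ae_filter_ringOfSetsType mu) P Q). Qed.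

Lemma leb_aeI (P Q : R -> Prop) : {ae mu, forall x, P x} ->
  {ae mu, forall x, Q x} -> {ae mu, forall x, P x /\ Q x}.
Proof. by move=> aP aQ; apply: (@filterI _ _ (ae_filter_ringOfSetsType mu) P Q). Qed.

(** By uniqueness of the Lebesgue measure it suffices to compare the measures
    of intervals. *)
Lemma lebesgue_measure_shift (c : R) (A : set R) : measurable A ->
  pushforward mu ((fun x => x + c) : _ -> measurableTypeR R) A = mu A.
Proof.
move=> mA; apply/esym; apply: lebesgue_measure_unique => //=; first exact: measurable_funD.
move=> mf _ [[a b]] _ <-.
rewrite /pushforward.
rewrite (_ : _ @^-1` _ = `]a - c, b - c]%classic); last first.
  by apply/seteqP; split => x /=; rewrite !in_itv/= ltrBlDr lerBrDr.
rewrite !lebesgue_measure_itv/= !lte_fin ltrD2r; case: ifP => // _.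
by rewrite -!EFinB; congr EFin; ring.
Qed.

Lemma ge0_integral_shift (f : R -> \bar R) c : measurable_fun setT f ->
  (forall x, 0 <= f x)%E -> (\int[mu]_x f (x + c)%R = \int[mu]_x f x)%E.
Proof.
move=> mf f0.
have -> : (\int[mu]_x f x = \int[pushforward mu ((fun x => (x + c)%R) : _ -> measurableTypeR R)]_x f x)%E.
  apply: eq_measure_integral => //=; first exact: measurable_funD.
  by move=> mphi A mA _; apply/esym/lebesgue_measure_shift.
by rewrite ge0_integral_pushforward//; exact: measurable_funD.
Qed.

Lemma ge0_integral_oppr (f : R -> \bar R) : measurable_fun setT f ->
  (forall x, 0 <= f x)%E -> (\int[mu]_x f (- x)%R = \int[mu]_x f x)%E.
Proof.
move=> mf f0.
have -> : (\int[mu]_x f x = \int[pushforward mu (-%R : _ -> measurableTypeR R)]_x f x)%E.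
  by apply: eq_measure_integral => //= A mA _; apply/esym/lebesgue_measureN.
by rewrite ge0_integral_pushforward.
Qed.

Lemma ge0_integral_reflect (f : R -> \bar R) c : measurable_fun setT f ->
  (forall x, 0 <= f x)%E -> (\int[mu]_x f (c - x)%R = \int[mu]_x f x)%E.
Proof.
move=> mf f0.
rewrite -[RHS](ge0_integral_oppr mf f0).
rewrite -[RHS](@ge0_integral_shift (fun x => f (- x)) (- c))//.
  by apply: eq_integral => x _; congr f; ring.
by apply: measurableT_comp.
Qed.

Lemma Rintegral_shift (f : R -> R) c : measurable_fun setT f ->
  \int[mu]_x f (x + c) = \int[mu]_x f x.
Proof.
move=> /measurable_EFinP mf; rewrite /Rintegral; congr fine; rewrite integralE [RHS]integralE.
congr (_ - _)%E.
- rewrite -[RHS](@ge0_integral_shift ((EFin \o f)^\+)%E c (measurable_funepos mf) (fun=> funepos_ge0 _ _)).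
  by apply: eq_integral => x _; rewrite ?funeposE ?funenegE.
- rewrite -[RHS](@ge0_integral_shift ((EFin \o f)^\-)%E c (measurable_funeneg mf) (fun=> funeneg_ge0 _ _)).
  by apply: eq_integral => x _; rewrite ?funeposE ?funenegE.
Qed.

Lemma Rintegral_reflect (f : R -> R) c : measurable_fun setT f ->
  \int[mu]_x f (c - x) = \int[mu]_x f x.
Proof.
move=> /measurable_EFinP mf; rewrite /Rintegral; congr fine; rewrite integralE [RHS]integralE.
congr (_ - _)%E.
- rewrite -[RHS](@ge0_integral_reflect ((EFin \o f)^\+)%E c (measurable_funepos mf) (fun=> funepos_ge0 _ _)).
  by apply: eq_integral => x _; rewrite ?funeposE ?funenegE.
- rewrite -[RHS](@ge0_integral_reflect ((EFin \o f)^\-)%E c (measurable_funeneg mf) (fun=> funeneg_ge0 _ _)).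
  by apply: eq_integral => x _; rewrite ?funeposE ?funenegE.
Qed.

Lemma Rintegral_oppr (f : R -> R) : measurable_fun setT f ->
  \int[mu]_x f (- x) = \int[mu]_x f x.
Proof.
by move=> mf; rewrite -(Rintegral_reflect 0 mf); under [RHS]eq_Rintegral do rewrite sub0r.
Qed.

Lemma integrable_reflect (f : R -> R) c : mu.-integrable setT (EFin \o f) ->
  mu.-integrable setT (fun x => (f (c - x))%:E).
Proof.
move=> /integrableP[mf iff]; apply/integrableP; split.
  apply/measurable_EFinP; apply: measurableT_comp; first exact/measurable_EFinP.
  exact: measurable_funB.
have mf' : measurable_fun setT (abse \o (EFin \o f)) by apply: measurableT_comp => //; exact/measurable_EFinP.
by have := @ge0_integral_reflect (abse \o (EFin \o f)) c mf' (fun=> abse_ge0 _) => /= ->.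
Qed.

Lemma integrable_shift (f : R -> R) c : mu.-integrable setT (EFin \o f) ->
  mu.-integrable setT (fun x => (f (x + c))%:E).
Proof.
move=> /integrableP[mf iff]; apply/integrableP; split.
  apply/measurable_EFinP; apply: measurableT_comp; first exact/measurable_EFinP.
  exact: measurable_funD.
have mf' : measurable_fun setT (abse \o (EFin \o f)) by apply: measurableT_comp => //; exact/measurable_EFinP.
by have := @ge0_integral_shift (abse \o (EFin \o f)) c mf' (fun=> abse_ge0 _) => /= ->.
Qed.

(** The general statements above, at the product sigma-algebra of the plane. *)
Lemma leb_measurable_F (f : R * R -> \bar R) : measurable_fun setT f ->
  (forall p, 0 <= f p)%E -> measurable_fun setT (fun x : R => \int[mu]_y f (x, y))%E.
Proof. exact: (@measurable_fun_fubini_tonelli_F _ _ _ _ R mu f). Qed.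

Lemma leb_tonelli (f : R * R -> \bar R) : measurable_fun setT f ->
  (forall p, 0 <= f p)%E ->
  (\int[mu]_x \int[mu]_y f (x, y) = \int[mu]_y \int[mu]_x f (x, y))%E.
Proof. exact: (@fubini_tonelli _ _ _ _ R mu mu f). Qed.

Lemma leb_measurable_Rint (f : R * R -> R) : measurable_fun setT f ->
  measurable_fun setT (fun x : R => \int[mu]_y f (x, y)).
Proof. exact: (@measurable_Rintegral_param _ _ _ _ R mu f). Qed.

Lemma leb_fubini (f : R * R -> R) : measurable_fun setT f ->
  (\int[mu]_x \int[mu]_y `|f (x, y)|%:E < +oo)%E ->
  \int[mu]_x \int[mu]_y f (x, y) = \int[mu]_y \int[mu]_x f (x, y).
Proof. exact: (@Rintegral_fubini _ _ _ _ R mu mu f). Qed.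

Lemma leb_tensor_lty (Phi : R * R -> R) (u v : R -> R) :
  measurable_fun setT Phi ->
  mu.-integrable setT (EFin \o u) -> mu.-integrable setT (EFin \o v) ->
  (forall x y, `|Phi (x, y)| <= `|u x| * `|v y|) ->
  (\int[mu]_x \int[mu]_y `|Phi (x, y)|%:E < +oo)%E.
Proof. exact: (@tensor_lty _ _ _ _ R mu mu Phi u v). Qed.

End lebesgue_invariance.

(** The weighted arithmetic-geometric inequality, optimised over the weight
    [c]; this turns a family of linear bounds into a Cauchy-Schwarz
    inequality. *)
Lemma sqr_le_of_young (R : realType) (x A B : R) : 0 <= x -> 0 <= A -> 0 <= B ->
  (forall c, 0 < c -> 2 * x <= c * A + c^-1 * B) -> x ^+ 2 <= A * B.
Proof.
move=> x0 A0 B0 h.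
have [->|xn0] := eqVneq x 0; first by rewrite expr0n/= mulr_ge0.
have xp : 0 < x by rewrite lt_neqAle eq_sym xn0.
have [B0'|Bn0] := eqVneq B 0.
  have A1 : 0 < A + 1 by rewrite ltr_wpDl.
  have := h (x / (A + 1)) (divr_gt0 xp A1); rewrite B0' mulr0 addr0.
  rewrite -mulrA (mulrC _ A) => h1.
  have : A / (A + 1) <= 1 by rewrite ler_pdivrMr// mul1r lerDl.
  by move: (A / (A + 1)) h1 => u; nra.
have Bp : 0 < B by rewrite lt_neqAle eq_sym Bn0.
have := h (B / x) (divr_gt0 Bp xp); rewrite invf_div divfK//.
have -> : B / x * A = A * B / x by ring.
rewrite -[2 * x]/(2%:R * x) mulr_natl mulr2n lerD2r ler_pdivlMr// -expr2; exact.
Qed.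

(** * Elementary calculus and the Dirichlet integral *)

Section calculus.
Context {R : realType}.
Implicit Types (a x y t : R).

Lemma is_derive_scale (f : R -> R) a x df :
  is_derive (a * x) 1 f df -> is_derive x 1 (fun y => f (a * y)) (a * df).
Proof.
move=> fd; have h : is_derive x 1 (fun y => a * y) a.
  by apply: is_derive_eq; rewrite /GRing.scale/=; ring.
have := @is_derive1_comp R f _ x _ _ fd h.
by rewrite mulrC.
Qed.

Lemma is_derive_continuous (f : R -> R) x df : is_derive x 1 f df ->
  {for x, continuous f}.
Proof. by move=> [fd _]; apply/differentiable_continuous; exact/derivable1_diffP. Qed.

Lemma is_derive_sinM a x : is_derive x 1 (fun y => sin (a * y)) (a * cos (a * x)).
Proof. exact: is_derive_scale. Qed.

Lemma is_derive_cosM a x : is_derive x 1 (fun y => cos (a * y)) (- a * sin (a * x)).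
Proof. by rewrite mulNr -mulrN; exact: is_derive_scale. Qed.

Lemma is_derive_expRM a x : is_derive x 1 (fun y => expR (a * y)) (a * expR (a * x)).
Proof. exact: is_derive_scale. Qed.

Lemma lipschitz_of_derive (f df : R -> R) (C x y : R) :
  (forall z : R, is_derive z 1 f (df z)) -> (forall z, `|df z| <= C) ->
  `|f x - f y| <= C * `|x - y|.
Proof.
move=> fd dC.
wlog xy : x y / y < x.
  have [xy|yx|->] := ltgtP x y; last by move=> _; rewrite !subrr normr0 mulr0.
    by move=> h; rewrite distrC (distrC x); exact: h.
  exact.
have [z _ ->] := @MVT R f df y x xy (fun z _ => fd z)
  (derivable_within_continuous (fun z _ => (fd z).(ex_derive))).
by rewrite normrM ler_wpM2r.
Qed.

Lemma norm_sin_le1 x : `|sin x| <= 1.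
Proof. by rewrite ler_norml sin_geN1 sin_le1. Qed.

Lemma norm_cos_le1 x : `|cos x| <= 1.
Proof. by rewrite ler_norml cos_geN1 cos_le1. Qed.

Lemma lipschitz_sin x y : `|sin x - sin y| <= `|x - y|.
Proof.
rewrite -[leRHS]mul1r; apply: (@lipschitz_of_derive _ cos) => z.
exact: norm_cos_le1.
Qed.

Lemma lipschitz_cos x y : `|cos x - cos y| <= `|x - y|.
Proof.
rewrite -[leRHS]mul1r; apply: (@lipschitz_of_derive _ (fun z => - sin z)) => z.
by rewrite normrN norm_sin_le1.
Qed.

Lemma one_sub_cos_ge0 x : 0 <= 1 - cos x.
Proof. by rewrite subr_ge0 cos_le1. Qed.

Lemma one_sub_cos_le_norm x : 1 - cos x <= `|x|.
Proof.
by have := lipschitz_cos 0 x; rewrite cos0 sub0r normrN; apply: le_trans; exact: ler_norm.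
Qed.

Lemma one_sub_cos_le2 x : 1 - cos x <= 2.
Proof. by have := cos_geN1 x; lra. Qed.

Lemma expR_decay a C (u : R -> R) : 0 < a -> (forall x, 0 <= x -> `|u x| <= C) ->
  expR (- a * x) * u x @[x --> +oo] --> 0.
Proof.
move=> a0 uC.
have h : expR (- a * x) * C @[x --> +oo] --> 0.
  rewrite -(mul0r C); apply: cvgMl.
  have /cvgrPdist_lt := @cvgr_expR R => h; apply/cvgrPdist_lt => e e0.
  have [M [Mr Mh]] := h e e0.
  exists (M / a); split; first by rewrite num_real.
  move=> x; rewrite ltr_pdivrMr// => Mx.
  by rewrite mulNr (mulrC a); exact: Mh.
apply: norm_cvg0; apply: (@squeeze_cvgr _ _ _ _ (cst 0) (fun x => expR (- a * x) * C)) => //.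
  near=> x; rewrite /= normr_ge0/= normrM ger0_norm ?expR_ge0//.
  by rewrite ler_wpM2l ?expR_ge0//; apply: uC; near: x; exact: nbhs_pinfty_ge.
exact: cvg_cst.
Unshelve. all: by end_near. Qed.

End calculus.

Section dirichlet.
Context {R : realType}.
Local Notation mu := (@lebesgue_measure R).
Implicit Types (a x y t : R).

Lemma integral_halfline_FTC (f F : R -> R) (l : R) :
  (forall x, 0 <= x -> 0 <= f x) -> (forall x, is_derive x 1 F (f x)) ->
  continuous f -> F x @[x --> +oo] --> l ->
  (\int[mu]_(x in `[0%R, +oo[) (f x)%:E = (l - F 0)%:E)%E.
Proof.
move=> f0 Fd cf Fl; rewrite EFinB; apply: ge0_continuous_FTC2y => //.
- exact: continuous_subspaceT.
- by apply: cvg_at_right_filter; exact: (is_derive_continuous (Fd 0)).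
- by move=> x _; rewrite derive1E; apply: derive_val.
Qed.

Lemma integral_exp_one_sub_cos a t : 0 < t ->
  (\int[mu]_(x in `[0%R, +oo[) (expR (- t * x) * (1 - cos (a * x)))%:E =
   (a ^+ 2 / (t * (t ^+ 2 + a ^+ 2)))%:E)%E.
Proof.
move=> t0; have t2 : 0 < t ^+ 2 + a ^+ 2 by rewrite ltr_pwDl ?exprn_gt0// sqr_ge0.
pose F x := expR (- t * x) * ((t * cos (a * x) - a * sin (a * x)) / (t ^+ 2 + a ^+ 2) - t^-1).
transitivity ((0 - F 0)%:E); first apply: integral_halfline_FTC.
- by move=> x _; rewrite mulr_ge0 ?expR_ge0 ?one_sub_cos_ge0.
- move=> x; rewrite /F.
  have := is_derive_sinM a x; have := is_derive_cosM a x; have := is_derive_expRM (- t) x.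
  move=> h1 h2 h3; apply: is_derive_eq; rewrite /GRing.scale/=.
  by field; rewrite !gt_eqF.
- move=> x; apply: (@is_derive_continuous _ _ _ (- t * expR (- t * x) * (1 - cos (a * x)) + expR (- t * x) * (a * sin (a * x)))).
  have := is_derive_cosM a x; have := is_derive_expRM (- t) x.
  by move=> h1 h2; apply: is_derive_eq; rewrite /GRing.scale/=; ring.
- apply: (@expR_decay _ _ ((t + `|a|) / (t ^+ 2 + a ^+ 2) + t^-1)) => // x.
  rewrite (le_trans (ler_normB _ _))// lerD//; last by rewrite ger0_norm// invr_ge0 ltW.
  rewrite normrM [X in _ * X]ger0_norm ?invr_ge0 ?(ltW t2)// ler_wpM2r ?invr_ge0 ?(ltW t2)//.
  rewrite (le_trans (ler_normB _ _))// !normrM lerD//.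
    by rewrite (gtr0_norm t0) ler_piMr ?(ltW t0)// norm_cos_le1.
  by rewrite ler_piMr// norm_sin_le1.
- congr EFin; rewrite /F !mulr0 expR0 cos0 sin0; field.
  by rewrite !gt_eqF.
Qed.

Lemma integral_t_exp x : 0 < x ->
  (\int[mu]_(t in `[0%R, +oo[) (t * expR (- x * t))%:E = ((x ^+ 2)^-1)%:E)%E.
Proof.
move=> x0.
pose F t := - (expR (- x * t) * (t / x + (x ^+ 2)^-1)).
transitivity ((0 - F 0)%:E); first apply: integral_halfline_FTC.
- by move=> t t0; rewrite mulr_ge0 ?expR_ge0.
- move=> t; rewrite /F; have := is_derive_expRM (- x) t.
  by move=> h1; apply: is_derive_eq; rewrite /GRing.scale/=; field; rewrite gt_eqF.
- move=> t; apply: (@is_derive_continuous _ _ _ (expR (- x * t) + t * (- x * expR (- x * t)))).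
  have := is_derive_expRM (- x) t.
  by move=> h1; apply: is_derive_eq; rewrite /GRing.scale/=; ring.
- rewrite -oppr0; apply: cvgN.
  (* split the exponential: one half absorbs the linear factor *)
  have x20 : 0 < x / 2 by rewrite divr_gt0.
  have -> : (fun t => expR (- x * t) * (t / x + (x ^+ 2)^-1)) =
      (fun t => expR (- (x / 2) * t) * (expR (- (x / 2) * t) * (t / x + (x ^+ 2)^-1))).
    apply/funext => t; rewrite mulrA -expRD; congr (expR _ * _); by field.
  apply: (@expR_decay _ _ (3 / x ^+ 2)) => // t t0.
  have u0 : 0 <= t / x + (x ^+ 2)^-1 by rewrite addr_ge0 ?divr_ge0 ?invr_ge0 ?sqr_ge0 ?(ltW x0).
  rewrite ger0_norm ?mulr_ge0 ?expR_ge0// mulNr expRN ler_pdivrMl ?expR_gt0//.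
  have := expR_ge1Dx (x / 2 * t); set E := expR _ => hE.
  have -> : t / x + (x ^+ 2)^-1 = (2 * (x / 2 * t) + 1) / x ^+ 2 by field; rewrite gt_eqF.
  rewrite [leRHS]mulrA ler_wpM2r ?invr_ge0 ?sqr_ge0//.
  have : 0 <= x / 2 * t by rewrite mulr_ge0// ltW.
  by move: hE; set q := x / 2 * t; nra.
- by congr EFin; rewrite /F !mulr0 mul0r expR0; field; rewrite gt_eqF.
Qed.

Lemma continuous_inv_sqr_add a : 0 < a -> continuous (fun t : R => a ^+ 2 / (t ^+ 2 + a ^+ 2)).
Proof.
move=> a0 t; apply: cvgM; first exact: cvg_cst.
apply: cvgV; first by rewrite gt_eqF// ltr_wpDl ?sqr_ge0 ?exprn_gt0.
by apply: cvgD; [exact: exprn_continuous|exact: cvg_cst].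
Qed.

Lemma integral_inv_sqr_add a : 0 < a ->
  (\int[mu]_(t in `[0%R, +oo[) (a ^+ 2 / (t ^+ 2 + a ^+ 2))%:E = (a * pi / 2)%:E)%E.
Proof.
move=> a0; have p0 t : t ^+ 2 + a ^+ 2 != 0 by rewrite gt_eqF// ltr_wpDl ?sqr_ge0 ?exprn_gt0.
pose F t := a * atan (a^-1 * t).
transitivity (((a * (pi / 2)) - F 0)%:E); first apply: integral_halfline_FTC.
- by move=> t t0; rewrite mulr_ge0 ?sqr_ge0// invr_ge0 addr_ge0 ?sqr_ge0.
- move=> t; rewrite /F; have h := is_derive_scale (is_derive1_atan (a^-1 * t)).
  apply: is_derive_eq; rewrite /GRing.scale/=.
  have q0 : 1 + (a^-1 * t) ^+ 2 != 0 by rewrite gt_eqF// ltr_pwDl ?sqr_ge0.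
  by field; rewrite p0 gt_eqF//= addrC p0.
- exact: continuous_inv_sqr_add.
- apply: cvgMr.
  have /cvgrPdist_lt h := @cvgy_atan R; apply/cvgrPdist_lt => e e0.
  have [M [Mr Mh]] := h e e0.
  exists (a * M); split; first by rewrite num_real.
  by move=> x Mx; apply: Mh; rewrite ltr_pdivlMl.
- by congr EFin; rewrite /F mulr0 atan0 mulr0 subr0 mulrA.
Qed.

Lemma measurable_cosT : measurable_fun setT (@cos R).
Proof. by apply: continuous_measurable_fun => x; exact: (is_derive_continuous (is_derive_cos x)). Qed.

Lemma measurable_sinT : measurable_fun setT (@sin R).
Proof. by apply: continuous_measurable_fun => x; exact: (is_derive_continuous (is_derive_sin x)). Qed.

Lemma measurable_invr : measurable_fun setT (fun x : R => x^-1).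
Proof.
rewrite -(setUv [set 0 : R]); apply/measurable_funU => //; first exact: measurableC.
split; first exact: measurable_fun_set1.
apply: open_continuous_measurable_fun; first exact: closed_openC.
by move=> x; rewrite inE/= => /eqP x0; exact: inv_continuous.
Qed.

(** Write [x ^- 2] as the integral of [t * e^{- t x}] over [t > 0]; after
    Tonelli the inner integral in [x] is a Laplace transform, and what is left
    is the derivative of the arctangent. *)
Lemma dirichlet_half a : 0 < a ->
  (\int[mu]_(x in `]0%R, +oo[) ((1 - cos (a * x)) / x ^+ 2)%:E = (a * pi / 2)%:E)%E.
Proof.
move=> a0; set D : set R := `]0%R, +oo[%classic.
have mD : measurable D by exact: measurable_itv.
have Dgt0 x : x \in D -> 0 < x by rewrite inE /D/= in_itv/= andbT.
pose Phi (z : R * R) := (z.2 * expR (- (z.1 * z.2)) * (1 - cos (a * z.1))) * (\1_D z.1 * \1_D z.2).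
have mPhi : measurable_fun setT Phi.
  apply: measurable_funM; first apply: measurable_funM; first apply: measurable_funM => //.
  - by do 2 apply: measurableT_comp => //; apply: measurable_funM.
  - by apply: measurable_funB => //; apply: (measurableT_comp measurable_cosT); apply: measurable_funM.
  - by apply: measurable_funM; apply: measurableT_comp => //; apply: measurable_indic; exact: measurable_itv.
have Phi0 z : 0 <= Phi z.
  rewrite /Phi !indicE; have [/Dgt0 h1|_] := boolP (z.1 \in D); last by rewrite mul0r mulr0.
  have [/Dgt0 h2|_] := boolP (z.2 \in D); last by rewrite !mulr0.
  by rewrite !mulr1 mulr_ge0 ?one_sub_cos_ge0// mulr_ge0 ?expR_ge0 ?ltW.
transitivity (\int[mu]_x \int[mu]_t (Phi (x, t))%:E)%E.
  rewrite integral_mkcond; apply: eq_integral => x _.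
  rewrite patchE /Phi/= !indicE; case: ifPn => [xD|_]; last first.
    by under eq_integral do rewrite mul0r mulr0; rewrite integral0.
  have x0 := Dgt0 _ xD.
  transitivity (\int[mu]_(t in D) (t * expR (- x * t) * (1 - cos (a * x)))%:E)%E; last first.
    rewrite integral_mkcond; apply: eq_integral => t _; rewrite patchE indicE mul1r mulNr.
    by case: ifPn; rewrite ?mulr1 ?mulr0.
  under eq_integral do rewrite EFinM.
  rewrite ge0_integralZr//.
  - rewrite integral_itv_obnd_cbnd ?integral_t_exp//; first by rewrite -EFinM mulrC.
    apply/measurable_EFinP; apply: measurable_funM => //.
    by apply: measurableT_comp => //; apply: measurable_funM.
  - apply/measurable_EFinP; apply: measurable_funM => //.
    by apply: measurableT_comp => //; apply: measurable_funM.
  - by move=> t tD; rewrite lee_fin mulr_ge0 ?expR_ge0// ltW// Dgt0// inE.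
rewrite (@fubini_tonelli _ _ _ _ _ mu mu (EFin \o Phi))//; last exact/measurable_EFinP.
rewrite -(integral_inv_sqr_add a0) -integral_itv_obnd_cbnd; last first.
  apply/measurable_EFinP; apply: measurable_funTS; apply: continuous_measurable_fun.
  exact: continuous_inv_sqr_add.
rewrite [RHS]integral_mkcond; apply: eq_integral => t _.
rewrite patchE /Phi/= !indicE; case: ifPn => [tD|_]; last first.
  by under eq_integral do rewrite !mulr0; rewrite integral0.
have t0 := Dgt0 _ tD.
transitivity (\int[mu]_(x in D) (t%:E * (expR (- t * x) * (1 - cos (a * x)))%:E))%E.
  rewrite [RHS]integral_mkcond; apply: eq_integral => x _; rewrite patchE indicE mulr1 mulNr (mulrC x).
  by case: ifPn; rewrite ?mulr1 ?mulr0// -EFinM mulrA.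
have mE : measurable_fun setT (fun x : R => expR (- t * x) * (1 - cos (a * x))).
  apply: measurable_funM; first by apply: measurableT_comp => //; apply: measurable_funM.
  by apply: measurable_funB => //; apply: (measurableT_comp measurable_cosT); apply: measurable_funM.
rewrite ge0_integralZl//.
- rewrite integral_itv_obnd_cbnd ?integral_exp_one_sub_cos//; last first.
    by apply/measurable_EFinP; exact: measurable_funTS.
  by rewrite -EFinM; congr EFin; field; rewrite !gt_eqF// ltr_pwDl ?exprn_gt0// sqr_ge0.
- by apply/measurable_EFinP; exact: measurable_funTS.
- by rewrite lee_fin ltW.
Qed.

Lemma ge0_even_integral (f : R -> R) : measurable_fun setT f ->
  (forall x, 0 <= f x) -> (forall x, f (- x) = f x) ->
  (\int[mu]_x (f x)%:E = 2%:E * \int[mu]_(x in `]0%R, +oo[) (f x)%:E)%E.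
Proof.
move=> mf f0 fe; set D : set R := `]0%R, +oo[%classic.
have mD : measurable D by exact: measurable_itv.
rewrite -(setUv D) ge0_integral_setU//=; first last.
- by apply/disj_setPCl.
- by move=> x _; rewrite lee_fin.
- by apply/measurable_EFinP; rewrite setUv.
- exact: measurableC.
rewrite mule_natl mule2n; congr (_ + _)%E.
have mf' A : measurable_fun A (EFin \o f) by apply/measurable_EFinP; exact: measurable_funTS.
rewrite (@integral_itv_obnd_cbnd _ 0 +oo%O (EFin \o f)) ?mf'//.
rewrite integral_mkcond -ge0_integral_oppr//=; first last.
- by move=> x; rewrite patchE; case: ifP => // _; rewrite lee_fin.
- by apply/(measurable_restrictT _ _).1 => //; exact: measurableC.
rewrite [RHS]integral_mkcond; apply: eq_integral => x _; rewrite !patchE.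
rewrite (_ : (- x \in ~` D) = (x \in `[0, +oo[%classic)); first by rewrite fe.
apply/idP/idP; rewrite !inE /D/= !in_itv/= !andbT oppr_gt0.
  by move=> /negP; rewrite -leNgt.
by move=> x0; apply/negP; rewrite -leNgt.
Qed.

Lemma measurable_dirichlet a : measurable_fun setT (fun x : R => (1 - cos (a * x)) / x ^+ 2).
Proof.
apply: measurable_funM.
  by apply: measurable_funB => //; apply: (measurableT_comp measurable_cosT); apply: measurable_funM.
by apply: (measurableT_comp measurable_invr); exact: measurable_funX.
Qed.

Lemma dirichlet_ge0 a x : 0 <= (1 - cos (a * x)) / x ^+ 2.
Proof. by rewrite mulr_ge0 ?one_sub_cos_ge0// invr_ge0 sqr_ge0. Qed.

(** The single improper integral on which both the Fejer kernel and the
    Hilbert transform of an exponential rest; the integrand is nonnegative, so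
    the integral converges absolutely. *)
Lemma dirichlet_integralE a :
  (\int[mu]_x ((1 - cos (a * x)) / x ^+ 2)%:E = (`|a| * pi)%:E)%E.
Proof.
wlog a0 : a / 0 <= a.
  move=> h; have [/h//|a0] := leP 0 a.
  rewrite -normrN -h ?oppr_ge0 ?ltW//; apply: eq_integral => x _.
  by rewrite mulNr cosN.
have [->|an0] := eqVneq a 0.
  under eq_integral do rewrite mul0r cos0 subrr mul0r.
  by rewrite integral0 normr0 mul0r.
have ap : 0 < a by rewrite lt_neqAle eq_sym an0.
rewrite ge0_even_integral ?dirichlet_half//.
- by rewrite -EFinM ger0_norm//; congr EFin; field.
- exact: measurable_dirichlet.
- by move=> x; exact: dirichlet_ge0.
- by move=> x; rewrite mulrN cosN sqrrN.
Qed.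

Lemma integrable_dirichlet a :
  mu.-integrable setT (fun x => ((1 - cos (a * x)) / x ^+ 2)%:E).
Proof.
apply/integrableP; split; first by apply/measurable_EFinP; exact: measurable_dirichlet.
under eq_integral do rewrite gee0_abs ?lee_fin ?dirichlet_ge0//.
by rewrite dirichlet_integralE ltry.
Qed.

Lemma Rintegral_dirichlet a : \int[mu]_x ((1 - cos (a * x)) / x ^+ 2) = `|a| * pi.
Proof. by rewrite /Rintegral dirichlet_integralE. Qed.

End dirichlet.

(** * The Fejer pair *)

Section almost_everywhere_point.
Context {R : realType}.
Local Notation mu := (@lebesgue_measure R).

Lemma Rintegral_eq_except (f g : R -> R) (p : R) : measurable_fun setT f ->
  measurable_fun setT g -> (forall x, x != p -> f x = g x) ->
  \int[mu]_x f x = \int[mu]_x g x.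
Proof.
move=> mf mg fg; rewrite /Rintegral; congr fine; apply: ae_eq_integral => //.
- exact/measurable_EFinP.
- exact/measurable_EFinP.
exists [set p]; split => //; first exact: lebesgue_measure_set1.
move=> x /=; apply: contra_notP => /eqP xp _; by rewrite fg.
Qed.

Lemma integrable_eq_except (f g : R -> R) (p : R) : measurable_fun setT f ->
  (forall x, x != p -> f x = g x) ->
  mu.-integrable setT (EFin \o g) -> mu.-integrable setT (EFin \o f).
Proof.
move=> mf fg ig; have p0 : mu [set p] = 0%E by exact: lebesgue_measure_set1.
apply/(@negligible_integrable _ _ _ mu setT [set p]) => //.
  by apply/measurable_EFinP.
have ig' : mu.-integrable (setT `\` [set p]) (EFin \o g).
  by apply: integrableS ig => //; exact: measurableD.
apply: eq_integrable ig'; first exact: measurableD.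
by move=> x; rewrite inE => -[_ /eqP xp] /=; rewrite fg.
Qed.

Lemma Rintegral_even (f : R -> R) : mu.-integrable setT (EFin \o f) ->
  (forall x, f (- x) = f x) ->
  \int[mu]_x f x = 2 * \int[mu]_(x in `]0, +oo[) f x.
Proof.
move=> intf fe; set D : set R := `]0%R, +oo[%classic.
have mf := integrable_measurable intf.
have mD : measurable D by exact: measurable_itv.
rewrite -(setUv D) Rintegral_setU//=; first last.
- by apply/disj_setPCl.
- by rewrite setUv.
- exact: measurableC.
rewrite -[2 * _]/(2%:R * _) mulr_natl mulr2n; congr (_ + _).
rewrite /D (@Rintegral_itv_obnd_cbnd _ 0 +oo%O f); last first.
  by apply: integrableS intf.
rewrite [LHS]Rintegral_mkcond -Rintegral_oppr; last first.
  apply/(measurable_restrictT _ _).1 => //; first exact: measurableC.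
  exact: measurable_funTS.
rewrite [RHS]Rintegral_mkcond; apply: eq_Rintegral => x _; rewrite !patchE.
rewrite (_ : (- x \in ~` D) = (x \in `[0, +oo[%classic)); first by rewrite fe.
apply/idP/idP; rewrite !inE /D/= !in_itv/= !andbT oppr_gt0.
  by move=> /negP; rewrite -leNgt.
by move=> x0; apply/negP; rewrite -leNgt.
Qed.

Lemma Rintegral_odd (f : R -> R) : mu.-integrable setT (EFin \o f) ->
  (forall x, f (- x) = - f x) -> \int[mu]_x f x = 0.
Proof.
move=> intf fo; have mf := integrable_measurable intf.
have : \int[mu]_x f x = - \int[mu]_x f x.
  rewrite -{1}Rintegral_oppr// -mulN1r -RintegralZl//.
  by apply: eq_Rintegral => x _; rewrite fo mulN1r.
by move=> h; lra.
Qed.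

End almost_everywhere_point.

Section fejer.
Context {R : realType}.
Local Notation mu := (@lebesgue_measure R).
Implicit Types (L x y z n u : R).

(** The real kernel replacing the exponential.  With it, square integrability
    and Fubini are only needed for real functions. *)
Definition cas x := cos x + sin x.

Lemma norm_cas_le x : `|cas x| <= 2.
Proof.
rewrite (le_trans (ler_normD _ _))//.
by have := norm_cos_le1 x; have := norm_sin_le1 x; lra.
Qed.

Lemma measurable_cas : measurable_fun setT cas.
Proof. by apply: measurable_funD; [exact: measurable_cosT|exact: measurable_sinT]. Qed.

Lemma cas_mul x y n : cas (n * x) * cas (n * y) =
  cos (n * (x - y)) + sin (n * (x + y)).
Proof. by rewrite /cas (mulrBr n) (mulrDr n) cosB sinD; ring. Qed.

Lemma cas_shift u z x : cas ((u + z) * x) =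
  cas (z * x) * cos (u * x) + (cos (z * x) - sin (z * x)) * sin (u * x).
Proof. by rewrite /cas mulrDl cosD sinD; ring. Qed.

(** The triangle of half-width [L], a compactly supported approximation of 1
    whose transform is nonnegative. *)
Definition tri L n : R := Num.max 0 (1 - `|n| / L).

Lemma tri_ge0 L n : 0 <= tri L n.
Proof. by rewrite /tri le_max lexx. Qed.

Lemma tri_le1 L n : 0 < L -> tri L n <= 1.
Proof. by move=> L0; rewrite /tri ge_max ler01/= gerBl divr_ge0// ltW. Qed.

Lemma cvg_tri n : tri k.+1%:R n @[k --> \oo] --> (1 : R).
Proof.
have h : 1 - `|n| * harmonic k @[k --> \oo] --> (1 : R).
  rewrite -[X in _ --> X]subr0; apply: cvgB; first exact: cvg_cst.
  by rewrite -(mulr0 `|n|); apply: cvgMr; exact: cvg_harmonic.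
apply: (@squeeze_cvgr _ _ _ _ _ (cst 1) _ _ _ h); last exact: cvg_cst.
by apply: nearW => k; rewrite /= tri_le1// andbT /tri le_max lexx orbT.
Qed.

Lemma triN L n : tri L (- n) = tri L n.
Proof. by rewrite /tri normrN. Qed.

Lemma tri_out L n : 0 < L -> L <= `|n| -> tri L n = 0.
Proof. by move=> L0 Ln; rewrite /tri; apply/max_idPl; rewrite subr_le0 ler_pdivlMr ?mul1r. Qed.

Lemma measurable_tri L : measurable_fun setT (tri L).
Proof.
apply: measurable_maxr => //; apply: measurable_funB => //.
by apply: measurable_funM => //; exact: measurableT_comp.
Qed.

Lemma integrable_tri_bounded L C (g : R -> R) : 0 < L -> measurable_fun setT g ->
  (forall n, `|g n| <= C) -> mu.-integrable setT (fun n => (tri L n * g n)%:E).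
Proof.
move=> L0 mg gC.
have C0 : 0 <= C := le_trans (normr_ge0 _) (gC 0).
have iI : mu.-integrable setT (EFin \o (fun n => C * \1_(`[- L, L]%classic : set R) n)).
  by apply: intZl => //; exact: integrable_indic_itv.
apply: (integrable_dominated measurableT _ iI).
  by apply: measurable_funM => //; exact: measurable_tri.
move=> n _; rewrite normrM ger0_norm ?tri_ge0// indicE.
have [nL|] := boolP (n \in _).
  by rewrite mulr1 -[leRHS]mul1r ler_pM ?tri_ge0 ?tri_le1.
rewrite mulr0 notin_setE/= in_itv/= -ler_norml => /negP; rewrite -ltNge => nL.
by rewrite tri_out ?mul0r// ltW.
Qed.

Definition fejer L u := \int[mu]_n (tri L n * cos (n * u)).

Lemma measurable_cosM u : measurable_fun setT (fun n : R => cos (n * u)).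
Proof. by apply: (measurableT_comp measurable_cosT); exact: measurable_funM. Qed.

Lemma measurable_sinM u : measurable_fun setT (fun n : R => sin (n * u)).
Proof. by apply: (measurableT_comp measurable_sinT); exact: measurable_funM. Qed.

Lemma measurable_casM u : measurable_fun setT (fun n : R => cas (n * u)).
Proof. by apply: (measurableT_comp measurable_cas); exact: measurable_funM. Qed.

Lemma integrable_tri_cos L u : 0 < L ->
  mu.-integrable setT (fun n => (tri L n * cos (n * u))%:E).
Proof.
move=> L0; apply: (integrable_tri_bounded (C := 1)) => //; first exact: measurable_cosM.
by move=> n; exact: norm_cos_le1.
Qed.

Lemma integrable_tri_sin L u : 0 < L ->
  mu.-integrable setT (fun n => (tri L n * sin (n * u))%:E).
Proof.
move=> L0; apply: (integrable_tri_bounded (C := 1)) => //; first exact: measurable_sinM.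
by move=> n; exact: norm_sin_le1.
Qed.

(** One integration by parts.  A single point, here [u = 0], does not affect
    the integrals in [u]. *)
Lemma fejerE L u : 0 < L -> u != 0 -> fejer L u = 2 * ((1 - cos (L * u)) / u ^+ 2) / L.
Proof.
move=> L0 u0; rewrite /fejer Rintegral_even; [|exact: integrable_tri_cos|]; last first.
  by move=> n; rewrite triN mulNr cosN.
have cf : continuous (fun x : R => (1 - x / L) * cos (u * x)).
  move=> x; apply: (@is_derive_continuous _ _ _ (- L^-1 * cos (u * x) + (1 - x / L) * (- u * sin (u * x)))).
  have := is_derive_cosM u x.
  by move=> h1; apply: is_derive_eq; rewrite /GRing.scale/=; field; rewrite gt_eqF.
have -> : \int[mu]_(x in `]0, +oo[) (tri L x * cos (x * u)) =
    \int[mu]_(x in `[0, L]) ((1 - x / L) * cos (u * x)).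
  rewrite -Rintegral_itv_obnd_cbnd; last first.
    apply: (@integrableS _ _ _ mu `[0, L]%classic) => //.
      by apply: subset_itvr; rewrite bnd_simp.
    by apply: continuous_compact_integrable; [exact: segment_compact|exact: continuous_subspaceT].
  rewrite Rintegral_mkcond [RHS]Rintegral_mkcond; apply: eq_Rintegral => x _.
  rewrite !patchE; case: ifPn; rewrite ?inE ?notin_setE/= !in_itv/= ?andbT => h; last first.
    by rewrite ifF//; apply/negP; rewrite inE/= in_itv/= => /andP[/h].
  have [xL|Lx] := leP x L.
    rewrite ifT ?inE/= ?in_itv/= ?h// mulrC [in RHS]mulrC [u * _]mulrC; congr (_ * _).
    by rewrite /tri (gtr0_norm h); apply/max_idPr; rewrite subr_ge0 ler_pdivrMr ?mul1r.
  rewrite ifF; last by apply/negP; rewrite inE/= in_itv/= leNgt Lx andbF.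
  by rewrite tri_out ?mul0r// (gtr0_norm h) ltW.
pose F (x : R) := (1 - x / L) * (sin (u * x) / u) - cos (u * x) / (L * u ^+ 2).
have Fd x : is_derive x 1 F ((1 - x / L) * cos (u * x)).
  rewrite /F; have := is_derive_sinM u x; have := is_derive_cosM u x.
  by move=> h1 h2; apply: is_derive_eq; rewrite /GRing.scale/=; field; rewrite u0 gt_eqF.
rewrite /Rintegral (@continuous_FTC2 _ _ F)//.
- by rewrite /= /F divff ?gt_eqF// !mulr0 sin0 cos0 [u * L]mulrC; field; rewrite u0 gt_eqF.
- exact: continuous_subspaceT.
- split.
  + by move=> x _.
  + by apply: cvg_at_right_filter; exact: (is_derive_continuous (Fd 0)).
  + by apply: cvg_at_left_filter; exact: (is_derive_continuous (Fd L)).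
- by move=> x _; rewrite derive1E; apply: derive_val.
Qed.

Lemma fejerN L u : fejer L (- u) = fejer L u.
Proof. by apply: eq_Rintegral => n _; rewrite mulrN cosN. Qed.

Lemma fejer_ge0 L u : 0 < L -> 0 <= fejer L u.
Proof.
move=> L0; have [->|u0] := eqVneq u 0.
  by apply: Rintegral_ge0 => n _; rewrite mulr0 cos0 mulr1 tri_ge0.
by rewrite fejerE// divr_ge0 ?(ltW L0)// mulr_ge0// divr_ge0 ?sqr_ge0// one_sub_cos_ge0.
Qed.

Lemma measurable_fejer L : measurable_fun setT (fejer L).
Proof.
apply: (@measurable_Rintegral_param _ _ _ _ R mu (fun p : R * R => tri L p.2 * cos (p.2 * p.1))).
apply: measurable_funM; first by apply: measurableT_comp => //; exact: measurable_tri.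
by apply: (measurableT_comp measurable_cosT); exact: measurable_funM.
Qed.

Lemma fejer_tail L u : 0 < L -> u != 0 -> fejer L u <= 4 / (L * u ^+ 2).
Proof.
move=> L0 u0; rewrite fejerE//.
have -> : 2 * ((1 - cos (L * u)) / u ^+ 2) / L = (2 * (1 - cos (L * u))) / (L * u ^+ 2).
  by field; rewrite u0 gt_eqF.
rewrite ler_wpM2r// ?invr_ge0; first by apply: mulr_ge0; [exact: ltW|exact: sqr_ge0].
by have := one_sub_cos_le2 (L * u); lra.
Qed.

(** Inverting the transform of the triangle amounts to Dirichlet integrals,
    because a product of cosines is a sum of cosines. *)
Lemma fejer_cosE L x u : 0 < L -> u != 0 -> fejer L u * cos (u * x) =
  L^-1 * ((1 - cos ((x + L) * u)) / u ^+ 2 + (1 - cos ((x - L) * u)) / u ^+ 2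
          - 2 * ((1 - cos (x * u)) / u ^+ 2)).
Proof.
move=> L0 u0; rewrite fejerE// (mulrDl x L) (mulrBl u x L) cosD cosB [u * x]mulrC.
by field; rewrite u0 gt_eqF.
Qed.

Lemma integrable_fejer_cos L x : 0 < L ->
  mu.-integrable setT (fun u => (fejer L u * cos (u * x))%:E).
Proof.
move=> L0; apply: (@integrable_eq_except _ _ _ 0 _ (fun u => fejer_cosE x L0)).
  by apply: measurable_funM; [exact: measurable_fejer|exact: measurable_cosM].
apply: intZl => //; apply: intB => //; first apply: intD => //.
- exact: integrable_dirichlet.
- exact: integrable_dirichlet.
- by apply: intZl => //; exact: integrable_dirichlet.
Qed.

(** The triangle is the second difference of [`|x|], which is what the
    Dirichlet integrals produce. *)
Lemma Rintegral_fejer_cos L x : 0 < L ->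
  \int[mu]_u (fejer L u * cos (u * x)) = 2 * pi * tri L x.
Proof.
move=> L0; have iD := @integrable_dirichlet R.
have iS a b c := intB measurableT (intD measurableT (iD a) (iD b)) (intZl 2 measurableT (iD c)).
rewrite (@Rintegral_eq_except _ _ _ 0 _ _ (fun u => fejer_cosE x L0)); first last.
- exact: (integrable_measurable (intZl L^-1 measurableT (iS (x + L) (x - L) x))).
- by apply: measurable_funM; [exact: measurable_fejer|exact: measurable_cosM].
rewrite RintegralZl//.
rewrite RintegralB//; [|exact: (intD measurableT (iD _) (iD _))|exact: (intZl 2 measurableT (iD _))].
pose D a (u : R) : R := (1 - cos (a * u)) / u ^+ 2.
rewrite (@RintegralD _ _ _ mu setT (D (x + L)) (D (x - L)))//; [|exact: iD|exact: iD].
rewrite (@RintegralZl _ _ _ mu setT (D x))//; last exact: iD.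
rewrite /D !Rintegral_dirichlet /tri.
have -> : L^-1 * (`|x + L| * pi + `|x - L| * pi - 2 * (`|x| * pi)) =
  pi * ((`|x + L| + `|x - L| - 2 * `|x|) / L) by ring.
rewrite [2 * pi]mulrC -mulrA; congr (_ * _).
have [xL|Lx] := leP `|x| L.
  rewrite (max_idPr _); last by rewrite subr_ge0 ler_pdivrMr ?mul1r.
  move: xL; rewrite ler_norml => /andP[h1 h2].
  rewrite (ger0_norm (_ : 0 <= x + L)) ?(ler0_norm (_ : x - L <= 0)); [|lra|lra].
  by field; rewrite gt_eqF.
rewrite (max_idPl _) ?mulr0; last by rewrite subr_le0 ler_pdivlMr ?mul1r// ltW.
suff -> : `|x + L| + `|x - L| - 2 * `|x| = 0 by rewrite mul0r.
move: Lx; rewrite lter_normr => /orP[h|h].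
  by rewrite !ger0_norm; lra.
by rewrite !ler0_norm; lra.
Qed.

Lemma integrable_fejer L : 0 < L -> mu.-integrable setT (EFin \o fejer L).
Proof.
move=> L0; have := integrable_fejer_cos 0 L0.
by apply: eq_integrable => // u _ /=; rewrite mulr0 cos0 mulr1.
Qed.

Lemma Rintegral_fejer L : 0 < L -> \int[mu]_u fejer L u = 2 * pi.
Proof.
move=> L0; have := Rintegral_fejer_cos 0 L0.
rewrite /tri normr0 mul0r subr0 (max_idPr _)// mulr1 => <-.
by apply: eq_Rintegral => u _; rewrite mulr0 cos0 mulr1.
Qed.

Lemma fejer_le L u : 0 < L -> fejer L u <= fejer L 0.
Proof.
move=> L0; apply: le_Rintegral => //.
- exact: integrable_tri_cos.
- exact: integrable_tri_cos.
by move=> n _; rewrite ler_wpM2l ?tri_ge0// mulr0 cos0 cos_le1.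
Qed.

Lemma integrable_fejer_bounded L C z (g : R -> R) : 0 < L -> measurable_fun setT g ->
  (forall n, `|g n| <= C) -> mu.-integrable setT (fun n => (fejer L (n - z) * g n)%:E).
Proof.
move=> L0 mg gC.
have := intZl C measurableT (integrable_shift (- z) (integrable_fejer L0)).
move/integrable_dominated; apply => //.
  by apply: measurable_funM => //; apply: measurableT_comp; [exact: measurable_fejer|exact: measurable_funB].
move=> n _; rewrite normrM ger0_norm ?fejer_ge0// mulrC.
by rewrite ler_wpM2r ?fejer_ge0.
Qed.

(** The kernels of the summation method: this one comes from composing the
    transform with itself, the next one from transforming a translated Fejer
    kernel.  In both, the sine terms vanish by parity. *)
Lemma Rintegral_tri_cas L x y : 0 < L ->
  \int[mu]_n (tri L n * cas (n * x) * cas (n * y)) = fejer L (x - y).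
Proof.
move=> L0.
under eq_Rintegral do rewrite -mulrA cas_mul mulrDr.
rewrite RintegralD//; [|exact: integrable_tri_cos|exact: integrable_tri_sin].
rewrite (@Rintegral_odd _ (fun n => tri L n * sin (n * (x + y)))) ?addr0//.
  exact: integrable_tri_sin.
by move=> n; rewrite triN mulNr sinN mulrN.
Qed.

Lemma Rintegral_fejer_cas L z x : 0 < L ->
  \int[mu]_n (fejer L (n - z) * cas (n * x)) = 2 * pi * tri L x * cas (z * x).
Proof.
move=> L0.
have mg : measurable_fun setT (fun n => fejer L (n - z) * cas (n * x)).
  apply: measurable_funM; last exact: measurable_casM.
  by apply: measurableT_comp; [exact: measurable_fejer|exact: measurable_funB].
rewrite -(Rintegral_shift z mg).
under eq_Rintegral do rewrite addrK cas_shift mulrDr mulrCA (mulrCA (fejer L _)).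
have ic := integrable_fejer_cos x L0.
have is_ : mu.-integrable setT (fun u => (fejer L u * sin (u * x))%:E).
  have := integrable_fejer_bounded 0 L0 (measurable_sinM x) (fun n => norm_sin_le1 _).
  by under eq_fun do rewrite subr0.
rewrite RintegralD//; [|exact: intZl|exact: intZl].
rewrite !RintegralZl// Rintegral_fejer_cos// (@Rintegral_odd _ (fun u => fejer L u * sin (u * x)))//.
  by rewrite mulr0 addr0 mulrC.
by move=> u; rewrite fejerN mulNr sinN mulrN.
Qed.

End fejer.

(** * The Hartley transform on square integrable functions *)

(* only the properties of the kernels proved so far enter the L2 theory *)
Opaque fejer tri cas.

Section hartley.
Context {R : realType}.
Local Notation mu := (@lebesgue_measure R).
Implicit Types (L x y z n u N : R) (f g h phi : R -> R).

Definition hartley h x := \int[mu]_n (h n * cas (n * x)).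

Lemma measurable_hartley h : measurable_fun setT h -> measurable_fun setT (hartley h).
Proof.
move=> mh.
apply: (@leb_measurable_Rint R (fun p : R * R => h p.2 * cas (p.2 * p.1))).
apply: measurable_funM; first exact: measurableT_comp.
by apply: (measurableT_comp measurable_cas); exact: measurable_funM.
Qed.

Lemma integrable_mul_bounded C h g : mu.-integrable setT (EFin \o h) ->
  measurable_fun setT g -> (forall x, `|g x| <= C) ->
  mu.-integrable setT (fun x => (h x * g x)%:E).
Proof.
move=> ih mg gC; have mh := integrable_measurable ih.
apply: (integrable_dominated measurableT _ (intZl C measurableT (integrable_norm ih))).
  exact: measurable_funM.
by move=> x _ /=; rewrite normrM mulrC ler_wpM2r.
Qed.

Lemma integrable_hartley_integrand h x : mu.-integrable setT (EFin \o h) ->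
  mu.-integrable setT (fun n => (h n * cas (n * x))%:E).
Proof.
move=> ih; apply: (integrable_mul_bounded ih); first exact: measurable_casM.
by move=> n; exact: norm_cas_le.
Qed.

Lemma norm_hartley_le h x : mu.-integrable setT (EFin \o h) ->
  `|hartley h x| <= 2 * \int[mu]_n `|h n|.
Proof.
move=> ih; have ihc := integrable_hartley_integrand x ih.
apply: (le_trans (le_normr_Rintegral measurableT ihc)).
rewrite -RintegralZl//; last exact: integrable_norm.
apply: le_Rintegral => //; first exact: integrable_norm.
  by apply: intZl => //; exact: integrable_norm.
by move=> n _; rewrite normrM mulrC ler_wpM2r ?norm_cas_le.
Qed.

Lemma hartleyB h g x : mu.-integrable setT (EFin \o h) -> mu.-integrable setT (EFin \o g) ->
  hartley (fun n => h n - g n) x = hartley h x - hartley g x.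
Proof.
move=> ih ig; rewrite /hartley -RintegralB//; try exact: integrable_hartley_integrand.
by apply: eq_Rintegral => n _; rewrite mulrBl.
Qed.

(** The kernel [cas (x * y)] is symmetric in its two variables: this is
    Fubini's theorem. *)
Lemma hartley_adjoint f g : mu.-integrable setT (EFin \o f) ->
  mu.-integrable setT (EFin \o g) ->
  \int[mu]_x (f x * hartley g x) = \int[mu]_x (g x * hartley f x).
Proof.
move=> if_ ig; have mf := integrable_measurable if_; have mg := integrable_measurable ig.
pose Phi (p : R * R) := (f p.1 * g p.2) * cas (p.2 * p.1).
have mPhi : measurable_fun setT Phi.
  apply: measurable_funM; first by apply: measurable_funM; exact: measurableT_comp.
  by apply: (measurableT_comp measurable_cas); exact: measurable_funM.
have i2 : mu.-integrable setT (EFin \o (fun x => 2 * f x)) by exact: intZl.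
have Plty := leb_tensor_lty mPhi i2 ig.
transitivity (\int[mu]_x \int[mu]_y Phi (x, y)).
  apply: eq_Rintegral => x _; rewrite /hartley -RintegralZl//; last exact: integrable_hartley_integrand.
  by apply: eq_Rintegral => y _; rewrite /Phi/= mulrA.
rewrite leb_fubini//; last first.
  apply: Plty => x y; rewrite /Phi/= !normrM [`|2|]ger0_norm//.
  rewrite [leRHS](_ : _ = (`|f x| * `|g y|) * 2); last by ring.
  by rewrite ler_wpM2l ?norm_cas_le// mulr_ge0.
apply: eq_Rintegral => y _; rewrite /hartley -RintegralZl//; last exact: integrable_hartley_integrand.
by apply: eq_Rintegral => x _; rewrite /Phi/= mulrA [f x * g y]mulrC [y * x]mulrC.
Qed.

Lemma integrable_tri_casM L x : 0 < L ->
  mu.-integrable setT (fun n => (tri L n * cas (n * x))%:E).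
Proof.
move=> L0; apply: (integrable_tri_bounded (C := 2)) => //; first exact: measurable_casM.
by move=> n; exact: norm_cas_le.
Qed.

Lemma hartley_tri_cas L x y : 0 < L ->
  hartley (fun n => tri L n * cas (n * x)) y = fejer L (x - y).
Proof. exact: Rintegral_tri_cas. Qed.

Lemma hartley_fejer L z x : 0 < L ->
  hartley (fun n => fejer L (n - z)) x = 2 * pi * tri L x * cas (z * x).
Proof. exact: Rintegral_fejer_cas. Qed.

(** Schur's test: split the product [`|phi x| * `|phi y|] into half squares;
    the Fejer kernel, of mass [2 * pi], integrates out the other variable. *)
Lemma fejer_schur L phi : 0 < L -> sqint mu phi ->
  (\int[mu]_x \int[mu]_y (`|phi x| * `|phi y| * fejer L (x - y))%:E <=
   (2 * pi * \int[mu]_x (phi x ^+ 2))%:E)%E.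
Proof.
move=> L0 [mphi iphi2].
have F0 u : 0 <= fejer L u by exact: fejer_ge0.
have mF : measurable_fun setT (fun p : R * R => fejer L (p.1 - p.2)).
  by apply: measurableT_comp; [exact: measurable_fejer|exact: measurable_funB].
pose P (p : R * R) := (phi p.1 ^+ 2 / 2 * fejer L (p.1 - p.2))%:E.
pose Q (p : R * R) := (phi p.2 ^+ 2 / 2 * fejer L (p.1 - p.2))%:E.
have mP : measurable_fun setT P.
  apply/measurable_EFinP; apply: measurable_funM => //; apply: measurable_funM => //.
  by apply: measurable_funX; exact: measurableT_comp.
have mQ : measurable_fun setT Q.
  apply/measurable_EFinP; apply: measurable_funM => //; apply: measurable_funM => //.
  by apply: measurable_funX; exact: measurableT_comp.
have P0 p : (0 <= P p)%E by rewrite lee_fin mulr_ge0// divr_ge0 ?sqr_ge0.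
have Q0 p : (0 <= Q p)%E by rewrite lee_fin mulr_ge0// divr_ge0 ?sqr_ge0.
have iF : (\int[mu]_u (fejer L u)%:E = (2 * pi)%:E)%E.
  rewrite -(Rintegral_fejer L0) /Rintegral fineK//.
  by apply: integrable_fin_num => //; exact: integrable_fejer.
have mF1 : measurable_fun setT (fun u => (fejer L u)%:E) by apply/measurable_EFinP; exact: measurable_fejer.
have half c z : (0 <= c)%R -> (\int[mu]_u (c * fejer L (z - u))%:E = (c * (2 * pi))%:E)%E.
  move=> c0; under eq_integral do rewrite EFinM.
  rewrite ge0_integralZl//; last 2 first.
  - by apply/measurable_EFinP; apply: measurableT_comp; [exact: measurable_fejer|exact: measurable_funB].
  - by move=> u _; rewrite lee_fin.
  by rewrite (@ge0_integral_reflect _ (fun u => (fejer L u)%:E))// iF.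
have i2 : (\int[mu]_x (phi x ^+ 2 / 2 * (2 * pi))%:E = (pi * \int[mu]_x (phi x ^+ 2))%:E)%E.
  rewrite -RintegralZl// /Rintegral fineK//; last first.
    by apply: integrable_fin_num => //; exact: intZl.
  by apply: eq_integral => x _; congr EFin; field.
have IP : (\int[mu]_x \int[mu]_y P (x, y) = (pi * \int[mu]_x (phi x ^+ 2))%:E)%E.
  rewrite -i2; apply: eq_integral => x _.
  by rewrite -(half _ x) ?divr_ge0 ?sqr_ge0.
have IQ : (\int[mu]_x \int[mu]_y Q (x, y) = (pi * \int[mu]_x (phi x ^+ 2))%:E)%E.
  rewrite (leb_tonelli mQ Q0) -i2; apply: eq_integral => y _.
  transitivity (\int[mu]_x (phi y ^+ 2 / 2 * fejer L (y - x))%:E)%E; last first.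
    by apply: half; rewrite divr_ge0 ?sqr_ge0.
  by apply: eq_integral => x _; rewrite /Q/= -(fejerN _ (y - x)) opprB.
rewrite (_ : 2 * pi * \int[mu]_x (phi x ^+ 2) = pi * \int[mu]_x (phi x ^+ 2) + pi * \int[mu]_x (phi x ^+ 2)); last by ring.
rewrite EFinD -{1}IP -IQ -ge0_integralD//; first last.
- exact: (@leb_measurable_F R Q).
- by move=> x _; exact: integral_ge0.
- exact: (@leb_measurable_F R P).
- by move=> x _; exact: integral_ge0.
pose W (p : R * R) := (`|phi p.1| * `|phi p.2| * fejer L (p.1 - p.2))%:E.
have mW : measurable_fun setT W.
  apply/measurable_EFinP; apply: measurable_funM => //; apply: measurable_funM => //.
    by do 2 apply: measurableT_comp => //.
  by do 2 apply: measurableT_comp => //.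
have W0 p : (0 <= W p)%E by rewrite lee_fin !mulr_ge0.
apply: ge0_le_integral => //.
- by move=> x _; apply: integral_ge0 => y _; exact: (W0 (x, y)).
- exact: (@leb_measurable_F R W).
- apply: emeasurable_funD.
    exact: (@leb_measurable_F R P).
  exact: (@leb_measurable_F R Q).
move=> x _.
have sec (G : R * R -> \bar R) : measurable_fun setT G -> measurable_fun setT (fun y => G (x, y)).
  by move=> mG; apply: (measurableT_comp mG); exact: measurable_fun_pair.
rewrite -ge0_integralD//; [|exact: sec|exact: sec].
apply: ge0_le_integral => //.
- by move=> y _; exact: (W0 (x, y)).
- exact: (sec W).
- by apply: emeasurable_funD; exact: sec.
move=> y _; rewrite /P /Q/= -EFinD lee_fin -mulrDl ler_wpM2r//.
rewrite -(real_normK (num_real (phi x))) -(real_normK (num_real (phi y))).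
by move: `|phi x| `|phi y| => a b; have := sqr_ge0 (a - b); nra.
Qed.

Lemma sqint_le f g : measurable_fun setT f -> sqint mu g -> (forall x, `|f x| <= `|g x|) ->
  sqint mu f.
Proof.
move=> mf [mg ig] fg; split => //.
apply: (integrable_dominated measurableT _ ig); first exact: measurable_funX.
move=> x _; rewrite normrX -[leRHS]real_normK ?num_real// lerXn2r ?nnegrE//.
Qed.

Lemma sqint_bound f C : measurable_fun setT f ->
  (\int[mu]_x (f x ^+ 2)%:E <= C%:E)%E -> sqint mu f /\ \int[mu]_x (f x ^+ 2) <= C.
Proof.
move=> mf fC; have i2 : (\int[mu]_x (f x ^+ 2)%:E \is a fin_num)%E.
  rewrite ge0_fin_numE ?(le_lt_trans fC) ?ltry//.
  by apply: integral_ge0 => x _; rewrite lee_fin sqr_ge0.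
split; last by rewrite -lee_fin /Rintegral fineK.
split => //; apply/integrableP; split.
  by apply/measurable_EFinP; exact: measurable_funX.
under eq_integral do rewrite /= ger0_norm ?sqr_ge0//.
by rewrite (le_lt_trans fC) ?ltry.
Qed.

Lemma sqint_EFin f : sqint mu f ->
  (\int[mu]_x (f x ^+ 2)%:E = (\int[mu]_x (f x ^+ 2))%:E)%E.
Proof. by move=> [_ i2]; rewrite /Rintegral fineK//; exact: integrable_fin_num. Qed.

Lemma integrable_tri_hartley L phi : 0 < L -> mu.-integrable setT (EFin \o phi) ->
  mu.-integrable setT (fun n => (tri L n * hartley phi n)%:E).
Proof.
move=> L0 ip; apply: (integrable_tri_bounded (C := 2 * \int[mu]_n `|phi n|)) => //.
  by apply: measurable_hartley; exact: (integrable_measurable ip).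
by move=> n; exact: norm_hartley_le.
Qed.

(** By two applications of self-adjointness the left-hand side is the
    quadratic form of the Fejer kernel at [phi], which Schur's test bounds. *)
Lemma integral_tri_hartley_sq L phi : 0 < L -> mu.-integrable setT (EFin \o phi) ->
  sqint mu phi ->
  \int[mu]_n (tri L n * hartley phi n ^+ 2) <= 2 * pi * \int[mu]_x (phi x ^+ 2).
Proof.
move=> L0 ip sp; have mp := integrable_measurable ip.
have -> : \int[mu]_n (tri L n * hartley phi n ^+ 2) =
    \int[mu]_x (phi x * \int[mu]_y (phi y * fejer L (x - y))).
  transitivity (\int[mu]_n ((tri L n * hartley phi n) * hartley phi n)).
    by apply: eq_Rintegral => n _; rewrite expr2 mulrA.
  rewrite (hartley_adjoint (integrable_tri_hartley L0 ip) ip).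
  apply: eq_Rintegral => x _; congr (_ * _).
  transitivity (\int[mu]_n ((tri L n * cas (n * x)) * hartley phi n)).
    by apply: eq_Rintegral => n _; rewrite mulrAC.
  rewrite (hartley_adjoint (integrable_tri_casM x L0) ip).
  by apply: eq_Rintegral => y _; rewrite hartley_tri_cas.
have isec x : mu.-integrable setT (fun y => (phi y * fejer L (x - y))%:E).
  apply: (integrable_mul_bounded (C := fejer L 0) ip).
    by apply: measurableT_comp; [exact: measurable_fejer|exact: measurable_funB].
  by move=> y; rewrite ger0_norm ?fejer_ge0// fejer_le.
have mF : measurable_fun setT (fun p : R * R => fejer L (p.1 - p.2)).
  by apply: measurableT_comp; [exact: measurable_fejer|exact: measurable_funB].
have mPf : measurable_fun setT (fun p : R * R => phi p.2 * fejer L (p.1 - p.2)).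
  by apply: measurable_funM => //; exact: measurableT_comp.
rewrite -lee_fin; apply: le_trans (fejer_schur L0 sp).
apply: (@le_trans _ _ (\int[mu]_x `|(phi x * \int[mu]_y (phi y * fejer L (x - y)))%:E|)%E).
  apply: EFin_Rintegral_le; apply: measurable_funM => //.
  exact: (@leb_measurable_Rint R (fun p : R * R => phi p.2 * fejer L (p.1 - p.2))).
apply: ge0_le_integral => //.
- apply: measurableT_comp => //; apply/measurable_EFinP; apply: measurable_funM => //.
  apply: (@leb_measurable_Rint R (fun p : R * R => phi p.2 * fejer L (p.1 - p.2))).
  exact: mPf.
- apply: (@leb_measurable_F R (fun p : R * R => (`|phi p.1| * `|phi p.2| * fejer L (p.1 - p.2))%:E)).
    apply/measurable_EFinP; apply: measurable_funM; last exact: mF.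
    by apply: measurable_funM; do 2 apply: measurableT_comp => //.
  by move=> p; rewrite lee_fin !mulr_ge0// fejer_ge0.
move=> x _; rewrite /= normrM.
apply: (@le_trans _ _ (`|phi x| * \int[mu]_y `|phi y * fejer L (x - y)|)%:E).
  rewrite lee_fin; apply: ler_wpM2l; first exact: normr_ge0.
  exact: (le_normr_Rintegral measurableT (isec x)).
have isn : mu.-integrable setT (EFin \o (fun y => `|phi y * fejer L (x - y)|)).
  exact: (integrable_norm (isec x)).
rewrite -(RintegralZl _ measurableT isn) /Rintegral fineK; last first.
  by apply: integrable_fin_num => //; exact: (intZl _ measurableT isn).
rewrite le_eqVlt; apply/orP; left; apply/eqP; apply: eq_integral => y _.
by rewrite normrM (ger0_norm (fejer_ge0 _ L0)) mulrA.
Qed.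

(** Bessel's inequality: let the triangle grow to 1 in the previous bound. *)
Lemma hartley_bessel phi : mu.-integrable setT (EFin \o phi) -> sqint mu phi ->
  sqint mu (hartley phi) /\
  \int[mu]_n (hartley phi n ^+ 2) <= 2 * pi * \int[mu]_x (phi x ^+ 2).
Proof.
move=> ip sp; have mp := integrable_measurable ip.
have mh := measurable_hartley mp.
apply: sqint_bound => //.
have k0 (k : nat) : 0 < k.+1%:R :> R by rewrite ltr0n.
apply: (@fatou_le _ _ _ mu (fun k n => tri k.+1%:R n * hartley phi n ^+ 2) _
  (fun=> 2 * pi * \int[mu]_x (phi x ^+ 2))).
- by move=> k; apply: measurable_funM; [exact: measurable_tri|exact: measurable_funX].
- by move=> k n; rewrite mulr_ge0 ?tri_ge0 ?sqr_ge0.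
- exact: measurable_funX.
- apply: aeW => n; rewrite -[X in _ --> X]mul1r; apply: cvgMl.
  exact: cvg_tri.
- move=> k; apply: (@le_trans _ _ (\int[mu]_n (tri k.+1%:R n * hartley phi n ^+ 2))%:E); last first.
    by rewrite lee_fin; exact: (integral_tri_hartley_sq (k0 k) ip sp).
  rewrite /Rintegral fineK//; apply: integrable_fin_num => //.
  have := integrable_mul_bounded (integrable_tri_hartley (k0 k) ip) mh (fun n => norm_hartley_le n ip).
  by apply: eq_integrable => // n _ /=; rewrite expr2 mulrA.
- exact: cvg_cst.
- by move=> n; exact: sqr_ge0.
Qed.

Definition cut f N x := f x * \1_(`[- N, N]%classic : set R) x.

Lemma cutE f N x : cut f N x = if `|x| <= N then f x else 0.
Proof.
rewrite /cut indicE ler_norml; case: ifPn => h.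
  by rewrite mem_set ?mulr1//= in_itv.
by rewrite memNset ?mulr0//= in_itv; exact/negP.
Qed.

Lemma norm_cut_le f N x : `|cut f N x| <= `|f x|.
Proof. by rewrite cutE; case: ifP; rewrite ?normr0. Qed.

Lemma measurable_cut f N : measurable_fun setT f -> measurable_fun setT (cut f N).
Proof. by move=> mf; apply: measurable_funM => //; apply: measurable_indic; exact: measurable_itv. Qed.

Lemma sqint_cut f N : sqint mu f -> sqint mu (cut f N).
Proof.
move=> sf; apply: (sqint_le _ sf); first by apply: measurable_cut; case: sf.
exact: norm_cut_le.
Qed.

Lemma integrable_cut f N : sqint mu f -> mu.-integrable setT (EFin \o cut f N).
Proof.
move=> [mf i2]; have := intD measurableT i2 (@integrable_indic_itv R (- N) N true false).
move/integrable_dominated; apply => //; first exact: measurable_cut.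
move=> x _; rewrite cutE indicE; case: ifPn => h; last first.
  by rewrite normr0 addr_ge0 ?sqr_ge0.
rewrite mem_set; last by rewrite /= in_itv/= -ler_norml.
rewrite -(real_normK (num_real (f x))).
rewrite (_ : true%:R = 1 :> R)//.
by have := sqr_ge0 (`|f x| - 1); have := normr_ge0 (f x); move: `|f x| => a; nra.
Qed.

Definition tail f N := \int[mu]_x ((f x - cut f N x) ^+ 2).

Lemma sqint_tail f N : sqint mu f -> sqint mu (fun x => f x - cut f N x).
Proof. by move=> sf; apply: sqintB => //; exact: sqint_cut. Qed.

Lemma tail_ge0 f N : 0 <= tail f N.
Proof. exact: sqint_sq_ge0. Qed.

Lemma cvg_tail f : sqint mu f -> tail f N @[N --> +oo] --> 0.
Proof.
move=> sf; have [mf i2] := sf; apply/cvg_pinftyP => v vy.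
have -> : (0 : R) = \int[mu]_x (cst 0 x : R) by rewrite Rintegral_cst//= mul0r.
apply: (cvg_Rintegral_dominated measurableT _ _ _ i2) => //.
- by move=> n; apply: measurable_funX; apply: measurable_funB => //; exact: measurable_cut.
- apply: aeW => x _; apply: cvg_near_cst.
  move/cvgryPge : vy => /(_ `|x|); apply: filterS => n h.
  by rewrite cutE h subrr expr0n.
- move=> n x _; rewrite ger0_norm ?sqr_ge0// cutE.
  by case: ifP; rewrite ?subr0// subrr expr0n sqr_ge0.
Qed.

Lemma hartley_cut_diff f N M : sqint mu f ->
  sqint mu (fun n => hartley (cut f N) n - hartley (cut f M) n) /\
  \int[mu]_n ((hartley (cut f N) n - hartley (cut f M) n) ^+ 2) <=
    2 * pi * (tail f N + tail f M).
Proof.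
move=> sf; have iN := integrable_cut N sf; have iM := integrable_cut M sf.
have sNM : sqint mu (fun x => cut f N x - cut f M x) by apply: sqintB; exact: sqint_cut.
have e : (fun n => hartley (cut f N) n - hartley (cut f M) n) =
         hartley (fun x => cut f N x - cut f M x).
  by apply/funext => n; rewrite hartleyB.
have [h1 h2] := hartley_bessel (intB measurableT iN iM) sNM.
rewrite e; split => //.
rewrite (_ : \int[mu]_n _ = \int[mu]_n (hartley (fun x => cut f N x - cut f M x) n ^+ 2)); last first.
  by apply: eq_Rintegral => n _; rewrite hartleyB.
apply: (le_trans h2); rewrite ler_wpM2l ?mulr_ge0 ?pi_ge0//.
have [_ tN] := sqint_tail N sf; have [_ tM] := sqint_tail M sf; have [_ tNM] := sNM.
rewrite -RintegralD//; apply: le_Rintegral => //; first exact: intD.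
move=> x _; rewrite !cutE.
by case: ifP; case: ifP => _ _; have := sqr_ge0 (f x); rewrite ?subrr ?subr0 ?sub0r ?sqrrN ?expr0n/=; lra.
Qed.

Lemma sum_half k : \sum_(0 <= j < k) ((2^-1 : R) ^+ j) = 2 - 2 * (2^-1) ^+ k.
Proof.
elim: k => [|k ih]; first by rewrite big_nil expr0; ring.
by rewrite big_nat_recr//= ih exprS; field.
Qed.

(** The Riesz-Fischer argument, carried out on representatives.  The series of
    [2 ^ j * d j n ^ 2] has a finite integral, hence converges for almost
    every [n], and it dominates the series of the [`|d j n|] up to a
    geometric series. *)
Lemma ae_cvg_fast (G : nat -> R -> R) C :
  (forall j, measurable_fun setT (G j)) ->
  (forall j, sqint mu (fun n => G j.+1 n - G j n) /\
     \int[mu]_n ((G j.+1 n - G j n) ^+ 2) <= C * (4^-1) ^+ j) ->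
  exists V : R -> R, measurable_fun setT V /\
    {ae mu, forall n, G j n @[j --> \oo] --> V n}.
Proof.
move=> mG dG.
pose d j n := G j.+1 n - G j n.
have md j : measurable_fun setT (d j) by exact: measurable_funB.
have C0 : 0 <= C.
  by have [_ h] := dG 0%N; move: h; rewrite expr0 mulr1; apply: le_trans; exact: sqint_sq_ge0.
pose t j n := (2 ^+ j * d j n ^+ 2 : R).
have t0 j n : 0 <= t j n by apply: mulr_ge0; [exact: exprn_ge0|exact: sqr_ge0].
have mt j : measurable_fun setT (fun n => (t j n)%:E).
  by apply/measurable_EFinP; apply: measurable_funM => //; exact: measurable_funX.
pose S n := (\sum_(0 <= j <oo) (t j n)%:E)%E.
have it j : (\int[mu]_n (t j n)%:E <= (C * (2^-1) ^+ j)%:E)%E.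
  have [sd dC] := dG j.
  under eq_integral do rewrite EFinM.
  rewrite ge0_integralZl//; last 2 first.
  - exact: ((measurable_EFinP _ _).2 (measurable_funX 2 (md j))).
  - by move=> n _; rewrite lee_fin sqr_ge0.
  rewrite (sqint_EFin sd) -EFinM lee_fin.
  rewrite (_ : C * 2^-1 ^+ j = 2 ^+ j * (C * (4^-1) ^+ j)); first by rewrite ler_wpM2l// exprn_ge0.
  rewrite mulrCA -exprMn; congr (_ * _ ^+ _); by field.
have iS : (\int[mu]_n S n < +oo)%E.
  rewrite /S integral_nneseries//; last by move=> j n _; rewrite lee_fin.
  apply: (@le_lt_trans _ _ (C * 2)%:E); last by rewrite ltry.
  apply: lime_le; first by apply: is_cvg_nneseries => j _ _; apply: integral_ge0 => n _; rewrite lee_fin.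
  apply: nearW => k.
  apply: (@le_trans _ _ (\sum_(0 <= j < k) (C * (2^-1) ^+ j)%:E)%E); first exact: lee_sum.
  rewrite sumEFin lee_fin -mulr_sumr ler_wpM2l// sum_half gerBl mulr_ge0// exprn_ge0//.
have S0 n : (0 <= S n)%E by apply: nneseries_ge0 => j _ _; rewrite lee_fin.
have mS : measurable_fun setT S.
  by apply: ge0_emeasurable_sum => // j n _ _; rewrite lee_fin.
have iS' : mu.-integrable setT S.
  by apply/integrableP; split => //; under eq_integral do rewrite gee0_abs//.
pose V n := fine (limn_esup (fun j => (G j n)%:E)).
exists V; split.
  apply: (measurableT_comp (fine_measurable measurableT)).
  by apply: measurable_fun_limn_esup => j; exact/measurable_EFinP.
apply: (leb_aeS (integrable_ae measurableT iS')) => n /(_ I) Sn.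
suff /cvg_ex[l cl] : cvg (G j n @[j --> \oo]).
  have cE : (G j n)%:E @[j --> \oo] --> l%:E by apply/cvg_EFin => //; exact: nearW.
  by have [_ e] := cvg_limn_einf_sup cE; rewrite /V e.
have cd : cvgn (series (fun j => `|d j n|)).
  apply: nondecreasing_is_cvgn.
    by apply/nondecreasing_seqP => k; rewrite !seriesEnat/= big_nat_recr//= lerDl.
  exists (2^-1 * (fine (S n) + 2)) => _ [k _ <-].
  rewrite seriesEnat/=.
  apply: (@le_trans _ _ (\sum_(0 <= j < k) (2^-1 * (t j n + (2^-1) ^+ j)))).
    apply: ler_sum => j _; rewrite /t.
    rewrite -(real_normK (num_real (d j n))); move: `|d j n| => a.
    have p0 : 0 < 2 ^+ j :> R by rewrite exprn_gt0.
    rewrite exprVn -subr_ge0.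
    rewrite (_ : _ - a = 2^-1 * (2 ^+ j)^-1 * (2 ^+ j * a - 1) ^+ 2); last by field; rewrite gt_eqF.
    by rewrite mulr_ge0 ?sqr_ge0// mulr_ge0// invr_ge0 ltW.
  rewrite -mulr_sumr ler_wpM2l// big_split/= lerD//; last first.
    by rewrite sum_half gerBl mulr_ge0// exprn_ge0.
  rewrite -lee_fin fineK// -sumEFin; apply: nneseries_lim_ge => j _.
  by rewrite lee_fin.
have := normed_cvg cd.
rewrite (_ : series _ = (fun k => G k n - G 0%N n)); last first.
  by apply/funext => k; rewrite seriesEnat/= telescope_sumr.
move=> /cvg_ex[l cl]; apply/cvg_ex; exists (l + G 0%N n).
have h : (fun k => (G k n - G 0%N n) + G 0%N n) @ \oo --> l + G 0%N n.
  by apply: cvgD => //; exact: cvg_cst.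
by move: h; under eq_fun do rewrite subrK.
Qed.

(** The limit is built along truncations chosen with geometrically decreasing
    tails; Fatou's lemma then compares it with every truncation. *)
Lemma hartley_L2 f : sqint mu f -> exists V : R -> R, sqint mu V /\
  (forall N, sqint mu (fun n => V n - hartley (cut f N) n)) /\
  \int[mu]_n ((V n - hartley (cut f N) n) ^+ 2) @[N --> +oo] --> 0.
Proof.
move=> sf.
have : forall j : nat, exists N, tail f N <= (4^-1) ^+ j.
  move=> j; have e0 : 0 < (4^-1 : R) ^+ j by rewrite exprn_gt0.
  have /cvgrPdist_lt/(_ _ e0)[M [_ h]] := cvg_tail sf.
  exists (M + 1); have := h (M + 1) (ltr_pwDr ltr01 (lexx _)).
  by rewrite sub0r normrN ger0_norm ?tail_ge0// => /ltW.
move=> /choice[Nj tN].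
pose G j := hartley (cut f (Nj j)).
have mG j : measurable_fun setT (G j).
  by apply: measurable_hartley; apply: measurable_cut; case: sf.
have q0 j : 0 <= (4^-1 : R) ^+ j by rewrite exprn_ge0.
have [j|V [mV cV]] := @ae_cvg_fast G (4 * pi) mG.
  have [h1 h2] := hartley_cut_diff (Nj j.+1) (Nj j) sf; split => //.
  apply: (le_trans h2).
  have := tN j; have := tN j.+1; rewrite exprS => h3 h4.
  have -> : 4 * pi * 4^-1 ^+ j = 2 * pi * (2 * 4^-1 ^+ j) :> R by ring.
  rewrite ler_wpM2l ?mulr_ge0 ?pi_ge0//.
  by move: (q0 j) h3 h4; move: (4^-1 ^+ j) => q; lra.
have key N : (\int[mu]_n ((V n - hartley (cut f N) n) ^+ 2)%:E <= (2 * pi * tail f N)%:E)%E.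
  have mh : measurable_fun setT (hartley (cut f N)).
    by apply: measurable_hartley; apply: measurable_cut; case: sf.
  apply: (@fatou_le _ _ _ mu (fun j n => (G j n - hartley (cut f N) n) ^+ 2) _
    (fun j => 2 * pi * ((4^-1) ^+ j + tail f N))).
  - by move=> j; apply: measurable_funX; exact: (measurable_funB (mG j) mh).
  - by move=> j n; exact: sqr_ge0.
  - by apply: measurable_funX; exact: (measurable_funB mV mh).
  - apply: (leb_aeS cV) => n cn.
    have h : (fun j => G j n - hartley (cut f N) n) @ \oo --> V n - hartley (cut f N) n.
      by apply: cvgB => //; exact: cvg_cst.
    exact: (cvgM h h).
  - move=> j; have [h1 h2] := hartley_cut_diff (Nj j) N sf.
    rewrite (sqint_EFin h1) lee_fin (le_trans h2)// ler_wpM2l ?mulr_ge0 ?pi_ge0//.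
    by rewrite lerD2r.
  - apply: cvgMr; rewrite -[X in _ --> X]add0r; apply: cvgD; last exact: cvg_cst.
    by apply: cvg_expr; rewrite ger0_norm// invf_lt1// ltr1n.
  - by move=> n; exact: sqr_ge0.
have sV N : sqint mu (fun n => V n - hartley (cut f N) n) /\
    \int[mu]_n ((V n - hartley (cut f N) n) ^+ 2) <= 2 * pi * tail f N.
  apply: sqint_bound => //; apply: measurable_funB => //.
  by apply: measurable_hartley; apply: measurable_cut; case: sf.
exists V; split; [|split].
- have [s1 _] := sV 0; have [s2 _] := hartley_bessel (integrable_cut 0 sf) (sqint_cut 0 sf).
  have := sqintD s1 s2.
  by rewrite (_ : (fun x => _) = V)//; apply/funext => n; rewrite subrK.
- by move=> N; have [] := sV N.
have h0 : 2 * pi * tail f N @[N --> +oo] --> 0.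
  by rewrite -(mulr0 (2 * pi)); apply: cvgMr; exact: cvg_tail.
apply: (@squeeze_cvgr _ _ _ _ (cst 0) _ _ _ _ _ h0); last exact: cvg_cst.
by apply: nearW => N; have [_ ->] := sV N; rewrite andbT sqint_sq_ge0.
Qed.

End hartley.

(** * Totality of the Fejer kernels and Hartley inversion *)

Section density.
Context {R : realType}.
Local Notation mu := (@lebesgue_measure R).
Implicit Types (a b d x z u : R) (D : R -> R).

Lemma integrable_cauchy : mu.-integrable setT (fun u : R => ((1 + u ^+ 2)^-1)%:E).
Proof.
have cB : continuous (fun u : R => (1 + u ^+ 2)^-1).
  move=> u; apply: cvgV; first by rewrite gt_eqF// ltr_pwDl ?sqr_ge0.
  by apply: cvgD; [exact: cvg_cst|exact: exprn_continuous].
have mB : measurable_fun setT (fun u : R => (1 + u ^+ 2)^-1).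
  exact: continuous_measurable_fun.
have B0 u : 0 <= (1 + u ^+ 2)^-1 :> R by rewrite invr_ge0 addr_ge0 ?sqr_ge0.
apply/integrableP; split; first exact/measurable_EFinP.
under eq_integral do rewrite gee0_abs ?lee_fin//.
rewrite ge0_even_integral//; last by move=> u; rewrite sqrrN.
have := integral_inv_sqr_add (@ltr01 R).
rewrite -integral_itv_obnd_cbnd; last first.
  apply/measurable_EFinP; apply: measurable_funTS; apply: continuous_measurable_fun.
  exact: continuous_inv_sqr_add.
under eq_integral do rewrite expr1n mul1r addrC.
by move=> ->; rewrite -EFinM ltry.
Qed.

(** The part of the Fejer kernel away from the origin, which vanishes in the
    limit. *)
Definition far d k u : R := if d <= `|u| then fejer k.+1%:R u else 0.

Lemma measurable_far d k : measurable_fun setT (far d k).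
Proof.
apply: measurable_fun_ifT => //; last exact: measurable_fejer.
by apply: measurable_fun_ler => //; exact: measurableT_comp.
Qed.

Let k0 (k : nat) : 0 < k.+1%:R :> R. Proof. by rewrite ltr0n. Qed.

Lemma far_ge0 d k u : 0 <= far d k u.
Proof. by rewrite /far; case: ifP => // _; rewrite fejer_ge0. Qed.

Lemma far_le d k u : 0 < d ->
  far d k u <= 4 * (1 + d ^- 2) * harmonic k * (1 + u ^+ 2)^-1.
Proof.
move=> d0; rewrite /far; case: ifPn => [du|_]; last first.
  have d2 : 0 <= d ^- 2 by rewrite invr_ge0 sqr_ge0.
  have u2 : 0 <= (1 + u ^+ 2)^-1 by rewrite invr_ge0 addr_ge0// sqr_ge0.
  by rewrite !mulr_ge0// ?addr_ge0// invr_ge0.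
have u0 : 0 < `|u| by exact: lt_le_trans du.
have un0 : u != 0 by rewrite -normr_gt0.
apply: (le_trans (fejer_tail (k0 k) un0)).
have u2 : 0 < u ^+ 2 by rewrite exprn_even_gt0.
have -> : 4 / (k.+1%:R * u ^+ 2) = 4 * ((1 + u ^+ 2) / u ^+ 2) * harmonic k * (1 + u ^+ 2)^-1 :> R.
  rewrite /harmonic/=; have := k0 k; move: k.+1%:R => K K0.
  have uu : (u == 0) = false by apply/negbTE.
  have q1 : (1 + u ^+ 2 == 0) = false by rewrite gt_eqF// ltr_pwDl// ltW.
  by field; rewrite ?uu ?q1 ?(gt_eqF K0).
rewrite ler_wpM2r ?invr_ge0 ?addr_ge0 ?sqr_ge0// ler_wpM2r ?invr_ge0// ler_wpM2l//.
rewrite mulrDl divff ?gt_eqF// mul1r addrC lerD2l lef_pV2 ?posrE//; last exact: exprn_gt0.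
by rewrite -(real_normK (num_real u)) lerXn2r ?nnegrE// ltW.
Qed.

Lemma integrable_far d k : 0 < d -> mu.-integrable setT (EFin \o far d k).
Proof.
move=> d0; have := intZl (4 * (1 + d ^- 2) * harmonic k) measurableT integrable_cauchy.
move/integrable_dominated; apply => //; first exact: measurable_far.
by move=> u _; rewrite ger0_norm ?far_ge0// far_le.
Qed.

Lemma cvg_far d : 0 < d -> \int[mu]_u far d k u @[k --> \oo] --> 0.
Proof.
move=> d0; pose C := 4 * (1 + d ^- 2) * \int[mu]_u (1 + u ^+ 2)^-1 : R.
have h : C * harmonic k @[k --> \oo] --> 0.
  by rewrite -(mulr0 C); apply: cvgMr; exact: cvg_harmonic.
apply: (@squeeze_cvgr _ _ _ _ (cst 0) _ _ _ _ _ h); last exact: cvg_cst.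
apply: nearW => k; rewrite Rintegral_ge0/=; last by move=> u _; exact: far_ge0.
have -> : C * harmonic k = \int[mu]_u ((4 * (1 + d ^- 2) * harmonic k) * (1 + u ^+ 2)^-1).
  rewrite RintegralZl//; last exact: integrable_cauchy.
  by rewrite /C mulrAC.
apply: le_Rintegral => //; first exact: integrable_far.
  by apply: intZl => //; exact: integrable_cauchy.
by move=> u _; exact: far_le.
Qed.

(** Indicator of an interval convolved with a Fejer kernel.  Orthogonality to
    the kernels passes to it, and it tends to the indicator. *)
Definition smooth_itv a b k x := \int[mu]_z (\1_(`[a, b]%classic : set R) z * fejer k.+1%:R (x - z)).

Lemma integrable_fejer_reflect k x : mu.-integrable setT (fun z => (fejer k.+1%:R (x - z))%:E).
Proof. exact: (integrable_reflect x (integrable_fejer (k0 k))). Qed.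

Lemma Rintegral_fejer_reflect k x : \int[mu]_z (fejer k.+1%:R (x - z)) = 2 * pi.
Proof. by rewrite Rintegral_reflect ?Rintegral_fejer//; exact: measurable_fejer. Qed.

Lemma integrable_smooth_integrand a b k x :
  mu.-integrable setT (fun z => (\1_(`[a, b]%classic : set R) z * fejer k.+1%:R (x - z))%:E).
Proof.
have := integrable_fejer_reflect k x; move/integrable_dominated; apply => //.
  apply: measurable_funM; first by apply: measurable_indic; exact: measurable_itv.
  exact: (integrable_measurable (integrable_fejer_reflect k x)).
move=> z _; rewrite normrM (ger0_norm (fejer_ge0 _ (k0 k))).
by rewrite ler_piMl ?fejer_ge0// indicE; case: (_ \in _); rewrite ?normr1 ?normr0.
Qed.

Lemma smooth_itv_ge0 a b k x : 0 <= smooth_itv a b k x.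
Proof.
apply: Rintegral_ge0 => z _; by rewrite mulr_ge0 ?fejer_ge0// indicE.
Qed.

Lemma smooth_itv_le a b k x : smooth_itv a b k x <= 2 * pi.
Proof.
rewrite -(Rintegral_fejer_reflect k x); apply: le_Rintegral => //.
- exact: integrable_smooth_integrand.
- exact: integrable_fejer_reflect.
by move=> z _; rewrite ler_piMl ?fejer_ge0// indicE lern1 leq_b1.
Qed.

Lemma measurable_smooth_itv a b k : measurable_fun setT (smooth_itv a b k).
Proof.
apply: (@leb_measurable_Rint R (fun p => \1_(`[a, b]%classic : set R) p.2 * fejer k.+1%:R (p.1 - p.2))).
apply: measurable_funM.
  by apply: measurableT_comp => //; apply: measurable_indic; exact: measurable_itv.
by apply: measurableT_comp; [exact: measurable_fejer|exact: measurable_funB].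
Qed.

Lemma cvg_smooth_itv a b x : x != a -> x != b ->
  smooth_itv a b k x @[k --> \oo] --> 2 * pi * \1_(`[a, b]%classic : set R) x.
Proof.
move=> xa xb; pose d := Num.min `|x - a| `|x - b|.
have d0 : 0 < d by rewrite lt_min !normr_gt0 !subr_eq0 xa.
have da : d <= `|x - a| by rewrite ge_min lexx.
have db : d <= `|x - b| by rewrite ge_min lexx orbT.
apply/cvgrPdist_le => e e0.
have := cvg_far d0 => /cvgrPdist_le/(_ e e0); apply: filterS => k.
rewrite sub0r normrN ger0_norm; last by apply: Rintegral_ge0 => u _; exact: far_ge0.
apply: le_trans.
set c := \1_(`[a, b]%classic : set R) x.
have ir := integrable_fejer_reflect k x.
have -> : 2 * pi * c - smooth_itv a b k x =
    \int[mu]_z ((c - \1_(`[a, b]%classic : set R) z) * fejer k.+1%:R (x - z)).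
  rewrite -(Rintegral_fejer_reflect k x) [_ * c]mulrC -(RintegralZl c measurableT ir).
  rewrite /smooth_itv -RintegralB//; last exact: integrable_smooth_integrand.
    by apply: eq_Rintegral => z _; rewrite mulrBl.
  exact: (intZl c measurableT ir).
have id : mu.-integrable setT (fun z => ((c - \1_(`[a, b]%classic : set R) z) * fejer k.+1%:R (x - z))%:E).
  have := intB measurableT (intZl c measurableT ir) (integrable_smooth_integrand a b k x).
  by apply: eq_integrable => // z _ /=; rewrite mulrBl.
apply: (le_trans (le_normr_Rintegral measurableT id)).
rewrite -(Rintegral_reflect x (measurable_far d k)).
apply: le_Rintegral => //; first exact: (integrable_norm id).
  exact: (integrable_reflect x (integrable_far k d0)).
move=> z _; rewrite /far normrM (ger0_norm (fejer_ge0 _ (k0 k))).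
rewrite /c !indicE !mem_setE !in_itv/=.
have F0 := fejer_ge0 (x - z) (k0 k).
have [xI|xI] := boolP (a <= x <= b); have [zI|zI] := boolP (a <= z <= b).
- by rewrite subrr normr0 mul0r; case: ifP.
- rewrite subr0 normr1 mul1r ifT//.
  move: xI zI => /andP[ax xb']; rewrite negb_and -!ltNge => /orP[za|bz].
    by apply: (le_trans da); rewrite !ger0_norm; lra.
  by apply: (le_trans db); rewrite !ler0_norm; lra.
- rewrite sub0r normrN normr1 mul1r ifT//.
  move: zI xI => /andP[ax xb']; rewrite negb_and -!ltNge => /orP[za|bz].
    by apply: (le_trans da); rewrite !ler0_norm; lra.
  by apply: (le_trans db); rewrite !ger0_norm; lra.
- by rewrite subrr normr0 mul0r; case: ifP.
Qed.

(** A square integrable bound uniform in [k], as dominated convergence needs: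
    the mass of the kernel near the interval, its quadratic tail far away. *)
Lemma smooth_itv_dominated a b : a <= b -> exists C : R, 0 <= C /\
  forall k x, smooth_itv a b k x <= C * (1 + x ^+ 2)^-1.
Proof.
move=> ab; pose c := `|a| + `|b| + 1.
have c1 : 1 <= c by rewrite lerDr addr_ge0.
exists (2 * pi * (1 + 4 * c ^+ 2) + 32 * c).
have p0 : 0 <= pi :> R by exact: pi_ge0.
have q0 x : 0 < 1 + x ^+ 2 :> R by rewrite ltr_pwDl ?sqr_ge0.
split; first by rewrite addr_ge0// !mulr_ge0// ?addr_ge0 ?mulr_ge0 ?sqr_ge0//; lra.
move=> k x; rewrite ler_pdivlMr//.
(* beyond distance [2 * c] of the origin, [`|x - z|] is at least [`|x| / 2] *)
have [xc|cx] := leP `|x| (2 * c).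
  have x2 : x ^+ 2 <= 4 * c ^+ 2.
    rewrite -(real_normK (num_real x)) (_ : 4 * c ^+ 2 = (2 * c) ^+ 2); last by ring.
    by rewrite lerXn2r ?nnegrE//; lra.
  apply: (@le_trans _ _ (2 * pi * (1 + 4 * c ^+ 2))); last by rewrite lerDl; lra.
  rewrite ler_pM// ?smooth_itv_ge0 ?smooth_itv_le//; first by rewrite ltW.
  by rewrite lerD2l.
have x1 : 1 <= x ^+ 2.
  rewrite -(real_normK (num_real x)) -(expr1n _ 2) lerXn2r ?nnegrE//; lra.
have xn0 : x != 0 by rewrite -normr_gt0; lra.
have x2 : 0 < x ^+ 2 by lra.
apply: (@le_trans _ _ (32 * c)); last first.
  by rewrite lerDr; rewrite !mulr_ge0// addr_ge0// mulr_ge0// sqr_ge0.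
have key : smooth_itv a b k x <= 16 / x ^+ 2 * (b - a).
  have iI : mu.-integrable setT (EFin \o (fun z : R => 16 / x ^+ 2 * \1_(`[a, b]%classic : set R) z)).
    by apply: intZl => //; exact: integrable_indic_itv.
  have -> : 16 / x ^+ 2 * (b - a) = \int[mu]_z (16 / x ^+ 2 * \1_(`[a, b]%classic : set R) z).
    rewrite RintegralZl//; last exact: integrable_indic_itv.
    congr (_ * _); rewrite /Rintegral integral_indic ?setIT//= lebesgue_measure_itv/= lte_fin.
    move: ab; rewrite le_eqVlt => /orP[/eqP->|->//]; by rewrite ltxx subrr.
  apply: le_Rintegral => //; first exact: integrable_smooth_integrand.
  move=> z _; rewrite indicE mem_setE in_itv/=; have [/andP[az zb]|_] := boolP (a <= z <= b); last by rewrite mul0r mulr0.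
  rewrite mul1r mulr1.
  have zc : `|z| <= c.
    rewrite /c ler_norml; have := ler_norm a; have := ler_norm b; have := ler_norm (- a); have := ler_norm (- b).
    by rewrite !normrN => h1 h2 h3 h4; apply/andP; split; have := normr_ge0 a; have := normr_ge0 b; lra.
  have xz : `|x| / 2 <= `|x - z| by have := lerB_dist x z; lra.
  have xz0 : x - z != 0 by rewrite -normr_gt0; lra.
  apply: (le_trans (fejer_tail (k0 k) xz0)).
  have h4 : x ^+ 2 / 4 <= (x - z) ^+ 2.
    rewrite -(real_normK (num_real x)) -(real_normK (num_real (x - z))).
    by rewrite (_ : _ / 4 = (`|x| / 2) ^+ 2) ?lerXn2r ?nnegrE//; last by field.
  have h5 : x ^+ 2 / 4 <= k.+1%:R * (x - z) ^+ 2.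
    apply: (le_trans h4); rewrite ler_peMl ?sqr_ge0// ler1n//.
  rewrite ler_pdivrMr; last by apply: lt_le_trans h5; rewrite divr_gt0.
  by rewrite mulrAC ler_pdivlMr// ; lra.
apply: (@le_trans _ _ (16 / x ^+ 2 * (b - a) * (1 + x ^+ 2))).
  by rewrite ler_wpM2r// ltW.
have bac : b - a <= c.
  by rewrite /c; have := ler_norm b; have := ler_norm (- a); rewrite normrN; lra.
have ba0 : 0 <= b - a by rewrite subr_ge0.
have -> : 16 / x ^+ 2 * (b - a) * (1 + x ^+ 2) = (16 * ((1 + x ^+ 2) / x ^+ 2)) * (b - a) by field.
have w0 : 0 <= (1 + x ^+ 2) / x ^+ 2 by apply: divr_ge0; apply: ltW.
rewrite ler_pM//; first by rewrite mulr_ge0.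
rewrite (_ : 32 = 16 * 2 :> R); last by ring.
by rewrite ler_wpM2l// ler_pdivrMr//; lra.
Qed.

Lemma sqint_fejer k z : sqint mu (fun x => fejer k.+1%:R (x - z)).
Proof.
split.
  by apply: measurableT_comp; [exact: measurable_fejer|exact: measurable_funB].
have is2 := integrable_shift (- z) (integrable_fejer (k0 k)).
have := intZl (fejer k.+1%:R 0) measurableT is2; move/integrable_dominated; apply => //.
  by apply: measurable_funX; apply: measurableT_comp; [exact: measurable_fejer|exact: measurable_funB].
move=> x _; rewrite ger0_norm ?sqr_ge0// expr2 ler_wpM2r ?fejer_ge0//.
exact: fejer_le.
Qed.

Lemma sqint_tri_cas k z : sqint mu (fun n => tri k.+1%:R n * cas (n * z)).
Proof.
have m : measurable_fun setT (fun n : R => tri k.+1%:R n * cas (n * z)).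
  by apply: measurable_funM; [exact: measurable_tri|exact: measurable_casM].
split => //.
have := intZl 2 measurableT (integrable_norm (integrable_tri_casM z (k0 k))).
move/integrable_dominated; apply => //; first exact: measurable_funX.
move=> n _ /=; rewrite normrX expr2 ler_wpM2r// normrM (ger0_norm (tri_ge0 _ _)).
by rewrite -[leRHS]mul1r ler_pM ?tri_ge0 ?tri_le1 ?norm_cas_le.
Qed.

(** Fubini transfers the orthogonality from the kernels to the smoothed
    indicators, and dominated convergence to the indicator itself. *)
Lemma fejer_orthogonal_itv D : sqint mu D ->
  (forall k z, \int[mu]_x (D x * fejer k.+1%:R (x - z)) = 0) ->
  forall a b, a <= b -> \int[mu]_x (D x * \1_(`[a, b]%classic : set R) x) = 0.
Proof.
move=> sD oD a b ab; have [mD iD2] := sD.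
have [C [C0 hC]] := smooth_itv_dominated ab.
have mI : measurable_fun setT (\1_(`[a, b]%classic : set R) : R -> R).
  by apply: measurable_indic; exact: measurable_itv.
pose B (x : R) := C * (1 + x ^+ 2)^-1.
have sB : sqint mu B.
  apply: sqintZ; split; first exact: (integrable_measurable integrable_cauchy).
  apply: (integrable_dominated measurableT _ integrable_cauchy).
    by apply: measurable_funX; exact: (integrable_measurable integrable_cauchy).
  move=> x _; rewrite ger0_norm ?sqr_ge0// expr2.
  have q0 : 1 <= 1 + x ^+ 2 by rewrite lerDl sqr_ge0.
  have q1 : 0 < 1 + x ^+ 2 by exact: lt_le_trans q0.
  by rewrite ler_piMl ?invr_ge0 ?(ltW q1)// invf_le1.
have nD : sqint mu (fun x => `|D x|).
  split; first exact: measurableT_comp.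
  by apply: eq_integrable iD2 => // x _ /=; rewrite real_normK ?num_real.
have iDB := sqintM nD sB.
have orth k : \int[mu]_x (D x * smooth_itv a b k x) = 0.
  pose Phi (p : R * R) := D p.1 * (\1_(`[a, b]%classic : set R) p.2 * fejer k.+1%:R (p.1 - p.2)).
  have mPhi : measurable_fun setT Phi.
    apply: measurable_funM; first exact: measurableT_comp.
    apply: measurable_funM; first exact: measurableT_comp.
    by apply: measurableT_comp; [exact: measurable_fejer|exact: measurable_funB].
  transitivity (\int[mu]_x \int[mu]_z Phi (x, z)).
    apply: eq_Rintegral => x _; rewrite /smooth_itv -RintegralZl//.
    exact: integrable_smooth_integrand.
  rewrite (leb_fubini mPhi); last first.
    apply: (@le_lt_trans _ _ (\int[mu]_x (`|D x| * B x)%:E)%E); last first.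
      move/integrableP : iDB => [_]; apply: le_lt_trans.
      apply: ge0_le_integral => //.
      - by move=> x _; rewrite lee_fin mulr_ge0// /B mulr_ge0// invr_ge0 addr_ge0// sqr_ge0.
      - by apply/measurable_EFinP; exact: (integrable_measurable (sqintM nD sB)).
      - by apply: measurableT_comp => //; apply/measurable_EFinP; exact: (integrable_measurable (sqintM nD sB)).
      - by move=> x _; rewrite lee_fin ler_norm.
    apply: ge0_le_integral => //.
    - by move=> x _; exact: integral_ge0.
    - apply: (@leb_measurable_F R (fun p => `|Phi p|%:E)) => //.
      by apply/measurable_EFinP; exact: measurableT_comp.
    - by apply/measurable_EFinP; exact: (integrable_measurable (sqintM nD sB)).
    move=> x _.
    have is_ := integrable_smooth_integrand a b k x.
    have -> : (\int[mu]_z `|Phi (x, z)|%:E = (`|D x| * smooth_itv a b k x)%:E)%E.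
      rewrite /smooth_itv -(RintegralZl `|D x| measurableT is_) /Rintegral fineK; last first.
        by apply: integrable_fin_num => //; exact: (intZl `|D x| measurableT is_).
      apply: eq_integral => z _; rewrite /Phi/= normrM; congr ((_ * _)%:E).
      by rewrite ger0_norm// mulr_ge0// ?fejer_ge0// indicE; case: (_ \in _).
    by rewrite lee_fin ler_wpM2l.
  have -> : (0 : R) = \int[mu]_z (cst 0 z : R) by rewrite Rintegral_cst//= mul0r.
  apply: eq_Rintegral => z _.
  transitivity (\int[mu]_x (\1_(`[a, b]%classic : set R) z * (D x * fejer k.+1%:R (x - z)))).
    by apply: eq_Rintegral => x _; rewrite /Phi/= mulrCA.
  rewrite RintegralZl//; first by rewrite oD mulr0.
  by apply: sqintM => //; exact: sqint_fejer.
have := @cvg_Rintegral_dominated _ _ _ mu setT (fun k x => D x * smooth_itv a b k x)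
  (fun x => D x * (2 * pi * \1_(`[a, b]%classic : set R) x)) (fun x => `|D x| * B x) measurableT.
move=> /(_ (fun k => measurable_funM mD (measurable_smooth_itv a b k))).
move=> /(_ (measurable_funM mD (measurable_funM (measurable_cst _) mI))).
have cae : {ae mu, forall x, setT x -> D x * smooth_itv a b k x @[k --> \oo] -->
    D x * (2 * pi * \1_(`[a, b]%classic : set R) x)}.
  exists [set a; b]; split.
  - by apply: measurableU; exact: measurable_set1.
  - by rewrite measureU0//; exact: lebesgue_measure_set1.
  move=> x /=; apply: contra_notP => /not_orP[/eqP xa /eqP xb] _.
  by apply: cvgMr; exact: cvg_smooth_itv.
move=> /(_ cae iDB) h.
have {}h : \int[mu]_x (D x * (2 * pi * \1_(`[a, b]%classic : set R) x)) = 0.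
  have c0 : \int[mu]_x (D x * smooth_itv a b k x) @[k --> \oo] --> 0.
    by under eq_fun do rewrite orth; exact: cvg_cst.
  apply: (@cvg_unique _ (@Rhausdorff R) _ _ _ _ (h _) c0) => k x _.
  by rewrite normrM (ger0_norm (smooth_itv_ge0 _ _ _ _)) ler_wpM2l.
have iDI : mu.-integrable setT (EFin \o (fun x => D x * \1_(`[a, b]%classic : set R) x)).
  apply: sqintM => //; split => //.
  have := @integrable_indic_itv R a b true false.
  by apply: eq_integrable => // x _ /=; rewrite indicE; case: (_ \in _); rewrite ?expr1n ?expr0n.
have : 2 * pi * \int[mu]_x (D x * \1_(`[a, b]%classic : set R) x) = 0.
  rewrite -(RintegralZl _ measurableT iDI) -[RHS]h; apply: eq_Rintegral => x _.
  by rewrite mulrCA.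
by move/eqP; rewrite !mulf_eq0 pnatr_eq0/= gt_eqF ?pi_gt0//= => /eqP.
Qed.

Lemma locally_integrable_sqint D : sqint mu D -> locally_integrable setT D.
Proof.
move=> [mD iD2]; split => //; first exact: openT.
move=> K _ cK; have mK : measurable K by exact: compact_measurable.
have iK : mu.-integrable K (EFin \o (fun x => D x ^+ 2 + 1)).
  apply: intD => //; first by apply: integrableS iD2.
  by apply: continuous_compact_integrable => //; apply: continuous_subspaceT => ?; exact: cvg_cst.
move/integrableP : iK => [_]; apply: le_lt_trans.
apply: ge0_le_integral => //.
- by apply/measurable_EFinP; apply: measurableT_comp => //; exact: measurable_funTS.
- apply: measurableT_comp => //; apply/measurable_EFinP; apply: measurable_funD => //.
  by apply: measurable_funX; exact: measurable_funTS.
move=> x _; rewrite lee_fin /= (ger0_norm (_ : 0 <= D x ^+ 2 + 1)) ?addr_ge0 ?sqr_ge0//.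
rewrite -(real_normK (num_real (D x))).
by have := sqr_ge0 (`|D x| - 1); have := normr_ge0 (D x); move: `|D x| => t; nra.
Qed.

(** Lebesgue's differentiation theorem applied to the vanishing primitive. *)
Lemma ae_eq0_itv D : sqint mu D ->
  (forall a b, a <= b -> \int[mu]_x (D x * \1_(`[a, b]%classic : set R) x) = 0) ->
  {ae mu, forall x, D x = 0}.
Proof.
move=> sD D0; have [mD iD2] := sD.
apply: (leb_aeS (lebesgue_differentiation (locally_integrable_sqint sD))) => x lx.
have x1 : x < x + 1 by rewrite ltrDl.
have iD : mu.-integrable `[x - 1, x + 1] (EFin \o D).
  have := integrable_cut (`|x| + 1) sD => /(@integrableS _ _ _ mu setT `[x - 1, x + 1]%classic _ measurableT).
  move=> /(_ (measurable_itv _) (@subsetT _ _)); apply: eq_integrable => // y.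
  rewrite inE/= in_itv/= => /andP[y1 y2]; rewrite cutE ifT//.
  by rewrite ler_norml; have := ler_norm x; have := ler_norm (- x); rewrite normrN; lra.
have ax : x - 1 < x by lra.
have [_ <-] := FTC1_lebesgue_pt x1 iD ax lx.
  rewrite derive1E.
  rewrite (_ : (fun y => _) = cst 0).
    by rewrite derive_cst.
  apply/funext => y.
  have [xy|yx] := leP (x - 1) y; last by rewrite set_itv_ge ?Rintegral_set0// bnd_simp -ltNge.
  rewrite Rintegral_mkcond -[RHS](D0 _ _ xy); apply: eq_Rintegral => t _.
  by rewrite patchE indicE; case: ifPn; rewrite ?mulr1 ?mulr0.
Qed.

Lemma fejer_orthogonal_eq0 D : sqint mu D ->
  (forall k z, \int[mu]_x (D x * fejer k.+1%:R (x - z)) = 0) ->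
  {ae mu, forall x, D x = 0}.
Proof. by move=> sD oD; apply: ae_eq0_itv => //; exact: fejer_orthogonal_itv. Qed.

End density.

Section hartley_inversion.
Context {R : realType}.
Local Notation mu := (@lebesgue_measure R).
Implicit Types (f h V D g : R -> R) (N z n x : R).

Let k0 (k : nat) : 0 < k.+1%:R :> R. Proof. by rewrite ltr0n. Qed.

(** The transform of a square integrable function is the [L^2] limit of the
    transforms of its truncations; [V] is a representative of it. *)
Definition hartley_lim f V := sqint mu V /\
  \int[mu]_n ((V n - hartley (cut f N) n) ^+ 2) @[N --> +oo] --> 0.

Lemma sqint_hartley_cut f N : sqint mu f -> sqint mu (hartley (cut f N)).
Proof. by move=> sf; have [] := hartley_bessel (integrable_cut N sf) (sqint_cut N sf). Qed.

Lemma cvg_hartley_weak f V g : sqint mu f -> hartley_lim f V -> sqint mu g ->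
  \int[mu]_n (hartley (cut f N) n * g n) @[N --> +oo] --> \int[mu]_n (V n * g n).
Proof.
move=> sf [sV cV] sg.
have h : \int[mu]_n ((V n - hartley (cut f N) n) * g n) @[N --> +oo] --> 0.
  apply: cvg_sqint_weak => //; apply: nearW => N.
  by apply: sqintB => //; exact: sqint_hartley_cut.
have e N : \int[mu]_n (hartley (cut f N) n * g n) = \int[mu]_n (V n * g n) -
    \int[mu]_n ((V n - hartley (cut f N) n) * g n).
  rewrite -RintegralB//; [|exact: sqintM|]; last first.
    by apply: sqintM => //; apply: sqintB => //; exact: sqint_hartley_cut.
  by apply: eq_Rintegral => n _; ring.
rewrite (funext e).
by rewrite -[X in _ --> X]subr0; apply: cvgB => //; exact: cvg_cst.
Qed.

Lemma cvg_cut_weak f g : sqint mu f -> sqint mu g ->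
  \int[mu]_n (cut f N n * g n) @[N --> +oo] --> \int[mu]_n (f n * g n).
Proof.
move=> sf sg.
have h : \int[mu]_n ((f n - cut f N n) * g n) @[N --> +oo] --> 0.
  apply: cvg_sqint_weak => //; last exact: cvg_tail.
  by apply: nearW => N; exact: sqint_tail.
have e N : \int[mu]_n (cut f N n * g n) = \int[mu]_n (f n * g n) -
    \int[mu]_n ((f n - cut f N n) * g n).
  rewrite -RintegralB//; [|exact: sqintM|]; last by apply: sqintM => //; exact: sqint_tail.
  by apply: eq_Rintegral => n _; ring.
rewrite (funext e).
by rewrite -[X in _ --> X]subr0; apply: cvgB => //; exact: cvg_cst.
Qed.

(** Injectivity: by self-adjointness, testing the transform against
    [tri * cas] tests the function against a translated Fejer kernel. *)
Lemma hartley_lim0 D : sqint mu D -> hartley_lim D (fun=> 0) -> {ae mu, forall x, D x = 0}.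
Proof.
move=> sD cD; apply: fejer_orthogonal_eq0 => // k z.
have h1 := cvg_cut_weak sD (sqint_fejer k z).
have h2 := cvg_hartley_weak sD cD (sqint_tri_cas k z).
have e N : \int[mu]_n (cut D N n * fejer k.+1%:R (n - z)) =
   \int[mu]_n (hartley (cut D N) n * (tri k.+1%:R n * cas (n * z))).
  transitivity (\int[mu]_n (cut D N n * hartley (fun n => tri k.+1%:R n * cas (n * z)) n)).
    apply: eq_Rintegral => n _; rewrite (hartley_tri_cas _ _ (k0 k)).
    by rewrite -[in LHS]fejerN opprB.
  rewrite (hartley_adjoint (integrable_cut N sD) (integrable_tri_casM z (k0 k))).
  by apply: eq_Rintegral => n _; rewrite mulrC.
move: h1; under eq_fun do rewrite e.
move=> /(@cvg_unique _ (@Rhausdorff R) _ _ _ _ h2) <-.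
under eq_Rintegral do rewrite mul0r.
by rewrite Rintegral_cst//= mul0r.
Qed.

Lemma sqint_hartley h : mu.-integrable setT (EFin \o h) -> sqint mu h -> sqint mu (hartley h).
Proof. by move=> ih sh; have [] := hartley_bessel ih sh. Qed.

(** The transform of [hartley h] exists by [hartley_L2]; tested against a
    translated Fejer kernel it gives the same value as [2 * pi * h], by the
    two kernel identities. *)
Lemma hartley_inversion h : mu.-integrable setT (EFin \o h) -> sqint mu h ->
  hartley_lim (hartley h) (fun n => 2 * pi * h n).
Proof.
move=> ih sh; have sf := sqint_hartley ih sh.
have s2 : sqint mu (fun n => 2 * pi * h n) by exact: sqintZ.
split => //.
have [V [sV [sVN cV]]] := hartley_L2 sf.
have hV : hartley_lim (hartley h) V by split.
have D0 : {ae mu, forall x, V x - 2 * pi * h x = 0}.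
  apply: fejer_orthogonal_eq0; first exact: sqintB.
  move=> k z.
  have sF := sqint_fejer k z.
  have h2 := cvg_hartley_weak sf hV sF.
  (* from [k.+1] on, the truncation contains the support of the triangle *)
  have e N : k.+1%:R <= N -> \int[mu]_n (hartley (cut (hartley h) N) n * fejer k.+1%:R (n - z)) =
      2 * pi * \int[mu]_n (h n * fejer k.+1%:R (n - z)).
    move=> kN.
    have iF : mu.-integrable setT (EFin \o (fun n => fejer k.+1%:R (n - z))).
      exact: (integrable_shift (- z) (integrable_fejer (k0 k))).
    transitivity (\int[mu]_n (fejer k.+1%:R (n - z) * hartley (cut (hartley h) N) n)).
      by apply: eq_Rintegral => n _; rewrite mulrC.
    rewrite (hartley_adjoint iF (integrable_cut N sf)).
    have itc := integrable_tri_casM z (k0 k).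
    transitivity (\int[mu]_n (2 * pi * ((tri k.+1%:R n * cas (n * z)) * hartley h n))).
      apply: eq_Rintegral => n _; rewrite (hartley_fejer _ _ (k0 k)) cutE [z * n]mulrC.
      case: ifPn => [_|]; first by ring.
      rewrite -ltNge => Nn; rewrite tri_out ?k0 ?(ltW (le_lt_trans kN Nn))//.
      by rewrite !(mulr0, mul0r).
    rewrite (RintegralZl (2 * pi) measurableT); last first.
      exact: (integrable_mul_bounded itc (measurable_hartley (integrable_measurable ih))
        (fun n => norm_hartley_le n ih)).
    rewrite (hartley_adjoint itc ih); congr (_ * _).
    apply: eq_Rintegral => n _; rewrite (hartley_tri_cas _ _ (k0 k)).
    by rewrite -[in LHS]fejerN opprB.
  have h3 : \int[mu]_n (hartley (cut (hartley h) N) n * fejer k.+1%:R (n - z)) @[N --> +oo] -->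
      2 * pi * \int[mu]_n (h n * fejer k.+1%:R (n - z)).
    apply: cvg_near_cst; near=> N; apply: e.
    by near: N; apply: nbhs_pinfty_ge; rewrite num_real.
  have h4 := @cvg_unique _ (@Rhausdorff R) _ _ _ _ h2 h3.
  have ihF := sqintM sh sF; have iVF := sqintM sV sF.
  transitivity (\int[mu]_n (V n * fejer k.+1%:R (n - z) - 2 * pi * (h n * fejer k.+1%:R (n - z)))).
    by apply: eq_Rintegral => n _; ring.
  rewrite RintegralB//; last exact: (intZl (2 * pi) measurableT ihF).
  by rewrite (RintegralZl _ measurableT ihF) h4 subrr.
apply: cvg_trans cV; apply: near_eq_cvg; apply: nearW => N.
rewrite /Rintegral; congr fine; apply: ae_eq_integral => //.
- by apply/measurable_EFinP; apply: measurable_funX; have [] := sVN N.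
- apply/measurable_EFinP; apply: measurable_funX; apply: measurable_funB.
    by have [] := s2.
  by have [] := sqint_hartley_cut N sf.
apply: (leb_aeS D0) => x /subr0_eq Vx _.
by rewrite Vx.
Unshelve. all: by end_near. Qed.

Lemma cvg_double_sum0 (a b : R -> R) (F : set_system R) {FF : Filter F} :
  a N @[N --> F] --> 0 -> b N @[N --> F] --> 0 -> 2 * a N + 2 * b N @[N --> F] --> 0.
Proof.
move=> ca cb; rewrite -[X in _ --> X]addr0 -[X in _ --> X + _](mulr0 2) -[X in _ --> _ + X](mulr0 2).
by apply: cvgD; apply: cvgMr.
Qed.

Lemma hartleyB_cut f g N n : sqint mu f -> sqint mu g ->
  hartley (cut (fun x => f x - g x) N) n = hartley (cut f N) n - hartley (cut g N) n.
Proof.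
move=> sf sg; rewrite -hartleyB; [|exact: integrable_cut|exact: integrable_cut].
by congr hartley; apply/funext => x; rewrite /cut mulrBl.
Qed.

(** Both [f] and [hartley h] have the transform [2 * pi * h], so injectivity
    applies to their difference.  This is how the initial datum, known only up
    to a null set, is represented by its modes. *)
Lemma hartley_recover f h : sqint mu f -> mu.-integrable setT (EFin \o h) -> sqint mu h ->
  hartley_lim f (fun n => 2 * pi * h n) -> {ae mu, forall x, f x = hartley h x}.
Proof.
move=> sf ih sh [s2 cf]; have sg := sqint_hartley ih sh.
have [_ cg] := hartley_inversion ih sh.
suff : {ae mu, forall x, f x - hartley h x = 0}.
  by move=> D0; apply: (leb_aeS D0) => x /subr0_eq.
apply: hartley_lim0; first exact: sqintB.
split; first by split => //; apply: eq_integrable (integrable0 _ _) => // x _ /=; rewrite expr0n.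
have h0 : 2 * \int[mu]_n ((2 * pi * h n - hartley (cut f N) n) ^+ 2) +
    2 * \int[mu]_n ((2 * pi * h n - hartley (cut (hartley h) N) n) ^+ 2) @[N --> +oo] --> 0.
  exact: (cvg_double_sum0 cf cg).
apply: (@squeeze_cvgr _ _ _ _ (cst 0) _ _ _ _ _ h0); last exact: cvg_cst.
apply: nearW => N; rewrite Rintegral_ge0/=; last by move=> x _; exact: sqr_ge0.
have s1 := sqintB s2 (sqint_hartley_cut N sf).
have s3 := sqintB s2 (sqint_hartley_cut N sg).
have [_ i1] := s1; have [_ i3] := s3.
pose a n := (2 * pi * h n - hartley (cut f N) n) ^+ 2.
pose b n := (2 * pi * h n - hartley (cut (hartley h) N) n) ^+ 2.
have j1 := intZl 2 measurableT i1; have j3 := intZl 2 measurableT i3.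
have e : \int[mu]_n (2 * a n + 2 * b n) = 2 * \int[mu]_n a n + 2 * \int[mu]_n b n.
  by rewrite (RintegralD measurableT j1 j3) (RintegralZl 2 measurableT i1) (RintegralZl 2 measurableT i3).
rewrite -[leRHS]e; apply: le_Rintegral => //; [|exact: intD|].
  have [_] := sqintB (sqint_hartley_cut N sf) (sqint_hartley_cut N sg).
  apply: eq_integrable => // n _ /=.
  by rewrite hartleyB_cut// sub0r sqrrN.
move=> n _; rewrite hartleyB_cut// /a /b.
move: (2 * pi * h n) (hartley (cut f N) n) (hartley (cut (hartley h) N) n) => p q r.
rewrite -subr_ge0 (_ : _ - _ = ((p - q) + (p - r)) ^+ 2) ?sqr_ge0//; by ring.
Qed.

End hartley_inversion.

(** * Complex-valued functions, synthesis and self-convolution *)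

(* the pointwise formula of [cas] is needed again *)
Transparent fejer tri cas.

Section complex_values.
Local Open Scope complex_scope.
Context {R : realType}.
Local Notation Re := (@complex.Re R).
Local Notation Im := (@complex.Im R).
Local Notation normc := Normc.normc.
Implicit Types z w : R[i].

Lemma cReM z w : Re (z * w) = Re z * Re w - Im z * Im w.
Proof. by case: z w => a b [c d]. Qed.

Lemma cImM z w : Im (z * w) = Re z * Im w + Im z * Re w.
Proof. by case: z w => a b [c d]. Qed.

Lemma cReD z w : Re (z + w) = Re z + Re w. Proof. by case: z w => a b [c d]. Qed.

Lemma cImD z w : Im (z + w) = Im z + Im w. Proof. by case: z w => a b [c d]. Qed.

Lemma cReN z : Re (- z) = - Re z. Proof. by case: z. Qed.

Lemma cImN z : Im (- z) = - Im z. Proof. by case: z. Qed.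

Lemma cReB z w : Re (z - w) = Re z - Re w. Proof. by case: z w => a b [c d]. Qed.

Lemma cImB z w : Im (z - w) = Im z - Im w. Proof. by case: z w => a b [c d]. Qed.

Definition cReE := (cReM, cImM, cReD, cImD, cReN, cImN).

Lemma cReP z w : Re z = Re w -> Im z = Im w -> z = w.
Proof. by case: z w => a b [c d] /= -> ->. Qed.

Lemma normcE z : normc z = Num.sqrt (Re z ^+ 2 + Im z ^+ 2).
Proof. by case: z. Qed.

Lemma normc_ge0 z : 0 <= normc z.
Proof. by rewrite normcE sqrtr_ge0. Qed.

Lemma sqr_normcE z : normc z ^+ 2 = Re z ^+ 2 + Im z ^+ 2.
Proof. by rewrite normcE sqr_sqrtr// addr_ge0// sqr_ge0. Qed.

Lemma norm_Re_le z : `|Re z| <= normc z.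
Proof. by rewrite -sqrtr_sqr normcE ler_sqrt ?addr_ge0 ?sqr_ge0// lerDl sqr_ge0. Qed.

Lemma norm_Im_le z : `|Im z| <= normc z.
Proof. by rewrite -sqrtr_sqr normcE ler_sqrt ?addr_ge0 ?sqr_ge0// lerDr sqr_ge0. Qed.

Lemma normc_le_sum z : normc z <= `|Re z| + `|Im z|.
Proof.
rewrite -(@ler_sqr R) ?nnegrE ?normc_ge0 ?addr_ge0// sqr_normcE.
rewrite sqrrD !real_normK ?num_real//; have := mulr_ge0 (normr_ge0 (Re z)) (normr_ge0 (Im z)); lra.
Qed.

Lemma normcD z w : normc (z + w) <= normc z + normc w.
Proof. exact: complex.le_normcD. Qed.

Lemma normcM_le z w : normc (z * w) <= normc z * normc w.
Proof. by rewrite Normc.normcM. Qed.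

Lemma normcN z : normc (- z) = normc z. Proof. exact: complex.normcN. Qed.

Lemma normcB z w : normc (z - w) <= normc z + normc w.
Proof. by rewrite -(normcN w) normcD. Qed.

Lemma normc_real (a : R) : normc (a +i* 0) = `|a|.
Proof. by rewrite normcE/= expr0n addr0 sqrtr_sqr. Qed.

Lemma normc_imag (a : R) : normc (0 +i* a) = `|a|.
Proof. by rewrite normcE/= expr0n add0r sqrtr_sqr. Qed.

Definition cis (t : R) : R[i] := cos t +i* sin t.

Lemma normc_cis t : normc (cis t) = 1.
Proof. by rewrite normcE/= cos2Dsin2 sqrtr1. Qed.

Lemma cisD s t : cis (s + t) = cis s * cis t.
Proof. by apply: cReP; rewrite cReE/= ?cosD ?sinD//; ring. Qed.

Lemma cis0 : cis 0 = 1. Proof. by rewrite /cis cos0 sin0. Qed.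

Lemma normc_cisM t z : normc (cis t * z) = normc z.
Proof. by rewrite Normc.normcM normc_cis mul1r. Qed.

End complex_values.

Section complex_measurability.
Local Open Scope complex_scope.
Context {R : realType} d (T : measurableType d).
Local Notation Re := (@complex.Re R).
Local Notation Im := (@complex.Im R).
Local Notation normc := Normc.normc.
Implicit Types f g : T -> R[i].

Definition cmeasurable f := measurable_fun setT (fun x => Re (f x)) /\
  measurable_fun setT (fun x => Im (f x)).

Lemma cmeasurableM f g : cmeasurable f -> cmeasurable g -> cmeasurable (fun x => f x * g x).
Proof.
move=> [f1 f2] [g1 g2]; split.
  apply: (eq_measurable_fun (fun x => Re (f x) * Re (g x) - Im (f x) * Im (g x))).
    by move=> x _; rewrite cReM.
  by apply: measurable_funB; apply: measurable_funM.
apply: (eq_measurable_fun (fun x => Re (f x) * Im (g x) + Im (f x) * Re (g x))).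
  by move=> x _; rewrite cImM.
by apply: measurable_funD; apply: measurable_funM.
Qed.

Lemma cmeasurableD f g : cmeasurable f -> cmeasurable g -> cmeasurable (fun x => f x + g x).
Proof.
move=> [f1 f2] [g1 g2]; split.
  apply: (eq_measurable_fun (fun x => Re (f x) + Re (g x))).
    by move=> x _; rewrite cReD.
  exact: measurable_funD.
apply: (eq_measurable_fun (fun x => Im (f x) + Im (g x))).
  by move=> x _; rewrite cImD.
exact: measurable_funD.
Qed.

Lemma cmeasurable_pair (a b : T -> R) : measurable_fun setT a -> measurable_fun setT b ->
  cmeasurable (fun x => a x +i* b x).
Proof. by split. Qed.

Lemma cmeasurable_real (a : T -> R) : measurable_fun setT a -> cmeasurable (fun x => a x +i* 0).
Proof. by move=> ma; apply: cmeasurable_pair => //; exact: measurable_cst. Qed.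

Lemma cmeasurable_cst z : cmeasurable (fun=> z).
Proof. by split; exact: measurable_cst. Qed.

Lemma cmeasurable_cis (a : T -> R) : measurable_fun setT a -> cmeasurable (fun x => cis (a x)).
Proof.
move=> ma; apply: cmeasurable_pair.
  exact: measurableT_comp measurable_cosT ma.
exact: measurableT_comp measurable_sinT ma.
Qed.

Lemma measurable_normc f : cmeasurable f -> measurable_fun setT (fun x => normc (f x)).
Proof.
move=> [f1 f2].
rewrite (_ : (fun x => _) = Num.sqrt \o (fun x => Re (f x) ^+ 2 + Im (f x) ^+ 2)); last first.
  by apply/funext => x /=; rewrite normcE.
apply: measurableT_comp; first exact: continuous_measurable_fun (@sqrt_continuous R).
by apply: measurable_funD; exact: measurable_funX.
Qed.

End complex_measurability.

Lemma cmeasurable_comp {R : realType} d d' (T : measurableType d) (U : measurableType d')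
    (f : U -> R[i]) (h : T -> U) : cmeasurable f -> measurable_fun setT h ->
  cmeasurable (fun x => f (h x)).
Proof. by move=> [f1 f2] mh; split; [exact: (measurableT_comp f1 mh)|exact: (measurableT_comp f2 mh)]. Qed.

Section complex_integral.
Local Open Scope complex_scope.
Context {R : realType} d (T : measurableType d).
Local Notation Re := (@complex.Re R).
Local Notation Im := (@complex.Im R).
Local Notation normc := Normc.normc.
Variable mu : {measure set T -> \bar R}.
Implicit Types f g : T -> R[i].

(** Integration of complex functions by components.  Norm bounds then come
    from rotating the value of the integral onto the real axis. *)
Definition cint (D : set T) f : R[i] :=
  (\int[mu]_(x in D) Re (f x)) +i* (\int[mu]_(x in D) Im (f x)).

Lemma integrable_Re D f h : measurable D -> cmeasurable f ->
  mu.-integrable D (EFin \o h) -> (forall x, D x -> normc (f x) <= h x) ->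
  mu.-integrable D (EFin \o (fun x => Re (f x))).
Proof.
move=> mD [f1 _] ih fh; apply: (integrable_dominated _ _ ih) => //.
  exact: measurable_funS f1.
by move=> x Dx; rewrite (le_trans _ (fh x Dx))// norm_Re_le.
Qed.

Lemma integrable_Im D f h : measurable D -> cmeasurable f ->
  mu.-integrable D (EFin \o h) -> (forall x, D x -> normc (f x) <= h x) ->
  mu.-integrable D (EFin \o (fun x => Im (f x))).
Proof.
move=> mD [_ f1] ih fh; apply: (integrable_dominated _ _ ih) => //.
  exact: measurable_funS f1.
by move=> x Dx; rewrite (le_trans _ (fh x Dx))// norm_Im_le.
Qed.

Lemma normc_cint_le D f h : measurable D -> cmeasurable f ->
  mu.-integrable D (EFin \o h) -> (forall x, D x -> normc (f x) <= h x) ->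
  normc (cint D f) <= \int[mu]_(x in D) h x.
Proof.
move=> mD mf ih fh; set z := cint D f.
have i1 := integrable_Re mD mf ih fh; have i2 := integrable_Im mD mf ih fh.
have h0 : 0 <= \int[mu]_(x in D) h x.
  by apply: Rintegral_ge0 => x Dx; rewrite (le_trans _ (fh x Dx))// normc_ge0.
have [z0|z0] := eqVneq (normc z) 0; first by rewrite z0.
have zp : 0 < normc z by rewrite lt_neqAle eq_sym z0 normc_ge0.
rewrite -(ler_pM2l zp) -expr2 sqr_normcE.
have -> : Re z ^+ 2 + Im z ^+ 2 =
    \int[mu]_(x in D) (Re z * Re (f x) + Im z * Im (f x)).
  rewrite RintegralD//; [|exact: intZl|exact: intZl].
  by rewrite (RintegralZl _ mD i1) (RintegralZl _ mD i2).
rewrite -RintegralZl//; apply: le_Rintegral => //.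
- by apply: intD => //; exact: intZl.
- exact: intZl.
move=> x Dx; apply: (@le_trans _ _ (normc z * normc (f x))).
  rewrite (le_trans (ler_norm _))// -(@ler_sqr R) ?nnegrE ?mulr_ge0 ?normc_ge0//.
  rewrite exprMn !sqr_normcE real_normK ?num_real//.
  move: (Re z) (Im z) (Re (f x)) (Im (f x)) => a b u v.
  by have := sqr_ge0 (a * v - b * u); nra.
by rewrite ler_pM2l// fh.
Qed.

End complex_integral.

Section real_synthesis.
Local Open Scope complex_scope.
Context {R : realType}.
Local Notation mu := (@lebesgue_measure R).
Local Notation Re := (@complex.Re R).
Local Notation Im := (@complex.Im R).
Local Notation normc := Normc.normc.
Implicit Types g h : R -> R[i].

Definition cL1 g := cmeasurable g /\ mu.-integrable setT (EFin \o (fun n => normc (g n))).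

(** The real part of the synthesis [F] of the modes [g]; its imaginary part is
    [rsynth] of [- i * g], so that all analysis stays real. *)
Definition rsynth g x := \int[mu]_n Re (g n * cis (n * x)).

Lemma cL1_dominated g (h : R -> R) : cmeasurable g -> mu.-integrable setT (EFin \o h) ->
  (forall n, normc (g n) <= h n) -> cL1 g.
Proof.
move=> mg ih gh; split=> //; apply: (integrable_dominated _ _ ih) => //.
  exact: measurable_normc.
by move=> n _; rewrite ger0_norm ?normc_ge0.
Qed.

Lemma cL1D g h : cL1 g -> cL1 h -> cL1 (fun n => g n + h n).
Proof.
move=> [mg ig] [mh ih]; apply: (cL1_dominated _ (intD measurableT ig ih)).
  exact: cmeasurableD.
by move=> n; exact: normcD.
Qed.

Lemma cL1Z c g : cL1 g -> cL1 (fun n => c * g n).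
Proof.
move=> [mg ig]; apply: (cL1_dominated _ (intZl (normc c) measurableT ig)).
  by apply: cmeasurableM => //; exact: cmeasurable_cst.
by move=> n; rewrite Normc.normcM.
Qed.

Lemma measurable_idM x : measurable_fun setT (fun n : R => n * x).
Proof. by apply: measurable_funM => //; exact: measurable_cst. Qed.

Lemma cmeasurable_synth g x : cmeasurable g -> cmeasurable (fun n => g n * cis (n * x)).
Proof. by move=> mg; apply: cmeasurableM => //; apply: cmeasurable_cis; exact: measurable_idM. Qed.

Lemma normc_Mcis z (t : R) : normc (z * cis t) = normc z.
Proof. by rewrite mulrC normc_cisM. Qed.

Lemma integrable_synth g x : cL1 g ->
  mu.-integrable setT (EFin \o (fun n => Re (g n * cis (n * x)))).
Proof.
move=> [mg ig]; apply: (integrable_Re _ _ ig) => //; first exact: cmeasurable_synth.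
by move=> n _; rewrite normc_Mcis.
Qed.

Lemma rsynthD g h x : cL1 g -> cL1 h -> rsynth (fun n => g n + h n) x = rsynth g x + rsynth h x.
Proof.
move=> g1 h1; rewrite /rsynth -RintegralD//; [|exact: integrable_synth|exact: integrable_synth].
by congr Rintegral; apply/funext => n; rewrite mulrDl cReD.
Qed.

Lemma rsynthZ (a : R) g x : cL1 g -> rsynth (fun n => (a +i* 0) * g n) x = a * rsynth g x.
Proof.
move=> g1; rewrite /rsynth -(RintegralZl a measurableT (integrable_synth x g1)).
by congr Rintegral; apply/funext => n; rewrite -mulrA cReM/= mul0r subr0.
Qed.

Lemma is_derive_under_integral (F F' : R -> R -> R) (G : R -> R) (a u v : R) :
  u < a < v -> (forall x, u < x < v -> mu.-integrable setT (EFin \o F x)) ->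
  (forall x n, u < x < v -> is_derive x 1 (F ^~ n) (F' x n)) ->
  mu.-integrable setT (EFin \o G) -> (forall x n, u < x < v -> `|F' x n| <= G n) ->
  is_derive a 1 (fun x => \int[mu]_n F x n) (\int[mu]_n F' a n).
Proof.
move=> auv iF dF iG FG.
have Ia : (`]u, v[%classic : set R) a by rewrite /= in_itv/=.
have G0 n : 0 <= G n by rewrite (le_trans _ (FG a n auv)).
have h1 x : (`]u, v[%classic : set R) x -> mu.-integrable setT (EFin \o F x).
  by rewrite /= in_itv/=; exact: iF.
have h2 x n : (`]u, v[%classic : set R) x -> setT n -> derivable (F ^~ n) x 1.
  by rewrite /= in_itv/= => xuv _; have [] := dF x n xuv.
have dE x n : u < x < v -> partial1of2 F x n = F' x n.
  by move=> xuv; rewrite partial1of2E; have [_ ->] := dF x n xuv.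
have h3 x n : (`]u, v[%classic : set R) x -> setT n -> `|partial1of2 F x n| <= G n.
  by rewrite /= in_itv/= => xuv _; rewrite dE// FG.
split; first exact: (derivable_under_integral measurableT Ia h1 h2 G0 iG h3).
rewrite -derive1E (differentiation_under_integral measurableT Ia h1 h2 G0 iG h3).
by congr Rintegral; apply/funext => n; rewrite dE.
Qed.

Lemma is_derive_Re_cis (z : R[i]) (n x : R) :
  is_derive x 1 (fun y : R => Re (z * cis (n * y))) (Re ((0 +i* n) * z * cis (n * x))).
Proof.
have e : (fun y : R => Re (z * cis (n * y))) = (fun y => Re z * cos (n * y) - Im z * sin (n * y)).
  by apply/funext => y; rewrite cReM.
rewrite e.
have h1 := is_derive_cosM n x; have h2 := is_derive_sinM n x.
have h3 := @is_deriveB _ _ _ _ _ _ _ _ _ (@is_deriveZ _ _ _ _ (Re z) _ _ _ h1) (@is_deriveZ _ _ _ _ (Im z) _ _ _ h2).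
apply: is_derive_eq; rewrite /GRing.scale/= !cReE/=; ring.
Qed.

Lemma is_derive_rsynth g (x : R) : cL1 g -> cL1 (fun n => (0 +i* n) * g n) ->
  is_derive x 1 (rsynth g) (rsynth (fun n => (0 +i* n) * g n) x).
Proof.
move=> g1 [mg' ig'].
apply: (@is_derive_under_integral (fun x n => Re (g n * cis (n * x)))
  (fun x n => Re ((0 +i* n) * g n * cis (n * x))) _ x (x - 1) (x + 1) _ _ _ ig').
- by rewrite ltrBlDr !ltrDl ltr01.
- by move=> y _; exact: integrable_synth.
- by move=> y n _; exact: is_derive_Re_cis.
- by move=> y n _; rewrite (le_trans (norm_Re_le _))// normc_Mcis.
Qed.

Definition conv g n := cint mu setT (fun m => g m * g (n - m)).

Lemma measurable_sub2 : measurable_fun setT (fun p : R * R => p.1 - p.2).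
Proof. exact: measurable_funB. Qed.

Lemma cmeasurable_conv2 g : cmeasurable g ->
  cmeasurable (fun p : R * R => g p.2 * g (p.1 - p.2)).
Proof.
move=> mg; apply: cmeasurableM; first exact: (cmeasurable_comp mg measurable_snd).
exact: (cmeasurable_comp mg measurable_sub2).
Qed.

Lemma cmeasurable_conv g : cmeasurable g -> cmeasurable (conv g).
Proof.
move=> /cmeasurable_conv2[m1 m2].
by split; [exact: (leb_measurable_Rint m1)|exact: (leb_measurable_Rint m2)].
Qed.

Lemma leb_ae_section (f : R * R -> R) : measurable_fun setT f ->
  (\int[mu]_x \int[mu]_y `|f (x, y)|%:E < +oo)%E ->
  {ae mu, forall x, mu.-integrable setT (fun y => (f (x, y))%:E)}.
Proof. exact: (@ae_integrable_section _ _ _ _ R mu mu f). Qed.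

Lemma leb_ae_eq_Rintegral (f g : R -> R) : measurable_fun setT f -> measurable_fun setT g ->
  {ae mu, forall x, f x = g x} -> \int[mu]_x f x = \int[mu]_x g x.
Proof.
move=> mf mg fg; rewrite /Rintegral; congr fine; apply: ae_eq_integral => //.
- exact/measurable_EFinP.
- exact/measurable_EFinP.
by apply: (leb_aeS fg) => x -> _.
Qed.

Lemma measurable_conv2 (u v : R -> R) : measurable_fun setT u -> measurable_fun setT v ->
  measurable_fun setT (fun p : R * R => u p.2 * v (p.1 - p.2)).
Proof.
move=> mf mg; apply: measurable_funM; first exact: (measurableT_comp mf measurable_snd).
exact: (measurableT_comp mg measurable_sub2).
Qed.

(** Tonelli and translation invariance: the convolution of integrable
    functions is finite almost everywhere. *)
Lemma conv_lty (u v : R -> R) : mu.-integrable setT (EFin \o u) ->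
  mu.-integrable setT (EFin \o v) ->
  (\int[mu]_n \int[mu]_m `|u m * v (n - m)|%:E < +oo)%E.
Proof.
move=> iu iv; have mu_ := integrable_measurable iu.
have mv := integrable_measurable iv.
have mv' : measurable_fun setT (fun n => `|v n|%:E).
  by apply/measurable_EFinP; exact: measurableT_comp.
have mP : measurable_fun setT (fun p : R * R => `|u p.2 * v (p.1 - p.2)|%:E).
  by apply/measurable_EFinP; apply: measurableT_comp => //; exact: measurable_conv2.
rewrite (leb_tonelli mP); last by move=> p; rewrite lee_fin.
rewrite /=.
under eq_integral => m _.
  under eq_integral do rewrite normrM EFinM.
  rewrite (@ge0_integralZl _ _ _ mu _ measurableT (fun n => `|v (n - m)|%:E))//; last first.
    by apply/measurable_EFinP; apply: measurableT_comp => //; apply: measurableT_comp => //; exact: measurable_funD.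
  rewrite (@ge0_integral_shift _ (fun n => `|v n|%:E) (- m))//.
  over.
have /integrableP[_ iu'] := iu; have /integrableP[_ iv'] := iv.
rewrite ge0_integralZr//; last 2 first.
- by apply/measurable_EFinP; exact: measurableT_comp.
- exact: integral_ge0.
apply: lte_mul_pinfty => //; first exact: integral_ge0.
by rewrite ge0_fin_numE// integral_ge0.
Qed.

Lemma ae_integrable_conv (u v : R -> R) : mu.-integrable setT (EFin \o u) ->
  mu.-integrable setT (EFin \o v) ->
  {ae mu, forall n, mu.-integrable setT (EFin \o (fun m => u m * v (n - m)))}.
Proof.
move=> iu iv; have mu_ := integrable_measurable iu.
have mv := integrable_measurable iv.
exact: (leb_ae_section (measurable_conv2 mu_ mv) (conv_lty iu iv)).
Qed.

(** This is [2 Re F Im F = Im (F ^ 2)], where the modes of [F ^ 2] are [conv g]: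
    the product of the two integrals becomes a double integral over the
    frequencies [k] and [m], and [n = k + m] is the new outer variable. *)
Lemma rsynth_sqr g x : cL1 g ->
  2 * (rsynth g x * rsynth (fun n => (0 -i* 1) * g n) x) = rsynth (fun n => (0 -i* 1) * conv g n) x.
Proof.
move=> g1; have [mg ig] := g1.
set b := fun k => Re ((0 -i* 1) * g k * cis (k * x)).
set a := fun k => Re (g k * cis (k * x)).
have ia : mu.-integrable setT (EFin \o a) by exact: integrable_synth.
have ib : mu.-integrable setT (EFin \o b) by apply: integrable_synth; exact: cL1Z.
have mS := cmeasurable_synth x mg.
pose P := fun p : R * R => Im (g p.2 * g (p.1 - p.2) * cis (p.1 * x)).
have cP : cmeasurable (fun p : R * R => g p.2 * g (p.1 - p.2) * cis (p.1 * x)).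
  apply: cmeasurableM; first exact: cmeasurable_conv2.
  by apply: cmeasurable_cis; apply: measurable_funM => //; exact: measurable_cst.
have mP : measurable_fun setT P by case: cP.
have PE m k : a m * b k + b m * a k = P (k + m, m).
  rewrite /P /= addrK /a /b mulrDl cisD !cReE/=; ring.
have lP : (\int[mu]_n \int[mu]_m `|P (n, m)|%:E < +oo)%E.
  apply: (le_lt_trans _ (conv_lty ig ig)).
  have mN : measurable_fun setT (fun p : R * R => `|normc (g p.2) * normc (g (p.1 - p.2))|%:E).
    apply/measurable_EFinP; apply: measurableT_comp => //.
    exact: (measurable_conv2 (measurable_normc mg) (measurable_normc mg)).
  have mP' : measurable_fun setT (fun p : R * R => `|P p|%:E).
    by apply/measurable_EFinP; exact: measurableT_comp.
  apply: ge0_le_integral => //.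
  - by move=> n _; exact: integral_ge0.
  - exact: (leb_measurable_F mP').
  - exact: (leb_measurable_F mN).
  move=> n _; apply: ge0_le_integral => //.
  - exact: (measurableT_comp mP' (pair1_measurable n)).
  - exact: (measurableT_comp mN (pair1_measurable n)).
  move=> m _; rewrite lee_fin (le_trans (norm_Im_le _))// normc_Mcis Normc.normcM.
  exact: ler_norm.
transitivity (\int[mu]_n \int[mu]_m P (n, m)); last first.
  apply: leb_ae_eq_Rintegral.
  - exact: leb_measurable_Rint.
  - have := cmeasurable_synth x (cmeasurableM (cmeasurable_cst _ (0 -i* 1)) (cmeasurable_conv mg)).
    by case.
  apply: (leb_aeS (ae_integrable_conv ig ig)) => n ign.
  have mgn : cmeasurable (fun m => g m * g (n - m)).
    by have := cmeasurable_comp (cmeasurable_conv2 mg) (pair1_measurable n).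
  have i1 := @integrable_Re R _ _ mu setT _ _ measurableT mgn ign.
  have i2 := @integrable_Im R _ _ mu setT _ _ measurableT mgn ign.
  have {}i1 := i1 (fun m _ => normcM_le _ _).
  have {}i2 := i2 (fun m _ => normcM_le _ _).
  rewrite !cReE/=.
  transitivity (cos (n * x) * (\int[mu]_m Im (g m * g (n - m)))
     + sin (n * x) * (\int[mu]_m Re (g m * g (n - m)))); last by ring.
  rewrite -(RintegralZl _ measurableT i1) -(RintegralZl _ measurableT i2) -RintegralD//.
  - by congr Rintegral; apply/funext => m; rewrite /P/= [in LHS]cImM/=; ring.
  - exact: intZl.
  - exact: intZl.
rewrite (leb_fubini mP lP).
transitivity (\int[mu]_m (a m * rsynth (fun n => (0 -i* 1) * g n) x + b m * rsynth g x)).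
  rewrite RintegralD//.
  - rewrite !RintegralZr//; rewrite -/(rsynth _ _) -/(rsynth _ _) /=; ring.
  - by under eq_fun do rewrite mulrC; exact: intZl.
  - by under eq_fun do rewrite mulrC; exact: intZl.
congr Rintegral; apply/funext => m.
have mPm : measurable_fun setT (fun n => P (n, m)).
  exact: (measurableT_comp mP (pair2_measurable m)).
rewrite -(Rintegral_shift m mPm) -!RintegralZl// -RintegralD//.
- by congr Rintegral; apply/funext => k; rewrite PE.
- exact: intZl.
- exact: intZl.
Qed.

End real_synthesis.

(** * The Hilbert transform of a synthesis *)

Section sine_integral.
Context {R : realType}.
Local Notation mu := (@lebesgue_measure R).
Implicit Types n s x a b : R.

Lemma one_sub_cos_le_sqr x : 1 - cos x <= x ^+ 2 / 2.
Proof.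
have -> : 1 - cos x = 2 * (sin (x / 2)) ^+ 2.
  have h : x = x / 2 + x / 2 by field.
  rewrite {1}h cosD; have := cos2Dsin2 (x / 2); nra.
have := lipschitz_sin (x / 2) 0; rewrite sin0 !subr0 => h.
have : (sin (x / 2)) ^+ 2 <= (x / 2) ^+ 2.
  by rewrite -[leLHS]real_normK ?num_real// -[leRHS]real_normK ?num_real// ler_sqr ?nnegrE.
by nra.
Qed.

Definition ker n s : R := (1 - cos (n * s)) / s ^+ 2 / n.

(** Twice the integral of [sin (n * s) / s] over [0 < s < b], after an
    integration by parts that makes the integral absolutely convergent up to
    [b = +oo]. *)
Definition si n b : R := 2 * ((1 - cos (n * b)) / (n * b) + \int[mu]_(s in `[0, b]) ker n s).

Lemma integrable_ker n : mu.-integrable setT (EFin \o ker n).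
Proof.
have := intZl n^-1 measurableT (integrable_dirichlet n).
by apply: eq_integrable => // s _; rewrite /ker/= mulrC.
Qed.

Lemma ker_ge0 n s : 0 < n -> 0 <= ker n s.
Proof. by move=> n0; rewrite /ker divr_ge0// ?dirichlet_ge0// ltW. Qed.

Lemma integral_ker_half n : 0 < n -> \int[mu]_(s in `]0, +oo[) ker n s = pi / 2.
Proof.
move=> n0; have h := Rintegral_even (integrable_ker n).
have h2 : \int[mu]_s ker n s = pi.
  rewrite /ker; under eq_Rintegral do rewrite mulrC.
  rewrite RintegralZl//; last exact: integrable_dirichlet.
  by rewrite Rintegral_dirichlet gtr0_norm//; field; rewrite gt_eqF.
have {}h : \int[mu]_s ker n s = 2 * \int[mu]_(s in `]0, +oo[) ker n s.
  by apply: h => s; rewrite /ker mulrN cosN sqrrN.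
by rewrite h2 in h; rewrite h; field.
Qed.

Lemma ker_itvE n b : 0 <= b -> \int[mu]_(s in `[0, b]) ker n s =
  \int[mu]_(s in `]0, +oo[) (\1_(`[0, b]%classic : set R) s * ker n s).
Proof.
move=> b0; rewrite -Rintegral_itv_obnd_cbnd; last first.
  by apply: integrableS (integrable_ker n).
rewrite Rintegral_mkcond [RHS]Rintegral_mkcond; apply: eq_Rintegral => s _.
rewrite !patchE !indicE; have [s0|s0] := ltP 0 s.
  rewrite [in RHS]ifT ?inE/= ?in_itv/= ?s0//.
  case: ifPn; rewrite ?inE ?notin_setE/= !in_itv/= s0/= => h.
    by rewrite mem_set ?mul1r//= in_itv/= (ltW s0).
  by rewrite memNset ?mul0r//= in_itv/= (ltW s0).
by rewrite !ifF//; apply/negP; rewrite inE/= in_itv/= ltNge s0.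
Qed.

Lemma measurable_ker n : measurable_fun setT (ker n).
Proof. exact: integrable_measurable (integrable_ker n). Qed.

Lemma measurable_ind_ker b n :
  measurable_fun setT (fun s => \1_(`[0, b]%classic : set R) s * ker n s).
Proof. by apply: measurable_funM; [exact: measurable_indic|exact: measurable_ker]. Qed.

Lemma ker_itv_ge0 n b : 0 < n -> 0 <= \int[mu]_(s in `[0, b]) ker n s.
Proof. by move=> n0; apply: Rintegral_ge0 => s _; exact: ker_ge0. Qed.

Lemma ker_itv_le n b : 0 < n -> 0 <= b -> \int[mu]_(s in `[0, b]) ker n s <= pi / 2.
Proof.
move=> n0 b0; rewrite ker_itvE// -(integral_ker_half n0).
have i1 : mu.-integrable `]0, +oo[ (EFin \o ker n) by apply: integrableS (integrable_ker n).
apply: le_Rintegral => //.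
  apply: (integrable_dominated _ _ i1) => //.
    exact: measurable_funTS (measurable_ind_ker b n).
  move=> s _; rewrite indicE normrM ger0_norm; last by case: (_ \in _).
  by rewrite (ger0_norm (ker_ge0 _ n0)) ler_piMl ?ker_ge0//; case: (_ \in _).
by move=> s _; rewrite indicE ler_piMl ?ker_ge0//; case: (_ \in _).
Qed.

Lemma si_ge0 n b : 0 < n -> 0 < b -> 0 <= si n b.
Proof.
move=> n0 b0; rewrite /si mulr_ge0// addr_ge0 ?ker_itv_ge0//.
by rewrite divr_ge0 ?one_sub_cos_ge0// mulr_ge0// ltW.
Qed.

(** A bound uniform in the frequency and the radius: it dominates the
    convergence of the truncated Hilbert transforms. *)
Lemma si_le n b : 0 < n -> 0 < b -> si n b <= 2 + pi.
Proof.
move=> n0 b0; have nb : 0 < n * b by rewrite mulr_gt0.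
have h1 : (1 - cos (n * b)) / (n * b) <= 1.
  by rewrite ler_pdivrMr// mul1r; have := one_sub_cos_le_norm (n * b); rewrite gtr0_norm.
have h2 := ker_itv_le n0 (ltW b0); rewrite /si; lra.
Qed.

Lemma si_le_lin n b : 0 < n -> 0 < b -> si n b <= 2 * n * b.
Proof.
move=> n0 b0; have nb : 0 < n * b by rewrite mulr_gt0.
have h1 : (1 - cos (n * b)) / (n * b) <= n * b / 2.
  by rewrite ler_pdivrMr//; have := one_sub_cos_le_sqr (n * b); nra.
have h2 : \int[mu]_(s in `[0, b]) ker n s <= n * b / 2.
  have -> : n * b / 2 = \int[mu]_(s in `[0, b]) (n / 2).
    rewrite Rintegral_cst//= lebesgue_measure_itv/= lte_fin b0 oppr0 adde0/=; by field.
  apply: le_Rintegral => //.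
  - by apply: integrableS (integrable_ker n).
  - apply: (@continuous_compact_integrable _ (cst (n / 2))); first exact: segment_compact.
    by apply: continuous_subspaceT => z; exact: cst_continuous.
  move=> s _; rewrite /ker; have [->|s0] := eqVneq s 0.
    by rewrite expr0n/= invr0 !mulr0 mul0r divr_ge0// ltW.
  have s2 : 0 < s ^+ 2 by rewrite exprn_even_gt0.
  rewrite ler_pdivrMr// ler_pdivrMr//.
  by have := one_sub_cos_le_sqr (n * s); rewrite exprMn; nra.
rewrite /si; nra.
Qed.

Lemma cvg_si_right0 n : 0 < n -> si n b @[b --> 0^'+] --> 0.
Proof.
move=> n0; apply: (@squeeze_cvgr _ _ _ _ (fun=> 0) (fun b => 2 * n * b)).
- near=> b; have b0 : 0 < b by [].
  by rewrite si_ge0// si_le_lin.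
- exact: cvg_cst.
- rewrite -[X in _ --> X](mulr0 (2 * n)); apply: cvgMr.
  by apply: cvg_at_right_filter; exact: cvg_id.
Unshelve. all: by end_near. Qed.

Lemma cvg_si_pinfty n : 0 < n -> si n b @[b --> +oo] --> pi.
Proof.
move=> n0; apply/cvg_pinftyP => u uoo.
have upos : \forall k \near \oo, 0 < u k by move/cvgryPgt : uoo; exact.
have -> : pi = 2 * (0 + pi / 2) :> R by field.
apply: cvgMr; apply: cvgD.
  have h : (u k)^-1 @[k --> \oo] --> 0 by apply/gtr0_cvgV0.
  apply: (@squeeze_cvgr _ _ _ _ (fun=> 0) (fun k => 2 / n * (u k)^-1)).
  - near=> k; have uk : 0 < u k by near: k.
    rewrite divr_ge0 ?one_sub_cos_ge0 ?mulr_ge0 ?(ltW n0) ?(ltW uk)//=.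
    rewrite invfM mulrA ler_pM2r ?invr_gt0// ler_pM2r ?invr_gt0//.
    exact: one_sub_cos_le2.
  - exact: cvg_cst.
  - by rewrite -[X in _ --> X](mulr0 (2 / n)); exact: cvgMr.
rewrite -(integral_ker_half n0).
have i1 : mu.-integrable `]0, +oo[ (EFin \o ker n) by apply: integrableS (integrable_ker n).
apply: cvg_trans; last first.
  apply: (@cvg_Rintegral_dominated _ _ _ mu `]0, +oo[%classic
    (fun k s => \1_(`[0, u k]%classic : set R) s * ker n s) (ker n) (ker n)) => //.
  - move=> k; exact: measurable_funTS (measurable_ind_ker (u k) n).
  - exact: measurable_funTS (measurable_ker n).
  - apply: nearW => s /=; rewrite in_itv/= andbT => s0.
    apply: cvg_near_cst; near=> k.
    rewrite indicE mem_set ?mul1r//= in_itv/= (ltW s0)/= ltW//.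
    by near: k; move/cvgryPgt : uoo; exact.
  - move=> k s _; rewrite indicE normrM ger0_norm; last by case: (_ \in _).
    by rewrite (ger0_norm (ker_ge0 _ n0)) ler_piMl ?ker_ge0//; case: (_ \in _).
apply: near_eq_cvg; near=> k.
have uk : 0 < u k by near: k.
by rewrite ker_itvE ?ltW.
Unshelve. all: by end_near. Qed.

Lemma integral_sinc_itv n a b : 0 < n -> 0 < a -> a < b ->
  2 * \int[mu]_(s in `[a, b]) (sin (n * s) / s) = si n b - si n a.
Proof.
move=> n0 a0 ab; have b0 := lt_trans a0 ab.
pose F s := (1 - cos (n * s)) / (n * s).
pose f s := sin (n * s) / s - ker n s.
have Fd s : 0 < s -> is_derive s 1 F (f s).
  move=> s0; have ns : n * s != 0 by rewrite mulf_neq0 ?gt_eqF.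
  have h1 := is_derive_cosM n s.
  have h2 : is_derive s 1 (fun y : R => n * y) n.
    by apply: is_derive_eq; rewrite /GRing.scale/=; ring.
  have h3 := @is_deriveV _ (fun y : R => n * y) _ _ _ ns h2.
  rewrite /F; apply: is_derive_eq; rewrite /GRing.scale/= /f /ker.
  by field; rewrite !gt_eqF.
have cf s : 0 < s -> {for s, continuous f}.
  move=> s0; rewrite /f /ker.
  have hs := is_derive_continuous (is_derive_sinM n s).
  have hc := is_derive_continuous (is_derive_cosM n s).
  have s2 : s ^+ 2 != 0 by rewrite expf_neq0 ?gt_eqF.
  apply: cvgB; first by apply: cvgM => //; apply: cvgV => //; rewrite gt_eqF.
  apply: cvgM; last exact: cvg_cst.
  apply: cvgM; first by apply: cvgB => //; exact: cvg_cst.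
  by apply: cvgV => //; exact: exprn_continuous.
have inI s : s \in `[a, b] -> 0 < s by rewrite in_itv/= => /andP[/(lt_le_trans a0)].
have cfI : {within `[a, b], continuous f}.
  by apply: continuous_in_subspaceT => s; rewrite inE/= => /inI; exact: cf.
have E : \int[mu]_(s in `[a, b]) f s = F b - F a.
  rewrite /Rintegral (@continuous_FTC2 _ _ F)//.
  - split.
    + move=> s; rewrite in_itv/= => /andP[/(lt_trans a0) /Fd h _]; by case: h.
    + by apply: cvg_at_right_filter; exact: (is_derive_continuous (Fd a a0)).
    + by apply: cvg_at_left_filter; exact: (is_derive_continuous (Fd b b0)).
  - move=> s; rewrite in_itv/= => /andP[/(lt_trans a0) /Fd h _]; rewrite derive1E; exact: derive_val.
have iT D : measurable D -> mu.-integrable D (EFin \o ker n).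
  by move=> mD; apply: integrableS (integrable_ker n).
have K : \int[mu]_(s in `[a, b]) ker n s =
    \int[mu]_(s in `[0, b]) ker n s - \int[mu]_(s in `[0, a]) ker n s.
  rewrite Rintegral_itvB ?bnd_simp ?(ltW a0) ?(ltW ab)//; last exact: iT.
  by rewrite Rintegral_itv_obnd_cbnd//; exact: iT.
have -> : \int[mu]_(s in `[a, b]) (sin (n * s) / s) =
    \int[mu]_(s in `[a, b]) f s + \int[mu]_(s in `[a, b]) ker n s.
  rewrite -RintegralD//; last 2 first.
  - by apply: continuous_compact_integrable => //; exact: segment_compact.
  - exact: iT.
  by apply: eq_Rintegral => s _; rewrite /f subrK.
by rewrite E K /si /F; ring.
Qed.

Lemma measurable_si b : 0 < b -> measurable_fun setT (si ^~ b).
Proof.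
move=> b0; rewrite /si; apply: measurable_funM; first exact: measurable_cst.
apply: measurable_funD.
  apply: measurable_funM.
    by apply: measurable_funB => //; exact: measurable_cosM.
  exact: (measurableT_comp measurable_invr (measurable_idM b)).
have mP : measurable_fun setT (fun p : R * R => \1_(`[0, b]%classic : set R) p.2 * ker p.1 p.2).
  apply: measurable_funM.
    by apply: (measurableT_comp _ measurable_snd); exact: measurable_indic.
  rewrite /ker; apply: measurable_funM; last exact: (measurableT_comp measurable_invr measurable_fst).
  apply: measurable_funM.
    apply: measurable_funB => //.
    by apply: (measurableT_comp measurable_cosT); exact: measurable_funM.
  apply: (measurableT_comp measurable_invr).
  by apply: measurable_funX.
apply: eq_measurable_fun (leb_measurable_Rint mP) => n _ /=.
rewrite [RHS]Rintegral_mkcond; apply: eq_Rintegral => s _; rewrite patchE indicE.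
by case: ifPn; rewrite ?mul1r ?mul0r.
Qed.

(** The annulus of the principal value, centred at the origin. *)
Definition band a b s : R := if a < `|s| < b then 1 else 0.

Lemma measurable_band a b : measurable_fun setT (band a b).
Proof.
have -> : band a b = \1_([set s : R | a < `|s|] `&` [set s : R | `|s| < b]).
  apply/funext => s; rewrite /band indicE; case: ifPn => h.
    by rewrite mem_set//; apply/andP.
  by rewrite memNset// => -[/= h1 h2]; rewrite h1 h2 in h.
apply: measurable_indic; apply: measurableI.
  rewrite (_ : [set _ | _] = setT `&` Num.norm @^-1` `]a, +oo[%classic); last first.
    by apply/seteqP; split => s /=; rewrite in_itv/= andbT// => -[].
  by apply: (@normr_measurable R setT).
rewrite (_ : [set _ | _] = setT `&` Num.norm @^-1` `]-oo, b[%classic); last first.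
  by apply/seteqP; split => s /=; rewrite in_itv//= => -[].
by apply: (@normr_measurable R setT).
Qed.

Lemma bandN a b s : band a b (- s) = band a b s.
Proof. by rewrite /band normrN. Qed.

Lemma integrable_band_inv a b : 0 < a -> mu.-integrable setT (EFin \o (fun s => band a b s / s)).
Proof.
move=> a0; set D : set R := `[- b, b]%classic.
have mD : measurable D by exact: measurable_itv.
have iD : mu.-integrable setT (EFin \o (fun s : R => a^-1 * \1_D s)).
  apply: intZl => //; apply/integrableP; split.
    by apply/measurable_EFinP; exact: measurable_indic.
  under eq_integral do rewrite /= ger0_norm//.
  by rewrite integral_indic// setIT /D/= lebesgue_measure_itv/=; case: ifP => // _; rewrite -EFinB ltry.
apply: (integrable_dominated _ _ iD) => //.
  apply: measurable_funM; [exact: measurable_band|exact: measurable_invr].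
move=> s _; rewrite /band; case: ifPn => [|_]; last by rewrite mul0r normr0 mulr_ge0 ?invr_ge0 ?(ltW a0).
move=> /andP[as_ sb]; rewrite mul1r normfV indicE mem_set; last first.
  by rewrite /D/= in_itv/= -ler_norml ltW.
by rewrite mulr1 lef_pV2 ?posrE// ?ltW// (lt_trans a0).
Qed.

Lemma integrable_band_bounded a b (h : R -> R) : 0 < a -> measurable_fun setT h ->
  (forall s, `|h s| <= 1) -> mu.-integrable setT (EFin \o (fun s => band a b s / s * h s)).
Proof. by move=> a0 mh h1; exact: (integrable_mul_bounded (integrable_band_inv b a0) mh h1). Qed.

Lemma integral_band_cos n a b : 0 < a -> \int[mu]_s (band a b s / s * cos (n * s)) = 0.
Proof.
move=> a0; apply: Rintegral_odd.
  apply: integrable_band_bounded => //; last by move=> s; exact: norm_cos_le1.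
  by under eq_fun do rewrite mulrC; exact: measurable_cosM.
by move=> s; rewrite bandN mulrN cosN invrN mulrN mulNr.
Qed.

Lemma integral_band_sin n a b : 0 < n -> 0 < a -> a < b ->
  \int[mu]_s (band a b s / s * sin (n * s)) = si n b - si n a.
Proof.
move=> n0 a0 ab; rewrite -(integral_sinc_itv n0 a0 ab) Rintegral_even.
- congr (_ * _); rewrite -Rintegral_itv_obnd_cbnd; last first.
    apply: (@integrableS _ _ _ mu `[a, b]%classic) => //.
      by apply: subset_itvr; rewrite bnd_simp.
    apply: continuous_compact_integrable; first exact: segment_compact.
    apply: continuous_in_subspaceT => s; rewrite inE/= in_itv/= => /andP[/(lt_le_trans a0) s0 _].
    have hs := is_derive_continuous (is_derive_sinM n s).
    by apply: cvgM => //; apply: cvgV => //; rewrite gt_eqF.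
  rewrite -Rintegral_itv_bndo_bndc; last first.
    apply: (@integrableS _ _ _ mu `[a, b]%classic) => //.
      by apply: subset_itv; rewrite bnd_simp.
    apply: continuous_compact_integrable; first exact: segment_compact.
    apply: continuous_in_subspaceT => s; rewrite inE/= in_itv/= => /andP[/(lt_le_trans a0) s0 _].
    have hs := is_derive_continuous (is_derive_sinM n s).
    by apply: cvgM => //; apply: cvgV => //; rewrite gt_eqF.
  rewrite Rintegral_mkcond [RHS]Rintegral_mkcond; apply: eq_Rintegral => s _.
  rewrite !patchE /band; have [s0|s0] := ltP 0 s; last first.
    rewrite !ifF//; apply/negP; rewrite inE/= in_itv/=; last by rewrite ltNge s0.
    by move=> /andP[/(lt_trans a0)]; rewrite ltNge s0.
  rewrite ifT ?inE/= ?in_itv/= ?s0// gtr0_norm//.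
  case: ifPn => h; last first.
    by rewrite ifF ?mul0r//; apply/negP; rewrite inE/= in_itv/=; exact/negP.
  by rewrite ifT ?inE/= ?in_itv//= mul1r mulrC.
- apply: integrable_band_bounded => //; last by move=> s; exact: norm_sin_le1.
  by under eq_fun do rewrite mulrC; exact: measurable_sinM.
by move=> s; rewrite bandN mulrN sinN invrN; ring.
Qed.

End sine_integral.

Section synthesis_bounded.
Context {R : realType}.
Local Notation mu := (@lebesgue_measure R).

Lemma norm_rsynth_le (g : R -> R[i]) x : cL1 g ->
  `|rsynth g x| <= \int[mu]_n Normc.normc (g n).
Proof.
move=> g1; have [_ ig] := g1.
apply: (le_trans (le_normr_Rintegral _ (integrable_synth x g1))) => //.
apply: le_Rintegral => //; first exact: integrable_norm (integrable_synth x g1).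
by move=> n _; rewrite (le_trans (norm_Re_le _))// normc_Mcis.
Qed.

Lemma measurable_rsynth (g : R -> R[i]) : cmeasurable g -> measurable_fun setT (rsynth g).
Proof.
move=> mg.
have [h _] : cmeasurable (fun p : R * R => g p.2 * cis (p.2 * p.1)).
  apply: cmeasurableM; first exact: cmeasurable_comp mg measurable_snd.
  by apply: cmeasurable_cis; exact: measurable_funM.
exact: (leb_measurable_Rint h).
Qed.

End synthesis_bounded.

(** For one frequency [n > 0] the truncated Hilbert transform of a sinusoid is,
    by parity, the conjugate sinusoid times [si n b - si n a] up to [pi]: it
    converges as [a] tends to 0 and [b] to infinity.  Fubini's theorem and
    dominated convergence extend this to an integrable superposition. *)
Section hilbert_transform.
Local Open Scope complex_scope.
Context {R : realType}.
Local Notation mu := (@lebesgue_measure R).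
Local Notation Re := (@complex.Re R).
Local Notation Im := (@complex.Im R).
Local Notation normc := Normc.normc.
Variable g : R -> R[i].
Hypothesis g1 : cL1 g.
Hypothesis g0 : forall n, n <= 0 -> g n = 0.
Variable x : R.

Let b n := Im (g n * cis (n * x)).

Let a n := Re (g n * cis (n * x)).

Lemma Rintegral_cst0 D : \int[mu]_(s in D) (0 : R) = 0.
Proof. by rewrite /Rintegral integral0. Qed.

Lemma annulus_band (f : R -> R) p : measurable_fun setT f ->
  \int[mu]_(y in annulus x p) (f y / (x - y)) = \int[mu]_s (band p.1 p.2 s / s * f (x - s)).
Proof.
move=> mf; rewrite Rintegral_mkcond.
have e : (fun y => f y / (x - y)) \_ (annulus x p) =
    fun y => band p.1 p.2 (x - y) / (x - y) * f y.
  apply/funext => y; rewrite patchE /band; case: ifPn; rewrite ?inE ?notin_setE /annulus/=.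
    by move=> ->; rewrite mul1r mulrC.
  by move=> /negP/negbTE ->; rewrite !mul0r.
rewrite e -(@Rintegral_reflect _ _ x).
  by apply: eq_Rintegral => s _; rewrite subKr.
apply: measurable_funM => //; apply: measurable_funM.
  by apply: (measurableT_comp (measurable_band _ _)); exact: measurable_funB.
by apply: (measurableT_comp measurable_invr); exact: measurable_funB.
Qed.

Lemma cmeasurable_rsynth_aux : measurable_fun setT a /\ measurable_fun setT b.
Proof. by have [mg _] := g1; have := cmeasurable_synth x mg. Qed.

Lemma integrable_b : mu.-integrable setT (EFin \o b).
Proof.
have [mg ig] := g1; apply: (integrable_dominated _ _ ig) => //.
  by case: cmeasurable_rsynth_aux.
by move=> n _; rewrite (le_trans (norm_Im_le _))// normc_Mcis.
Qed.

Lemma b_neg n : n <= 0 -> b n = 0.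
Proof. by move=> n0; rewrite /b g0// mul0r. Qed.

Lemma norm_b_si_le c n : 0 < c -> `|b n * si n c| <= `|b n| * (2 + pi).
Proof.
move=> c0; rewrite normrM; have [n0|n0] := ltP 0 n; last by rewrite b_neg// normr0 !mul0r.
by rewrite ler_wpM2l// ger0_norm ?si_ge0 ?si_le.
Qed.

Lemma integrable_b_bound : mu.-integrable setT (EFin \o (fun n => `|b n| * (2 + pi))).
Proof.
have h : mu.-integrable setT (EFin \o (fun n => `|b n|)) by exact: integrable_norm integrable_b.
by apply: eq_integrable (intZl (2 + pi) measurableT h) => // n _; rewrite /= mulrC.
Qed.

(** After Fubini, only the odd part in [s] of [Re (g n * cis (n * (x - s)))]
    survives the odd kernel [s^-1] on the symmetric band. *)
Lemma hilbert_trunc_rsynth al be : 0 < al -> al < be ->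
  hilbert_trunc (rsynth g) x (al, be) =
  pi^-1 * \int[mu]_n (b n * si n be) - pi^-1 * \int[mu]_n (b n * si n al).
Proof.
move=> a0 ab; have b0 := lt_trans a0 ab.
have [mg ig] := g1.
rewrite /hilbert_trunc annulus_band/=; last exact: measurable_rsynth.
pose P (p : R * R) := band al be p.1 / p.1 * Re (g p.2 * cis (p.2 * (x - p.1))).
have ik := integrable_band_inv be a0.
have mP : measurable_fun setT P.
  apply: measurable_funM.
    exact: (measurableT_comp (integrable_measurable ik) measurable_fst).
  have : cmeasurable (fun p : R * R => g p.2 * cis (p.2 * (x - p.1))).
    apply: cmeasurableM; first exact: cmeasurable_comp mg measurable_snd.
    apply: cmeasurable_cis; apply: measurable_funM => //.
    exact: measurable_funB.
  by case.
have lP : (\int[mu]_s \int[mu]_n `|P (s, n)|%:E < +oo)%E.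
  apply: (leb_tensor_lty mP ik ig) => s n; rewrite /P/= normrM ler_wpM2l//.
  by rewrite (le_trans (norm_Re_le _))// normc_Mcis ler_norm.
transitivity (pi^-1 * \int[mu]_s \int[mu]_n P (s, n)).
  congr (_ * _); apply: eq_Rintegral => s _; rewrite -RintegralZl//.
  exact: integrable_synth.
rewrite (leb_fubini mP lP) -mulrBr; congr (_ * _).
have ib c : 0 < c -> mu.-integrable setT (EFin \o (fun n => b n * si n c)).
  move=> c0; apply: (integrable_dominated _ _ integrable_b_bound) => //.
    apply: measurable_funM; last exact: measurable_si.
    by case: cmeasurable_rsynth_aux.
  by move=> n _; exact: norm_b_si_le.
rewrite -RintegralB//; [|exact: ib|exact: ib].
apply: eq_Rintegral => n _.
have [n0|n0] := ltP 0 n; last first.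
  rewrite b_neg// !mul0r subrr -[RHS](Rintegral_cst0 setT).
  by apply: eq_Rintegral => s _; rewrite /P/= g0// mul0r mulr0.
have i1 : mu.-integrable setT (EFin \o (fun s => band al be s / s * cos (n * s))).
  apply: integrable_band_bounded => //; last by move=> s; exact: norm_cos_le1.
  by under eq_fun do rewrite mulrC; exact: measurable_cosM.
have i2 : mu.-integrable setT (EFin \o (fun s => band al be s / s * sin (n * s))).
  apply: integrable_band_bounded => //; last by move=> s; exact: norm_sin_le1.
  by under eq_fun do rewrite mulrC; exact: measurable_sinM.
transitivity (\int[mu]_s (a n * (band al be s / s * cos (n * s)) +
    b n * (band al be s / s * sin (n * s)))).
  apply: eq_Rintegral => s _; rewrite /P/= mulrBr cisD mulrA [in LHS]cReM /a /b/=.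
  by rewrite cosN sinN; ring.
rewrite RintegralD//; [|exact: intZl|exact: intZl].
rewrite (RintegralZl _ _ i1)// (RintegralZl _ _ i2)//.
by rewrite integral_band_cos// integral_band_sin//; ring.
Qed.

Lemma cvg_b_si (u : R ^nat) (c : R -> R) : (forall k, 0 < u k) ->
  (forall n, 0 < n -> si n (u k) @[k --> \oo] --> c n) -> measurable_fun setT (fun n => b n * c n) ->
  \int[mu]_n (b n * si n (u k)) @[k --> \oo] --> \int[mu]_n (b n * c n).
Proof.
move=> u0 uc mc; have [_ mb] := cmeasurable_rsynth_aux.
apply: (@cvg_Rintegral_dominated _ _ _ mu setT (fun k n => b n * si n (u k))
   (fun n => b n * c n) (fun n => `|b n| * (2 + pi))) => //.
- by move=> k; apply: measurable_funM => //; exact: measurable_si.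
- apply: nearW => n _; have [n0|n0] := ltP 0 n.
    by apply: cvgMr; exact: uc.
  by rewrite b_neg// mul0r; under eq_fun do rewrite mul0r; exact: cvg_cst.
- exact: integrable_b_bound.
- by move=> k n _; exact: norm_b_si_le.
Qed.

Let Psi c := pi^-1 * \int[mu]_n (b n * si n c).

Lemma cvg_Psi_right0 : Psi c @[c --> 0^'+] --> 0.
Proof.
apply/cvg_at_rightP => u [u0 uc]; rewrite -[X in _ --> X](mulr0 pi^-1); apply: cvgMr.
have -> : 0 = \int[mu]_n (b n * 0) by under eq_Rintegral do rewrite mulr0; rewrite Rintegral_cst// mul0r.
apply: cvg_b_si => //; last by under eq_fun do rewrite mulr0; exact: measurable_cst.
move=> n n0; have /cvg_at_rightP := cvg_si_right0 n0; apply.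
by split.
Qed.

Lemma cvg_Psi_pinfty : Psi c @[c --> +oo] --> rsynth (fun n => (0 -i* 1) * g n) x.
Proof.
have [_ mb] := cmeasurable_rsynth_aux.
have -> : rsynth (fun n => (0 -i* 1) * g n) x = pi^-1 * \int[mu]_n (b n * pi).
  under [in RHS]eq_Rintegral do rewrite mulrC.
  rewrite RintegralZl//; last exact: integrable_b.
  rewrite mulrA mulVf ?gt_eqF ?pi_gt0// mul1r; apply: eq_Rintegral => n _.
  by rewrite /b -mulrA cReM/=; ring.
apply/cvg_pinftyP => u uoo; apply: cvgMr.
have [N _ Nu] : \forall k \near \oo, 0 < u k by move/cvgryPgt : uoo; exact.
rewrite -(cvg_shiftn N).
apply: (@cvg_b_si (fun k => u (k + N)%N)).
- by move=> k; apply: Nu => /=; rewrite leq_addl.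
- move=> n n0; have /cvg_pinftyP := cvg_si_pinfty n0; apply.
  by rewrite (cvg_shiftn N).
- by apply: measurable_funM => //; exact: measurable_cst.
Qed.

Lemma cvg_hilbert_trunc : hilbert_trunc (rsynth g) x p @[p --> pv_filter] -->
  rsynth (fun n => (0 -i* 1) * g n) x.
Proof.
apply: (@cvg_trans _ ((fun p : R * R => Psi p.2 - Psi p.1) p @[p --> pv_filter])); last first.
  rewrite -[rsynth _ x]subr0; apply: cvgB.
    by apply: (cvg_comp snd Psi); [exact: cvg_snd|exact: cvg_Psi_pinfty].
  by apply: (cvg_comp fst Psi); [exact: cvg_fst|exact: cvg_Psi_right0].
apply: near_eq_cvg.
exists ([set a : R | 0 < a < 1], [set b : R | 1 < b]).
  split => /=; last exact: nbhs_pinfty_gt.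
  by near=> c; apply/andP; split.
move=> [al be] /= [/andP[a0 a1] b1].
by rewrite hilbert_trunc_rsynth// (lt_trans a1).
Unshelve. all: by end_near. Qed.

Lemma has_hilbert_rsynth : has_hilbert (rsynth g) x.
Proof.
have [mg _] := g1; split; last by apply/cvg_ex; eexists; exact: cvg_hilbert_trunc.
move=> p p0.
have ik := integrable_mul_bounded (integrable_reflect x (integrable_band_inv p.2 p0))
  (measurable_rsynth mg) (fun y => norm_rsynth_le y g1).
have mA : measurable (annulus x p).
  have -> : annulus x p = setT `&` (fun y => band p.1 p.2 (x - y)) @^-1` [set 1].
    apply/seteqP; split => y /=; rewrite /annulus/= /band.
      by move=> ->.
    by case: ifP => // _ [_ /eqP]; rewrite eq_sym oner_eq0.
  apply: (measurableT_comp (measurable_band _ _)) => //; exact: measurable_funB.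
have ikA : mu.-integrable (annulus x p) (EFin \o (fun y => band p.1 p.2 (x - y) / (x - y) * rsynth g y)).
  by apply: integrableS ik.
apply: eq_integrable ikA => // y; rewrite inE /annulus/= => h.
by rewrite /band h mul1r mulrC.
Qed.

Lemma hilbert_rsynth : hilbert (rsynth g) x = rsynth (fun n => (0 -i* 1) * g n) x.
Proof. exact: cvg_lim cvg_hilbert_trunc. Qed.

End hilbert_transform.

(** * Majorants *)

(** Two nonnegative majorants are needed, a nonlinear one ([p = 0]) and a
    linear one ([q = 0]); both are supersolutions of an equation of this type. *)
Section convolution_supersolution.
Context {R : realType}.
Local Notation mu := (@lebesgue_measure R).
Variables (a p : R -> R) (q C : R).
Hypothesis ma : measurable_fun setT a.
Hypothesis mp : measurable_fun setT p.
Hypothesis a0 : forall n, 0 <= a n.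
Hypothesis p0 : forall n, 0 <= p n.
Hypothesis q0 : 0 <= q.
Hypothesis C0 : 0 <= C.
Hypothesis budget : (\int[mu]_n (a n)%:E +
  (\int[mu]_n (p n)%:E + q%:E * C%:E) * C%:E <= C%:E)%E.

(** Values in the extended reals keep the iteration total: finiteness is only
    known almost everywhere, in the limit. *)
Let kern (h : R -> \bar R) n m := (((p m)%:E + q%:E * h m) * h (n - m)%R)%E.

Let step (h : R -> \bar R) n := ((a n)%:E + \int[mu]_m kern h n m)%E.

Fixpoint conv_iter k := if k is k'.+1 then step (conv_iter k') else (fun=> 0%E).

Let kern_ge0 h n m : (forall n, 0 <= h n)%E -> (0 <= kern h n m)%E.
Proof. by move=> h0; rewrite mule_ge0// adde_ge0// ?lee_fin// mule_ge0. Qed.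

Let measurable_kern h : measurable_fun setT h ->
  measurable_fun setT (fun z : R * R => kern h z.1 z.2).
Proof.
move=> mh; apply: emeasurable_funM.
  apply: emeasurable_funD.
    by apply/measurable_EFinP; exact: (measurableT_comp mp measurable_snd).
  by apply: measurable_funeM; exact: (measurableT_comp mh measurable_snd).
exact: (measurableT_comp mh measurable_sub2).
Qed.

Lemma conv_iter_ge0 k n : (0 <= conv_iter k n)%E.
Proof.
elim: k n => [//|k IH] n /=; rewrite adde_ge0 ?lee_fin//.
by apply: integral_ge0 => m _; exact: kern_ge0.
Qed.

Lemma measurable_conv_iter k : measurable_fun setT (conv_iter k).
Proof.
elim: k => [|k IH] /=; first exact: measurable_cst.
apply: emeasurable_funD; first exact/measurable_EFinP.
apply: (leb_measurable_F (measurable_kern IH)) => z.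
exact: kern_ge0 (conv_iter_ge0 k).
Qed.

Let measurable_kern1 h n : measurable_fun setT h -> measurable_fun setT (kern h n).
Proof. by move=> mh; exact: (measurableT_comp (measurable_kern mh) (pair1_measurable n)). Qed.

Let kern_le h h' n m : (forall n, 0 <= h n)%E -> (forall n, h n <= h' n)%E ->
  (kern h n m <= kern h' n m)%E.
Proof.
move=> h0 hh'; apply: lee_pmul => //; first by rewrite adde_ge0// ?lee_fin// mule_ge0.
by apply: leeD => //; apply: lee_wpmul2l.
Qed.

Lemma conv_iterS k n : (conv_iter k n <= conv_iter k.+1 n)%E.
Proof.
elim: k n => [|k IH] n; first exact: conv_iter_ge0.
rewrite /= leeD2l//; apply: ge0_le_integral => //.
- by move=> m _; apply: kern_ge0; exact: conv_iter_ge0.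
- by apply: measurable_kern1; exact: measurable_conv_iter.
- by apply: measurable_kern1; exact: (measurable_conv_iter k.+1).
- by move=> m _; apply: kern_le; [exact: conv_iter_ge0|exact: IH].
Qed.

Let nd_iter n : nondecreasing_seq (conv_iter ^~ n).
Proof. by apply/nondecreasing_seqP => k; exact: conv_iterS. Qed.

(** The mass of a convolution is the product of the masses, so the masses of
    the iterates follow a scalar iteration, bounded by the budget. *)
Lemma integral_step h : measurable_fun setT h -> (forall n, 0 <= h n)%E ->
  (\int[mu]_n step h n = \int[mu]_n (a n)%:E +
   (\int[mu]_n (p n)%:E + q%:E * \int[mu]_n h n) * \int[mu]_n h n)%E.
Proof.
move=> mh h0; have mk := measurable_kern mh.
rewrite ge0_integralD//; last 4 first.
- by move=> n _; rewrite lee_fin.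
- exact/measurable_EFinP.
- by move=> n _; apply: integral_ge0 => m _; exact: kern_ge0.
- by apply: (leb_measurable_F mk) => z; exact: kern_ge0.
congr (_ + _)%E.
have -> := @leb_tonelli _ (fun z => kern h z.1 z.2) mk (fun z => kern_ge0 _ _ h0).
have mp' : measurable_fun setT (EFin \o p) by exact/measurable_EFinP.
under eq_integral => m _.
  rewrite /= /kern ge0_integralZl//; last 2 first.
  - by apply: (measurableT_comp mh); exact: measurable_funB.
  - by rewrite adde_ge0// ?lee_fin// mule_ge0.
  rewrite (@ge0_integral_shift _ h (- m))//.
  over.
rewrite ge0_integralZr//; last 3 first.
- by apply: emeasurable_funD => //; exact: measurable_funeM.
- by move=> m _; rewrite adde_ge0// ?lee_fin// mule_ge0.
- exact: integral_ge0.
congr (_ * _)%E; rewrite ge0_integralD//.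
- by rewrite ge0_integralZl.
- by move=> m _; rewrite lee_fin.
- by move=> m _; rewrite mule_ge0.
- exact: measurable_funeM.
Qed.

Lemma integral_conv_iter_le k : (\int[mu]_n conv_iter k n <= C%:E)%E.
Proof.
elim: k => [|k IH]; first by rewrite integral0 lee_fin.
have h0 := conv_iter_ge0 k; have mh := measurable_conv_iter k.
rewrite [X in (X <= _)%E](integral_step mh h0); apply: le_trans budget; rewrite leeD2l//.
have i0 : (0 <= \int[mu]_n conv_iter k n)%E by exact: integral_ge0.
have ip0 : (0 <= \int[mu]_n (p n)%:E)%E by apply: integral_ge0 => m _; rewrite lee_fin.
apply: lee_pmul => //; first by rewrite adde_ge0// mule_ge0// lee_fin.
by rewrite leeD2l// lee_wpmul2l// lee_fin.
Qed.

(** The indeterminate product of 0 and infinity causes no harm: for sequences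
    below their limits, a zero limit forces zero terms. *)
Lemma cvge_mul_nd (x y : (\bar R)^nat) (X Y : \bar R) :
  (forall k, 0 <= x k)%E -> (forall k, 0 <= y k)%E ->
  (forall k, x k <= X)%E -> (forall k, y k <= Y)%E ->
  x k @[k --> \oo] --> X -> y k @[k --> \oo] --> Y ->
  (x k * y k)%E @[k --> \oo] --> (X * Y)%E.
Proof.
move=> x0 y0 xX yY cx cy.
have [X0|X0] := eqVneq X 0%E.
  have -> : (fun k => x k * y k)%E = fun=> 0%E.
    apply/funext => k; have -> : x k = 0%E; last by rewrite mul0e.
    by apply/eqP; rewrite eq_le x0 andbT -X0 xX.
  by rewrite X0 mul0e; exact: cvg_cst.
have [Y0|Y0] := eqVneq Y 0%E.
  have -> : (fun k => x k * y k)%E = fun=> 0%E.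
    apply/funext => k; have -> : y k = 0%E; last by rewrite mule0.
    by apply/eqP; rewrite eq_le y0 andbT -Y0 yY.
  by rewrite Y0 mule0; exact: cvg_cst.
apply: cvgeM => //; move: X0 Y0.
by case: (X) => [r||]; case: (Y) => [t||].
Qed.

(** The iterates started at 0 increase, and their masses stay below [C]; the
    limit is a supersolution by monotone convergence. *)
Lemma convolution_supersolution : exists H : R -> \bar R,
  [/\ measurable_fun setT H, (forall n, 0 <= H n)%E, (\int[mu]_n H n <= C%:E)%E &
  forall n, ((a n)%:E + \int[mu]_m (((p m)%:E + q%:E * H m) * H (n - m)%R) <= H n)%E].
Proof.
pose H n := limn (conv_iter ^~ n).
have cH n : conv_iter k n @[k --> \oo] --> H n.
  exact: ereal_nondecreasing_is_cvgn (@nd_iter n).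
have leH k n : (conv_iter k n <= H n)%E.
  rewrite /H; have /cvg_lim -> // := ereal_nondecreasing_cvgn (@nd_iter n).
  by apply: ereal_sup_ubound; exists k.
have H0 n : (0 <= H n)%E by rewrite (le_trans _ (leH 0%N n)).
exists H; split => //.
- by apply: (@emeasurable_fun_cvg _ _ _ setT conv_iter) => [k|n _]; [exact: measurable_conv_iter|exact: cH].
- have cI := @cvg_monotone_convergence _ _ _ mu setT measurableT conv_iter
    measurable_conv_iter (fun k n _ => conv_iter_ge0 k n) (fun n _ => nd_iter n).
  by apply: (cvge_to_le cI); apply: nearW => k; exact: integral_conv_iter_le.
move=> n.
have ck m : kern (conv_iter k) n m @[k --> \oo] --> kern H n m.
  apply: cvge_mul_nd; [| | | | |exact: cH].
  - by move=> k; rewrite adde_ge0 ?lee_fin// mule_ge0// conv_iter_ge0.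
  - by move=> k; exact: conv_iter_ge0.
  - by move=> k; rewrite leeD2l// lee_wpmul2l// lee_fin.
  - by [].
  - apply: cvgeD => //; [exact: cvg_cst|].
    by apply: cvgeZl.
have -> : (\int[mu]_m (((p m)%:E + q%:E * H m) * H (n - m)%R) =
    \int[mu]_m limn (fun k => kern (conv_iter k) n m))%E.
  by apply: eq_integral => m _; apply/esym/cvg_lim => //; exact: ck.
have cI := @cvg_monotone_convergence _ _ _ mu setT measurableT
  (fun k => kern (conv_iter k) n) (fun k => measurable_kern1 n (measurable_conv_iter k))
  (fun k m _ => kern_ge0 n m (conv_iter_ge0 k)).
have {}cI : (\int[mu]_m kern (conv_iter k) n m)%E @[k --> \oo] -->
    (\int[mu]_m limn (fun k => kern (conv_iter k) n m))%E.
  apply: cI => m _; apply/nondecreasing_seqP => k.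
  by apply: kern_le; [exact: conv_iter_ge0|exact: conv_iterS].
set L := (\int[mu]_m _)%E in cI *.
have cs : conv_iter k.+1 n @[k --> \oo] --> ((a n)%:E + L)%E.
  by apply: cvgeD; [exact: fin_num_adde_defr|exact: cvg_cst|exact: cI].
by apply: (cvge_to_le cs); apply: nearW => k; exact: leH.
Qed.

End convolution_supersolution.

Section majorants.
Context {R : realType}.
Local Notation mu := (@lebesgue_measure R).

Lemma ge0_integrable_le (f : R -> R) (X : R) : measurable_fun setT f ->
  (forall x, 0 <= f x) -> (\int[mu]_x (f x)%:E <= X%:E)%E ->
  mu.-integrable setT (EFin \o f) /\ \int[mu]_x f x <= X.
Proof.
move=> mf f0 fX.
have i : mu.-integrable setT (EFin \o f).
  apply/integrableP; split; first exact/measurable_EFinP.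
  under eq_integral do rewrite /= ger0_norm//.
  by rewrite (le_lt_trans fX)// ltry.
split=> //; rewrite -lee_fin; apply: le_trans fX; rewrite /Rintegral fineK//.
exact: integrable_fin_num.
Qed.

(** Back to finite values: the majorant on a good set [G], and 0 elsewhere. *)
Definition on (G : set R) (h : R -> \bar R) n : R := fine (h n) * \1_G n.

Lemma measurable_on G h : measurable G -> measurable_fun setT h -> measurable_fun setT (on G h).
Proof.
move=> mG mh; apply: measurable_funM; last exact: measurable_indic.
exact: (measurableT_comp (fine_measurable measurableT) mh).
Qed.

Lemma on_out G h n : ~ G n -> on G h n = 0.
Proof. by move=> nG; rewrite /on indicE memNset// mulr0. Qed.

Lemma on_in G h n : G n -> on G h n = fine (h n).
Proof. by move=> nG; rewrite /on indicE mem_set// mulr1. Qed.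

Lemma on_ge0 G h n : (forall n, 0 <= h n)%E -> 0 <= on G h n.
Proof. by move=> h0; rewrite /on mulr_ge0// fine_ge0. Qed.

Lemma on_le G h n : (forall n, 0 <= h n)%E -> ((on G h n)%:E <= h n)%E.
Proof.
move=> h0; have [Gn|Gn] := pselect (G n); last by rewrite on_out.
rewrite on_in//; case: (h n) (h0 n) => [r|_|] //=; by rewrite leey.
Qed.

Lemma measurable_lty (h : R -> \bar R) : measurable_fun setT h ->
  measurable [set n : R | (h n < +oo)%E].
Proof.
move=> mh; have -> : [set n : R | (h n < +oo)%E] = setT `&` h @^-1` [set x | (x < +oo)%E].
  by apply/seteqP; split => n //= [].
apply: mh => //.
rewrite (_ : [set x | _] = ~` [set +oo%E]); last first.
  apply/seteqP; split => y /=; first by move=> h1 h2; rewrite h2 in h1.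
  by move=> h1; rewrite ltey; apply/eqP.
exact: measurableC.
Qed.

Lemma measurable_pos : measurable [set n : R | 0 < n].
Proof.
rewrite (_ : [set _ | _] = `]0, +oo[%classic) //.
by apply/seteqP; split => n /=; rewrite in_itv/= andbT.
Qed.

Variables (u : R -> R) (m lam nu : R).
Hypothesis u0 : forall n, 0 <= u n.
Hypothesis su : sqint mu u.
Hypothesis um : (\int[mu]_n (expR n * u n)%:E <= m%:E)%E.
Hypothesis lam0 : 0 < lam.
Hypothesis mlam : 4 * m <= lam.
Hypothesis nu0 : 0 < nu.

Let m0 : 0 <= m.
Proof.
rewrite -lee_fin (le_trans _ um)// integral_ge0// => n _.
by rewrite lee_fin mulr_ge0// expR_ge0.
Qed.

(** The majorant after one derivative has been absorbed by the weight of
    width [nu], the smallest width up to time [T]. *)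
Definition damp (M : R -> R) n := n * expR (- nu * n) * M n.

Lemma exp_decay_bound n : 0 <= n -> n * expR (- nu * n) <= nu^-1.
Proof.
move=> n0; rewrite mulNr expRN ler_pdivrMr ?expR_gt0//.
rewrite ler_pdivlMl//; have := expR_ge1Dx (nu * n); lra.
Qed.

(** [M] controls the weighted modes and [Z] the growth of their [L^2] norm; [G]
    is the set of positive frequencies where both are finite.  The second
    inequality is linear with a kernel of mass at most [kappa / 2], but it is
    wanted in [L^2]: [Z] is the square root of a supersolution [Y] for the
    squares, by the Cauchy-Schwarz inequality with respect to [damp M]. *)
Lemma wiener_majorants : exists (G : set R) (M Z : R -> R) (kappa : R),
  [/\ [/\ measurable G, forall n, G n -> 0 < n & {ae mu, forall n, 0 < n -> G n}],
     0 < kappa,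
     [/\ measurable_fun setT M, (forall n, 0 <= M n), mu.-integrable setT (EFin \o M),
        \int[mu]_n M n <= 2 * m & forall n, ~ G n -> M n = 0] &
     [/\ sqint mu Z, (forall n, 0 <= Z n),
      (forall n, G n -> mu.-integrable setT (EFin \o (fun k => M k * M (n - k))) /\
        expR n * u n + (2 * lam)^-1 * \int[mu]_k (M k * M (n - k)) <= M n) &
      (forall n, G n -> mu.-integrable setT (EFin \o (fun k => damp M k * Z (n - k))) /\
        u n + kappa^-1 * \int[mu]_k (damp M k * Z (n - k)) <= Z n)]].
Proof.
have [mu_ _] := su.
have ma : measurable_fun setT (fun n => expR n * u n).
  by apply: measurable_funM => //; exact: measurable_expR.
have a0 n : 0 <= expR n * u n by rewrite mulr_ge0// expR_ge0.
have q0 : 0 <= (2 * lam)^-1 by rewrite invr_ge0 mulr_ge0// ltW.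
have C0 : 0 <= 2 * m by rewrite mulr_ge0.
(* this is where [4 * m <= lam] enters *)
have budget : (\int[mu]_n (expR n * u n)%:E +
    (\int[mu]_n (0 : R)%:E + ((2 * lam)^-1)%:E * (2 * m)%:E) * (2 * m)%:E <= (2 * m)%:E)%E.
  rewrite integral0 add0e -!EFinM; apply: (le_trans (leeD2r _ um)).
  rewrite -EFinD lee_fin.
  have : (2 * lam)^-1 * (2 * m) <= 4^-1.
    have l2 : 0 < 2 * lam by rewrite mulr_gt0.
    rewrite (ler_pdivrMl _ _ l2) ler_pdivlMr//.
    have -> : 2 * m * 4 = 2 * (4 * m) by ring.
    by rewrite ler_pM2l.
  by nra.
have [H [mH H0 HC Hs]] := convolution_supersolution ma (measurable_cst (0 : R)) a0 (fun=> lexx 0) q0 C0 budget.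
pose G1 := [set n : R | 0 < n] `&` [set n | (H n < +oo)%E].
have mG1 : measurable G1 by apply: measurableI; [exact: measurable_pos|exact: measurable_lty].
pose M1 := on G1 H.
have mM1 : measurable_fun setT M1 by exact: measurable_on.
have M10 n : 0 <= M1 n by exact: on_ge0.
have [iM1 M1C] : mu.-integrable setT (EFin \o M1) /\ \int[mu]_n M1 n <= 2 * m.
  apply: ge0_integrable_le => //; apply: le_trans HC; apply: ge0_le_integral => //.
  - by move=> n _; rewrite lee_fin.
  - exact/measurable_EFinP.
  - by move=> n _; exact: on_le.
have Q10 n : 0 <= damp M1 n.
  have [Gn|Gn] := pselect (G1 n); last by rewrite /damp /M1 on_out// mulr0.
  by rewrite /damp mulr_ge0// mulr_ge0 ?expR_ge0// ltW//; case: Gn.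
have mdamp M : measurable_fun setT M -> measurable_fun setT (damp M).
  move=> mM; apply: measurable_funM => //; apply: measurable_funM => //.
  by apply: measurableT_comp => //; apply: measurable_funM.
have iQ1 : mu.-integrable setT (EFin \o damp M1).
  apply: (integrable_dominated measurableT _ (intZl nu^-1 measurableT iM1)); first exact: mdamp.
  move=> n _ /=; rewrite ger0_norm//; have [Gn|Gn] := pselect (G1 n); last first.
    by rewrite /damp /M1 on_out// !mulr0.
  by rewrite /damp ler_wpM2r// exp_decay_bound// ltW//; case: Gn.
set K := \int[mu]_n damp M1 n.
have K0 : 0 <= K by apply: Rintegral_ge0.
(* the linear kernel [kappa^-1 * damp M1] gets a mass at most one half *)
pose kappa := 2 * K + 1.
have k0 : 0 < kappa by rewrite ltr_wpDl// mulr_ge0.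
pose U := \int[mu]_n (u n ^+ 2).
have U0 : 0 <= U by exact: sqint_sq_ge0.
have mp : measurable_fun setT (fun n => kappa^-1 * damp M1 n).
  by apply: measurable_funM => //; exact: mdamp.
have p0 n : 0 <= kappa^-1 * damp M1 n by rewrite mulr_ge0// invr_ge0 ltW.
have ma2 : measurable_fun setT (fun n => 2 * u n ^+ 2).
  by apply: measurable_funM => //; exact: measurable_funX.
have a20 n : 0 <= 2 * u n ^+ 2 by rewrite mulr_ge0// sqr_ge0.
have CU0 : 0 <= 4 * U by rewrite mulr_ge0.
have budget2 : (\int[mu]_n (2 * u n ^+ 2)%:E +
    (\int[mu]_n (kappa^-1 * damp M1 n)%:E + (0 : R)%:E * (4 * U)%:E) * (4 * U)%:E <= (4 * U)%:E)%E.
  have [_ iu2] := su.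
  have -> : (\int[mu]_n (2 * u n ^+ 2)%:E = (2 * U)%:E)%E.
    rewrite -RintegralZl// /Rintegral fineK//; apply: integrable_fin_num => //.
    exact: intZl.
  have -> : (\int[mu]_n (kappa^-1 * damp M1 n)%:E = (kappa^-1 * K)%:E)%E.
    rewrite -RintegralZl// /Rintegral fineK//; apply: integrable_fin_num => //.
    exact: intZl.
  rewrite mul0e adde0 -EFinM -EFinD lee_fin.
  have : kappa^-1 * K <= 2^-1 by rewrite ler_pdivrMl// /kappa; lra.
  by nra.
have [Y [mY Y0 YC Ys]] := convolution_supersolution ma2 mp a20 p0 (lexx 0) CU0 budget2.
(* both majorants are restricted to the same set; shrinking [M1] to [M] only
   decreases the convolutions *)
pose G := G1 `&` [set n | (Y n < +oo)%E].
have mG : measurable G by apply: measurableI => //; exact: measurable_lty.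
pose M := on G H.
pose Z n := Num.sqrt (on G Y n).
have mM : measurable_fun setT M by exact: measurable_on.
have M0 n : 0 <= M n by exact: on_ge0.
have MM1 n : M n <= M1 n.
  have [Gn|Gn] := pselect (G n); last by rewrite /M on_out.
  by rewrite /M /M1 !on_in//; case: Gn.
have iM : mu.-integrable setT (EFin \o M).
  by apply: (integrable_dominated measurableT _ iM1) => // n _; rewrite ger0_norm.
have oY0 n : 0 <= on G Y n by exact: on_ge0.
have moY : measurable_fun setT (on G Y) by exact: measurable_on.
have mZ : measurable_fun setT Z.
  apply: (measurableT_comp _ moY); exact: continuous_measurable_fun (@sqrt_continuous R).
have Z0 n : 0 <= Z n by exact: sqrtr_ge0.
have Z2 n : Z n ^+ 2 = on G Y n by rewrite sqr_sqrtr.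
have [ioY _] : mu.-integrable setT (EFin \o on G Y) /\ \int[mu]_n on G Y n <= 4 * U.
  apply: ge0_integrable_le => //; apply: le_trans YC; apply: ge0_le_integral => //.
  - by move=> n _; rewrite lee_fin.
  - exact/measurable_EFinP.
  - by move=> n _; exact: on_le.
have sZ : sqint mu Z.
  by split => //; under [X in integrable _ _ X]eq_fun do rewrite Z2.
have QQ1 n : 0 <= damp M n <= damp M1 n.
  have [Gn|Gn] := pselect (G n); last by rewrite {1 2}/damp /M on_out// !mulr0 lexx Q10.
  have n0 : 0 <= n by apply: ltW; case: Gn => -[].
  have e0 := expR_ge0 (- nu * n).
  have b0 : 0 <= n * expR (- nu * n) by rewrite mulr_ge0.
  by apply/andP; split; [exact: mulr_ge0|exact: ler_wpM2l].
exists G, M, Z, kappa; split => //.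
- split => //; first by move=> n [[]].
  have hae (h : R -> \bar R) (C : R) : measurable_fun setT h -> (forall n, 0 <= h n)%E ->
      (\int[mu]_n h n <= C%:E)%E -> {ae mu, forall n, (h n < +oo)%E}.
    move=> mh h0 hC; have ih : mu.-integrable setT h.
      apply/integrableP; split => //.
      by under eq_integral do rewrite gee0_abs//; rewrite (le_lt_trans hC)// ltry.
    have /leb_aeS := integrable_ae measurableT ih; apply => n /(_ Logic.I).
    by rewrite ge0_fin_numE.
  apply: (leb_aeS (leb_aeI (hae _ _ mH H0 HC) (hae _ _ mY Y0 YC))) => n [Hn Yn] n0.
  by split.
- split => //; last by move=> n Gn; rewrite /M on_out.
  by apply: le_trans M1C; apply: le_Rintegral.
split => //.
- move=> n [[n0 Hn] Yn]; have Gn : G n by [].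
  have mMM : measurable_fun setT (fun k => M k * M (n - k)).
    by apply: measurable_funM => //; apply: measurableT_comp => //; exact: measurable_funB.
  have qMM0 k : 0 <= (2 * lam)^-1 * (M k * M (n - k)).
    by apply: mulr_ge0 => //; exact: mulr_ge0.
  have mq : measurable_fun setT (fun k => (2 * lam)^-1 * (M k * M (n - k))).
    by apply: measurable_funM => //; exact: measurable_cst.
  have [i1 l1] : mu.-integrable setT (EFin \o (fun k => (2 * lam)^-1 * (M k * M (n - k)))) /\
      \int[mu]_k ((2 * lam)^-1 * (M k * M (n - k))) <= fine (H n) - expR n * u n.
    apply: ge0_integrable_le => //.
    rewrite EFinB leeBrDl// fineK ?ge0_fin_numE//; apply: le_trans (Hs n).
    rewrite leeD2l//; apply: ge0_le_integral => //.
    + by move=> k _; rewrite lee_fin.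
    + exact: ((measurable_EFinP _ _).2 mq).
    + apply: emeasurable_funM; last by apply: (measurableT_comp mH); exact: measurable_funB.
      by apply: emeasurable_funD; [exact: ((measurable_EFinP _ _).2 (measurable_cst (0 : R)))|exact: measurable_funeM].
    move=> k _; rewrite add0e.
    have -> : ((2 * lam)^-1 * (M k * M (n - k)))%:E =
        (((2 * lam)^-1)%:E * (M k)%:E * (M (n - k))%:E)%E by rewrite mulrA -!EFinM.
    apply: lee_pmul => //.
    * by rewrite -EFinM lee_fin mulr_ge0.
    * by rewrite lee_fin.
    * by rewrite lee_wpmul2l ?lee_fin//; exact: on_le.
    * exact: on_le.
  have i2 : mu.-integrable setT (EFin \o (fun k => M k * M (n - k))).
    have := intZl (2 * lam) measurableT i1; apply: eq_integrable => // k _ /=.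
    by rewrite mulrA divff ?mul1r// mulf_neq0// gt_eqF.
  split => //; rewrite RintegralZl// in l1.
  by rewrite addrC -lerBrDr /M on_in.
- move=> n [[n0 Hn] Yn]; have Gn : G n by [].
  pose f k := damp M k * Z (n - k) ^+ 2.
  have mdM := mdamp _ mM.
  have mZn : measurable_fun setT (fun k : R => Z (n - k)).
    by apply: measurableT_comp => //; exact: measurable_funB.
  have dM0 k : 0 <= damp M k by case/andP: (QQ1 k).
  have f0 k : 0 <= f k by rewrite mulr_ge0// sqr_ge0.
  have mf : measurable_fun setT f by apply: measurable_funM => //; exact: measurable_funX.
  have mq : measurable_fun setT (fun k => kappa^-1 * f k).
    by apply: measurable_funM => //; exact: measurable_cst.
  have [i1 l1] : mu.-integrable setT (EFin \o (fun k => kappa^-1 * f k)) /\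
      \int[mu]_k (kappa^-1 * f k) <= fine (Y n) - 2 * u n ^+ 2.
    apply: ge0_integrable_le => //.
      by move=> k; rewrite mulr_ge0// invr_ge0 ltW.
    rewrite EFinB leeBrDl// fineK ?ge0_fin_numE//; apply: le_trans (Ys n).
    rewrite leeD2l//; apply: ge0_le_integral => //.
    + by move=> k _; rewrite lee_fin mulr_ge0// invr_ge0 ltW.
    + exact: ((measurable_EFinP _ _).2 mq).
    + apply: emeasurable_funM; last by apply: (measurableT_comp mY); exact: measurable_funB.
      by apply: emeasurable_funD => //; [exact/measurable_EFinP|exact: measurable_funeM].
    move=> k _; rewrite mul0e adde0 /f mulrA EFinM Z2; apply: lee_pmul => //.
    * by rewrite lee_fin mulr_ge0// invr_ge0 ltW.
    * by rewrite lee_fin.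
    * by rewrite lee_fin ler_wpM2l ?invr_ge0 ?(ltW k0)//; case/andP: (QQ1 k).
    * exact: on_le.
  have i2 : mu.-integrable setT (EFin \o f).
    have := intZl kappa measurableT i1; apply: eq_integrable => // k _ /=.
    by rewrite mulrA divff ?mul1r// gt_eqF.
  have idM : mu.-integrable setT (EFin \o damp M).
    apply: (integrable_dominated measurableT _ iQ1) => // k _.
    by rewrite ger0_norm//; case/andP: (QQ1 k).
  have i3 : mu.-integrable setT (EFin \o (fun k => damp M k * Z (n - k))).
    apply: (integrable_dominated measurableT _ (intD measurableT idM i2)).
      exact: measurable_funM.
    move=> k _; rewrite /f; move: (dM0 k) (Z0 (n - k)).
    move: (damp M k) (Z (n - k)) => x y x0 y0.
    by rewrite ger0_norm; [have := sqr_ge0 (y - 1); nra|exact: mulr_ge0].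
  split => //.
  set S := \int[mu]_k (damp M k * Z (n - k)).
  have S0 : 0 <= S by apply: Rintegral_ge0 => k _; rewrite mulr_ge0.
  have F0 : 0 <= \int[mu]_k f k by apply: Rintegral_ge0.
  have S2 : S ^+ 2 <= K * \int[mu]_k f k.
    apply: sqr_le_of_young => // c c0.
    rewrite -!RintegralZl// -RintegralD//; [|exact: intZl|exact: intZl].
    apply: le_Rintegral => //.
    + exact: intZl.
    + by apply: intD => //; exact: intZl.
    move=> k _ /=; have /andP[d0 d1] := QQ1 k.
    have cd : c * damp M k <= c * damp M1 k by rewrite ler_pM2l.
    apply: le_trans (lerD cd (lexx _)); rewrite /f.
    have -> : c * damp M k + c^-1 * (damp M k * Z (n - k) ^+ 2) =
      2 * (damp M k * Z (n - k)) + c^-1 * damp M k * (Z (n - k) - c) ^+ 2.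
      by field; rewrite gt_eqF.
    by rewrite lerDl mulr_ge0 ?sqr_ge0// mulr_ge0// invr_ge0 ltW.
  rewrite RintegralZl// in l1.
  rewrite -(@ler_sqr R) ?nnegrE ?addr_ge0 ?mulr_ge0 ?invr_ge0 ?(ltW k0)//.
  rewrite Z2 on_in//.
  apply: (@le_trans _ _ (2 * u n ^+ 2 + kappa^-1 * \int[mu]_k f k)); last by lra.
  apply: (@le_trans _ _ (2 * u n ^+ 2 + 2 * (kappa^-1 * S) ^+ 2)).
    by have := sqr_ge0 (u n - kappa^-1 * S); nra.
  rewrite lerD2l exprMn.
  apply: (@le_trans _ _ (2 * (kappa^-1 ^+ 2 * (K * \int[mu]_k f k)))).
    by rewrite ler_pM2l// ler_pM2l// exprn_gt0// invr_gt0.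
  have -> : 2 * (kappa^-1 ^+ 2 * (K * \int[mu]_k f k)) =
    (kappa^-1 * \int[mu]_k f k) * (2 * K * kappa^-1) by ring.
  rewrite ler_piMr ?mulr_ge0 ?invr_ge0 ?(ltW k0)//.
  by rewrite ler_pdivrMr// mul1r /kappa lerDl.
Qed.

End majorants.

(** * The Volterra equation for the modes *)

Section time_integrals.
Context {R : realType}.
Local Notation mu := (@lebesgue_measure R).
Local Notation normc := Normc.normc.

Lemma leb_normc_cint_le (D : set R) (f : R -> R[i]) (h : R -> R) : measurable D -> cmeasurable f ->
  mu.-integrable D (EFin \o h) -> (forall x, D x -> normc (f x) <= h x) ->
  normc (cint mu D f) <= \int[mu]_(x in D) h x.
Proof. exact: (@normc_cint_le R _ _ mu D f h). Qed.

Lemma leb_integrable_parts (D : set R) (f : R -> R[i]) (h : R -> R) : measurable D -> cmeasurable f ->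
  mu.-integrable D (EFin \o h) -> (forall x, D x -> normc (f x) <= h x) ->
  mu.-integrable D (EFin \o (fun x => complex.Re (f x))) /\
  mu.-integrable D (EFin \o (fun x => complex.Im (f x))).
Proof.
move=> mD mf ih fh; split.
- exact: (@integrable_Re R _ _ mu D f h).
- exact: (@integrable_Im R _ _ mu D f h).
Qed.

Lemma Rintegral_exp (a t : R) : 0 < a -> 0 <= t ->
  \int[mu]_(s in `[0, t]) expR (a * s) = (expR (a * t) - 1) / a.
Proof.
move=> a0; rewrite le_eqVlt => /predU1P[<-|t0].
  rewrite set_itv1 /Rintegral integral_set1; by rewrite /= mulr0 expR0 subrr mul0r.
pose F s := expR (a * s) / a.
have cf : continuous (fun s : R => expR (a * s)).
  by move=> s; exact: (is_derive_continuous (is_derive_expRM a s)).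
have Fd (s : R) : is_derive s 1 F (expR (a * s)).
  have h := is_derive_expRM a s.
  rewrite /F; apply: is_derive_eq; rewrite /GRing.scale/=; by field; rewrite gt_eqF.
rewrite /Rintegral (@continuous_FTC2 _ _ F)//.
- by rewrite /= /F mulr0 expR0; field; rewrite gt_eqF.
- exact: continuous_subspaceT.
- split.
  + by move=> x _; have [] := Fd x.
  + by apply: cvg_at_right_filter; exact: (is_derive_continuous (Fd 0)).
  + by apply: cvg_at_left_filter; exact: (is_derive_continuous (Fd t)).
- by move=> x _; rewrite derive1E; apply: derive_val.
Qed.

Lemma integrable_cont_itv (f : R -> R) a b : continuous f -> mu.-integrable `[a, b] (EFin \o f).
Proof.
move=> cf; apply: continuous_compact_integrable; first exact: segment_compact.
exact: continuous_subspaceT.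
Qed.

Lemma normc_cint_exp (X : R -> R[i]) C a t : 0 < a -> 0 <= t -> cmeasurable X ->
  (forall s, 0 <= s <= t -> normc (X s) <= C * expR (a * s)) ->
  normc (cint mu `[0, t] X) <= C * ((expR (a * t) - 1) / a).
Proof.
move=> a0 t0 mX hX; rewrite -Rintegral_exp//.
have ie : mu.-integrable `[0, t] (EFin \o (fun s : R => expR (a * s))).
  by apply: integrable_cont_itv => s; exact: (is_derive_continuous (is_derive_expRM a s)).
rewrite -RintegralZl//; apply: leb_normc_cint_le => //; exact: intZl.
Qed.

End time_integrals.

(** Self-convolutions of functions bounded by [W * p], when [W m * W (n - m)]
    is [W n]: the weight factors out.  The difference of two convolutions is
    bounded by the difference of the convolutions of their majorants, which is
    what makes increments telescope. *)
Section multiplicative_weight.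
Context {R : realType}.
Local Notation mu := (@lebesgue_measure R).
Local Notation normc := Normc.normc.
Variables (W M : R -> R) (n : R).
Hypothesis W0 : forall m, 0 <= W m.
Hypothesis WM : forall m, W m * W (n - m) = W n.
Hypothesis M0 : forall m, 0 <= M m.
Hypothesis iM : mu.-integrable setT (EFin \o (fun m => M m * M (n - m))).
Hypothesis mM : measurable_fun setT M.

Lemma measurable_conv1 (p q : R -> R) : measurable_fun setT p -> measurable_fun setT q ->
  measurable_fun setT (fun m => p m * q (n - m)).
Proof.
by move=> mp mq; apply: measurable_funM => //; apply: (measurableT_comp mq); exact: measurable_funB.
Qed.

Lemma integrable_conv1 (p q : R -> R) : measurable_fun setT p -> measurable_fun setT q ->
  (forall m, 0 <= p m <= M m) -> (forall m, 0 <= q m <= M m) ->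
  mu.-integrable setT (EFin \o (fun m => p m * q (n - m))).
Proof.
move=> mp mq pM qM; apply: (integrable_dominated measurableT _ iM); first exact: measurable_conv1.
move=> m _; have /andP[p0 p1] := pM m; have /andP[q0 q1] := qM (n - m).
by rewrite ger0_norm ?mulr_ge0// ler_pM.
Qed.

Lemma cmeasurable_conv1 (P : R -> R[i]) : cmeasurable P -> cmeasurable (fun m => P m * P (n - m)).
Proof.
move=> mP; apply: cmeasurableM => //; apply: (cmeasurable_comp mP).
exact: measurable_funB.
Qed.

Lemma normc_conv_le (P : R -> R[i]) (p : R -> R) : cmeasurable P -> measurable_fun setT p ->
  (forall m, 0 <= p m <= M m) -> (forall m, normc (P m) <= W m * p m) ->
  normc (conv P n) <= W n * \int[mu]_m (p m * p (n - m)).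
Proof.
move=> mP mp pM PW; have ip := integrable_conv1 mp mp pM pM.
rewrite -(RintegralZl _ measurableT ip).
apply: (leb_normc_cint_le measurableT (cmeasurable_conv1 mP) (intZl _ measurableT ip)) => m _.
rewrite Normc.normcM -(WM m) mulrACA.
by apply: ler_pM; rewrite ?normc_ge0.
Qed.

Lemma integrable_conv_parts (P : R -> R[i]) (p : R -> R) : cmeasurable P -> measurable_fun setT p ->
  (forall m, 0 <= p m <= M m) -> (forall m, normc (P m) <= W m * p m) ->
  mu.-integrable setT (EFin \o (fun m => complex.Re (P m * P (n - m)))) /\
  mu.-integrable setT (EFin \o (fun m => complex.Im (P m * P (n - m)))).
Proof.
move=> mP mp pM PW; have ip := integrable_conv1 mp mp pM pM.
have h m : setT m -> normc (P m * P (n - m)) <= W n * (p m * p (n - m)).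
  by move=> _; rewrite Normc.normcM -(WM m) mulrACA; apply: ler_pM; rewrite ?normc_ge0.
exact: (leb_integrable_parts measurableT (cmeasurable_conv1 mP) (intZl _ measurableT ip) h).
Qed.

Lemma cintB (D : set R) (f g : R -> R[i]) : measurable D ->
  mu.-integrable D (EFin \o (fun x => complex.Re (f x))) ->
  mu.-integrable D (EFin \o (fun x => complex.Im (f x))) ->
  mu.-integrable D (EFin \o (fun x => complex.Re (g x))) ->
  mu.-integrable D (EFin \o (fun x => complex.Im (g x))) ->
  cint mu D (fun x => f x - g x) = cint mu D f - cint mu D g.
Proof.
move=> mD f1 f2 g1 g2; apply: cReP; rewrite ?cReB ?cImB /cint/=.
- by rewrite -RintegralB//; apply: eq_Rintegral => x _; rewrite cReB.
- by rewrite -RintegralB//; apply: eq_Rintegral => x _; rewrite cImB.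
Qed.

Lemma normc_convB_le (P Q : R -> R[i]) (p q : R -> R) : cmeasurable P -> cmeasurable Q ->
  measurable_fun setT p -> measurable_fun setT q ->
  (forall m, 0 <= p m <= M m) -> (forall m, p m <= q m <= M m) ->
  (forall m, normc (P m) <= W m * p m) -> (forall m, normc (Q m) <= W m * q m) ->
  (forall m, normc (Q m - P m) <= W m * (q m - p m)) ->
  normc (conv Q n - conv P n) <=
    W n * (\int[mu]_m (q m * q (n - m)) - \int[mu]_m (p m * p (n - m))).
Proof.
move=> mP mQ mp mq pM qM PW QW dW.
have q0M m : 0 <= q m <= M m.
  by have /andP[p0 _] := pM m; have /andP[pq ->] := qM m; rewrite (le_trans p0 pq).
have ip := integrable_conv1 mp mp pM pM; have iq := integrable_conv1 mq mq q0M q0M.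
have [P1 P2] := integrable_conv_parts mP mp pM PW.
have [Q1 Q2] := integrable_conv_parts mQ mq q0M QW.
rewrite /conv -cintB// -RintegralB//.
have id := intB measurableT iq ip.
rewrite -(RintegralZl _ measurableT id).
apply: (leb_normc_cint_le measurableT _ (intZl _ measurableT id)).
  have -> : (fun m => Q m * Q (n - m) - P m * P (n - m)) =
      (fun m => Q m * Q (n - m) + (-1) * (P m * P (n - m))).
    by apply/funext => m; rewrite mulN1r.
  apply: cmeasurableD; first exact: cmeasurable_conv1.
  by apply: cmeasurableM; [exact: cmeasurable_cst|exact: cmeasurable_conv1].
move=> m _ /=.
have -> : Q m * Q (n - m) - P m * P (n - m) =
    (Q m - P m) * Q (n - m) + P m * (Q (n - m) - P (n - m)) by ring.
apply: (le_trans (normcD _ _)); rewrite !Normc.normcM -(WM m).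
have -> : W m * W (n - m) * (q m * q (n - m) - p m * p (n - m)) =
  (W m * (q m - p m)) * (W (n - m) * q (n - m)) +
  (W m * p m) * (W (n - m) * (q (n - m) - p (n - m))) by ring.
by apply: lerD; apply: ler_pM; rewrite ?normc_ge0.
Qed.

End multiplicative_weight.

Section complex_limits.
Context {R : realType}.
Local Notation mu := (@lebesgue_measure R).
Local Notation Re := (@complex.Re R).
Local Notation Im := (@complex.Im R).
Local Notation normc := Normc.normc.
Implicit Types u v : nat -> R[i].

Definition ccvg u (l : R[i]) := Re (u k) @[k --> \oo] --> Re l /\ Im (u k) @[k --> \oo] --> Im l.

Lemma ccvg_cst z : ccvg (fun=> z) z.
Proof. by split; exact: cvg_cst. Qed.

Lemma ccvgM u v a b : ccvg u a -> ccvg v b -> ccvg (fun k => u k * v k) (a * b).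
Proof.
move=> [u1 u2] [v1 v2]; split.
- rewrite cReM; under eq_fun do rewrite cReM.
  by apply: cvgB; exact: cvgM.
- rewrite cImM; under eq_fun do rewrite cImM.
  by apply: cvgD; exact: cvgM.
Qed.

Lemma ccvgD u v a b : ccvg u a -> ccvg v b -> ccvg (fun k => u k + v k) (a + b).
Proof.
move=> [u1 u2] [v1 v2]; split.
- by rewrite cReD; under eq_fun do rewrite cReD; exact: cvgD.
- by rewrite cImD; under eq_fun do rewrite cImD; exact: cvgD.
Qed.

Lemma ccvg_unique u a b : ccvg u a -> ccvg u b -> a = b.
Proof.
move=> [u1 u2] [v1 v2]; apply: cReP.
- exact: (@cvg_unique _ (@Rhausdorff R) _ _ _ _ u1 v1).
- exact: (@cvg_unique _ (@Rhausdorff R) _ _ _ _ u2 v2).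
Qed.

Lemma ccvg_normc_le u l C : ccvg u l -> (forall k, normc (u k) <= C) -> normc l <= C.
Proof.
move=> [u1 u2] uC; have C0 : 0 <= C by rewrite (le_trans (normc_ge0 _) (uC 0%N)).
rewrite -(@ler_sqr R) ?nnegrE ?normc_ge0// sqr_normcE.
have h : Re (u k) ^+ 2 + Im (u k) ^+ 2 @[k --> \oo] --> Re l ^+ 2 + Im l ^+ 2.
  by rewrite !expr2; under eq_fun do rewrite !expr2; apply: cvgD; exact: cvgM.
apply: (cvgr_to_le h); apply: nearW => k; rewrite -sqr_normcE.
by rewrite ler_sqr ?nnegrE ?normc_ge0.
Qed.

Lemma cint_ccvg (D : set R) (f : nat -> R -> R[i]) (F : R -> R[i]) (h : R -> R) :
  measurable D -> (forall k, cmeasurable (f k)) -> cmeasurable F ->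
  (forall x, D x -> ccvg (f ^~ x) (F x)) ->
  mu.-integrable D (EFin \o h) -> (forall k x, D x -> normc (f k x) <= h x) ->
  ccvg (fun k => cint mu D (f k)) (cint mu D F).
Proof.
move=> mD mf mF fF ih fh; split => /=.
- apply: (@cvg_Rintegral_dominated _ _ _ mu D (fun k x => Re (f k x)) (fun x => Re (F x)) h) => //.
  + by move=> k; have [m1 _] := mf k; exact: measurable_funTS.
  + by have [m1 _] := mF; exact: measurable_funTS.
  + by apply: nearW => x Dx; have [] := fF x Dx.
  + by move=> k x Dx; rewrite (le_trans (norm_Re_le _))// fh.
- apply: (@cvg_Rintegral_dominated _ _ _ mu D (fun k x => Im (f k x)) (fun x => Im (F x)) h) => //.
  + by move=> k; have [_ m1] := mf k; exact: measurable_funTS.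
  + by have [_ m1] := mF; exact: measurable_funTS.
  + by apply: nearW => x Dx; have [] := fF x Dx.
  + by move=> k x Dx; rewrite (le_trans (norm_Im_le _))// fh.
Qed.

(** The series of the increments converges absolutely, by comparison with a
    telescoping one. *)
Lemma cvg_of_dominated_increments (x r : nat -> R) (B : R) :
  (forall k, `|x k.+1 - x k| <= r k.+1 - r k) -> (forall k, `|x k| <= r k) ->
  (forall k, r k <= B) -> cvgn x.
Proof.
move=> dx xr rB.
have cr : cvgn r.
  apply: nondecreasing_is_cvgn; last by exists B => _ [k _ <-].
  apply/nondecreasing_seqP => k; rewrite -subr_ge0; exact: le_trans (dx k).
have cy : cvgn (fun k => x k + r k).
  apply: nondecreasing_is_cvgn; last first.
    exists (B + B) => _ [k _ <-]; apply: lerD => //.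
    by rewrite (le_trans (ler_norm _))// (le_trans (xr k)).
  by apply/nondecreasing_seqP => k; have := dx k; rewrite ler_norml => /andP[]; lra.
have -> : x = (fun k => (x k + r k) - r k) by apply/funext => k; rewrite addrK.
exact: is_cvgB.
Qed.

End complex_limits.

Lemma normc_0 {R : realType} : Normc.normc (0 : R[i]) = 0.
Proof. exact: Normc.normc0. Qed.

(** The equation for [V] in integrated form, with [om] the dispersion relation
    and the two majorants of the initial modes. *)
Section volterra.
Local Open Scope complex_scope.
Context {R : realType}.
Local Notation mu := (@lebesgue_measure R).
Local Notation normc := Normc.normc.
Variables (A T lam kappa : R) (om : R -> R) (g0 : R -> R[i]) (G : set R) (M Z : R -> R).
Let nu := 1 - lam * T.
Hypothesis A1 : `|A| <= 1.
Hypothesis T0 : 0 < T.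
Hypothesis lamT : lam * T <= 1.
Hypothesis lam0 : 0 < lam.
Hypothesis kappa0 : 0 < kappa.
Hypothesis mom : measurable_fun setT om.
Hypothesis mg0 : cmeasurable g0.
Hypothesis mG : measurable G.
Hypothesis Gpos : forall n, G n -> 0 < n.
Hypothesis mM : measurable_fun setT M.
Hypothesis M0 : forall n, 0 <= M n.
Hypothesis Mout : forall n, ~ G n -> M n = 0.
Hypothesis sZ : sqint mu Z.
Hypothesis Z0 : forall n, 0 <= Z n.
Hypothesis MM : forall n, G n -> mu.-integrable setT (EFin \o (fun k => M k * M (n - k))) /\
  expR n * normc (g0 n) + (2 * lam)^-1 * \int[mu]_k (M k * M (n - k)) <= M n.
Hypothesis MZ : forall n, G n -> mu.-integrable setT (EFin \o (fun k => damp nu M k * Z (n - k))) /\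
  normc (g0 n) + kappa^-1 * \int[mu]_k (damp nu M k * Z (n - k)) <= Z n.

(** The weight whose width shrinks at the rate [lam]. *)
Definition wt t n : R := expR (- (1 - lam * t) * n).

Lemma wt_ge0 t n : 0 <= wt t n. Proof. exact: expR_ge0. Qed.

Lemma wtM t n m : wt t m * wt t (n - m) = wt t n.
Proof. by rewrite /wt -expRD; congr expR; ring. Qed.

Lemma wtE t n : wt t n = expR (- n) * expR (lam * n * t).
Proof. by rewrite /wt -expRD; congr expR; ring. Qed.

Lemma wt_le t n : 0 <= t <= T -> 0 <= n -> wt t n <= expR (- nu * n).
Proof.
move=> /andP[t0 tT] n0; rewrite /wt ler_expR ler_wpM2r//.
by rewrite lerN2 /nu lerD2l lerN2 ler_pM2l.
Qed.

Definition rot t n : R[i] := cis (om n * t).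

(** [V] are the modes in the frame rotating with the linear dispersion; [osc V]
    are the actual modes, and [src V] is the nonlinearity in that frame. *)
Definition osc (V : R -> R -> R[i]) s n := rot s n * V s n.

Definition src (V : R -> R -> R[i]) n s :=
  cis (- (om n * s)) * ((A * n / 2) +i* 0) * conv (osc V s) n.

Definition duhamel (V : R -> R -> R[i]) t n : R[i] :=
  (\1_G n +i* 0) * (g0 n + cint mu `[0, t] (src V n)).

(** Joint measurability in time and frequency, so that the time integral of the
    source is again measurable in the frequency. *)
Definition jmeas (V : R -> R -> R[i]) := cmeasurable (fun p : R * R => V p.1 p.2).

Lemma jmeas_osc V : jmeas V -> jmeas (osc V).
Proof.
move=> mV; apply: cmeasurableM => //; apply: cmeasurable_cis.
apply: measurable_funM => //; exact: (measurableT_comp mom measurable_snd).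
Qed.

Lemma cmeasurable_param (Phi : (R * R) * R -> R[i]) : cmeasurable Phi ->
  cmeasurable (fun p : R * R => cint mu setT (fun y => Phi (p, y))).
Proof.
move=> [m1 m2]; split.
- exact: (@measurable_Rintegral_param _ _ _ _ R mu (fun z => complex.Re (Phi z)) m1).
- exact: (@measurable_Rintegral_param _ _ _ _ R mu (fun z => complex.Im (Phi z)) m2).
Qed.

Lemma jmeas_src V : jmeas V -> cmeasurable (fun p : R * R => src V p.2 p.1).
Proof.
move=> /jmeas_osc mU; apply: cmeasurableM.
  apply: cmeasurableM.
    apply: cmeasurable_cis; apply: measurableT_comp => //; apply: measurable_funM => //.
    exact: (measurableT_comp mom measurable_snd).
  apply: cmeasurable_real; apply: measurable_funM => //; exact: measurable_funM.
apply: (@cmeasurable_param (fun z => osc V z.1.1 z.2 * osc V z.1.1 (z.1.2 - z.2))).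
have m11 : measurable_fun setT (fun z : (R * R) * R => z.1.1).
  exact: (measurableT_comp measurable_fst measurable_fst).
apply: cmeasurableM.
  apply: (@cmeasurable_comp _ _ _ _ _ (fun p : R * R => osc V p.1 p.2)
    (fun z : (R * R) * R => (z.1.1, z.2)) mU).
  exact: measurable_fun_pair.
apply: (@cmeasurable_comp _ _ _ _ _ (fun p : R * R => osc V p.1 p.2)
  (fun z : (R * R) * R => (z.1.1, z.1.2 - z.2)) mU).
apply: measurable_fun_pair => //; apply: measurable_funB => //.
exact: (measurableT_comp measurable_snd measurable_fst).
Qed.

Lemma jmeas_duhamel V : jmeas V -> jmeas (duhamel V).
Proof.
move=> mV; apply: cmeasurableM.
  apply: cmeasurable_real; exact: (measurableT_comp (measurable_indic mG) measurable_snd).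
apply: cmeasurableD; first exact: (cmeasurable_comp mg0 measurable_snd).
pose ind (t s : R) : R := if (0 <= s) && (s <= t) then 1 else 0.
pose Phi (z : (R * R) * R) := (ind z.1.1 z.2 +i* 0) * src V z.1.2 z.2.
have e : (fun p : R * R => cint mu `[0, p.1] (src V p.2)) =
    (fun p : R * R => cint mu setT (fun s => Phi (p, s))).
  have indE (t s : R) : ind t s = \1_(`[0, t]%classic : set R) s.
    rewrite /ind indicE; case: ifPn => h; first by rewrite mem_set//= in_itv.
    by rewrite memNset//= in_itv/=; exact/negP.
  apply/funext => -[t n]; apply: cReP; rewrite /cint [LHS]Rintegral_mkcond;
    apply: eq_Rintegral => s _; rewrite patchE /Phi indE indicE.
  - by rewrite cReM mul0r subr0; case: (_ \in _); rewrite ?mul1r ?mul0r.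
  - by rewrite cImM mul0r addr0; case: (_ \in _); rewrite ?mul1r ?mul0r.
rewrite e; apply: (@cmeasurable_param Phi); apply: cmeasurableM; last first.
  apply: (@cmeasurable_comp _ _ _ _ _ (fun p : R * R => src V p.2 p.1)
    (fun z : (R * R) * R => (z.2, z.1.2)) (jmeas_src mV)).
  apply: measurable_fun_pair => //; exact: (measurableT_comp measurable_snd measurable_fst).
apply: cmeasurable_real; apply: measurable_fun_ifT => //.
apply: measurable_and; first exact: measurable_fun_ler.
apply: measurable_fun_ler => //.
exact: (measurableT_comp measurable_fst measurable_fst).
Qed.

Fixpoint Vn k : R -> R -> R[i] := if k is k'.+1 then duhamel (Vn k') else (fun _ _ => 0).

Lemma jmeas_Vn k : jmeas (Vn k).
Proof. by elim: k => [|k IH]; [exact: cmeasurable_cst|exact: jmeas_duhamel]. Qed.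

Lemma jmeas_slice V t : jmeas V -> cmeasurable (V t).
Proof. by move=> mV; have := cmeasurable_comp mV (pair1_measurable t). Qed.

(** The Picard iteration of the real majorant equation.  It runs in parallel
    with the complex one and bounds both its terms and its increments. *)
Fixpoint majorant k : R -> R := if k is k'.+1 then
  (fun n => \1_G n * (expR n * normc (g0 n) +
     (2 * lam)^-1 * \int[mu]_m (majorant k' m * majorant k' (n - m)))) else (fun=> 0).

Lemma measurable_majorant k : measurable_fun setT (majorant k).
Proof.
elim: k => [|k IH] /=; first exact: measurable_cst.
apply: measurable_funM; first exact: measurable_indic.
apply: measurable_funD.
  by apply: measurable_funM; [exact: measurable_expR|exact: measurable_normc].
apply: measurable_funM => //.
exact: (leb_measurable_Rint (measurable_conv2 IH IH)).
Qed.

Lemma lam2_ge0 : 0 <= (2 * lam)^-1.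
Proof. by rewrite invr_ge0 mulr_ge0// ltW. Qed.

Lemma conv1_le (p q : R -> R) n : G n -> measurable_fun setT p -> measurable_fun setT q ->
  (forall m, 0 <= p m) -> (forall m, p m <= q m <= M m) ->
  \int[mu]_m (p m * p (n - m)) <= \int[mu]_m (q m * q (n - m)).
Proof.
move=> Gn mp mq p0 pq; have [iM _] := MM Gn.
have qM m : 0 <= q m <= M m by have /andP[h ->] := pq m; rewrite (le_trans (p0 m) h).
have pM m : 0 <= p m <= M m by have /andP[h h'] := pq m; rewrite p0 (le_trans h h').
apply: le_Rintegral => //.
- exact: (integrable_conv1 iM mp mp).
- exact: (integrable_conv1 iM mq mq).
by move=> m _; have /andP[h _] := pq m; have /andP[h' _] := pq (n - m); exact: ler_pM.
Qed.

Lemma majorant_out k n : ~ G n -> majorant k n = 0.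
Proof. by case: k => [//|k] nG; rewrite /= indicE memNset// mul0r. Qed.

Lemma majorantS k n : G n -> majorant k.+1 n = expR n * normc (g0 n) +
     (2 * lam)^-1 * \int[mu]_m (majorant k m * majorant k (n - m)).
Proof. by move=> Gn; rewrite /= indicE mem_set// mul1r. Qed.

Lemma majorant_bounds k n : 0 <= majorant k n <= M n.
Proof.
elim: k n => [|k IH] n; first by rewrite lexx M0.
have [Gn|nG] := pselect (G n); last by rewrite majorant_out// lexx M0.
rewrite majorantS//; apply/andP; split.
  apply: addr_ge0; first by rewrite mulr_ge0 ?expR_ge0 ?normc_ge0.
  rewrite mulr_ge0 ?lam2_ge0// Rintegral_ge0// => m _.
  by rewrite mulr_ge0//; [case/andP: (IH m)|case/andP: (IH (n - m))].
have [_ h] := MM Gn; apply: le_trans h; rewrite lerD2l ler_wpM2l ?lam2_ge0//.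
apply: conv1_le => //; first exact: measurable_majorant.
- by move=> m; case/andP: (IH m).
- by move=> m; rewrite lexx andbT; case/andP: (IH m).
Qed.

Lemma majorant_ge0 k n : 0 <= majorant k n. Proof. by case/andP: (majorant_bounds k n). Qed.

Lemma majorant_leM k n : majorant k n <= M n. Proof. by case/andP: (majorant_bounds k n). Qed.

Lemma majorant_mono k n : majorant k n <= majorant k.+1 n.
Proof.
elim: k n => [|k IH] n; first exact: majorant_ge0.
have [Gn|nG] := pselect (G n); last by rewrite !majorant_out.
rewrite [leLHS]majorantS// [leRHS]majorantS// lerD2l ler_wpM2l ?lam2_ge0//.
apply: conv1_le => //; [exact: measurable_majorant|exact: measurable_majorant|exact: majorant_ge0|].
by move=> m; rewrite IH majorant_leM.
Qed.

Lemma normc_osc V s n : normc (osc V s n) = normc (V s n).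
Proof. exact: normc_cisM. Qed.

Lemma half_A n : 0 <= n -> normc ((A * n / 2) +i* 0) <= n / 2.
Proof.
move=> n0; rewrite normc_real normrM normrM (ger0_norm n0) (@ger0_norm _ 2^-1) ?invr_ge0//.
by rewrite ler_pM2r ?invr_gt0// ler_piMl.
Qed.

Lemma cmeasurable_src V n : jmeas V -> cmeasurable (src V n).
Proof. by move=> /jmeas_src h; have := cmeasurable_comp h (pair2_measurable n). Qed.

(** The factor [n] is the derivative lost in the nonlinearity.  It is regained
    since [lam * n * wt s n] is the time derivative of [wt s n]. *)
Lemma src_int_le (X : R -> R[i]) n t K : 0 < n -> 0 <= t -> cmeasurable X -> 0 <= K ->
  (forall s, 0 <= s <= t -> normc (X s) <= n / 2 * (wt s n * K)) ->
  normc (cint mu `[0, t] X) <= wt t n * ((2 * lam)^-1 * K) - expR (- n) * ((2 * lam)^-1 * K).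
Proof.
move=> n0 t0 mX K0 hX; have ln : 0 < lam * n by rewrite mulr_gt0.
apply: le_trans (normc_cint_exp (C := n / 2 * (expR (- n) * K)) ln t0 mX _) _.
  move=> s st; apply: (le_trans (hX s st)); rewrite wtE.
  by rewrite le_eqVlt; apply/orP; left; apply/eqP; ring.
rewrite wtE le_eqVlt; apply/orP; left; apply/eqP.
by field; rewrite !gt_eqF.
Qed.

Lemma duhamel_out V t n : ~ G n -> duhamel V t n = 0.
Proof. by move=> nG; rewrite /duhamel indicE memNset//; exact: mul0r. Qed.

Lemma duhamel_in V t n : G n -> duhamel V t n = g0 n + cint mu `[0, t] (src V n).
Proof. by move=> Gn; rewrite /duhamel indicE mem_set//; exact: mul1r. Qed.

Lemma Vn_out k t n : ~ G n -> Vn k t n = 0.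
Proof. by case: k => [//|k] nG; exact: duhamel_out. Qed.

Lemma srcE V n s : normc (src V n s) = normc ((A * n / 2) +i* 0) * normc (conv (osc V s) n).
Proof. by rewrite /src !Normc.normcM normc_cis mul1r. Qed.

Lemma src_le V (p : R -> R) s n : jmeas V -> measurable_fun setT p -> G n ->
  (forall m, 0 <= p m <= M m) -> (forall m, normc (V s m) <= wt s m * p m) ->
  normc (src V n s) <= n / 2 * (wt s n * \int[mu]_m (p m * p (n - m))).
Proof.
move=> mV mp Gn pM Vp; have [iM _] := MM Gn; have n0 := Gpos Gn.
rewrite srcE; apply: ler_pM; rewrite ?normc_ge0 ?half_A ?(ltW n0)//.
apply: (normc_conv_le (wtM s n) iM) => //; first exact: jmeas_slice (jmeas_osc mV).
by move=> m; rewrite normc_osc.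
Qed.

Lemma src_parts V (p : R -> R) t n : jmeas V -> measurable_fun setT p -> G n ->
  (forall m, 0 <= p m <= M m) ->
  (forall s m, 0 <= s <= t -> normc (V s m) <= wt s m * p m) ->
  mu.-integrable `[0, t] (EFin \o (fun s => complex.Re (src V n s))) /\
  mu.-integrable `[0, t] (EFin \o (fun s => complex.Im (src V n s))).
Proof.
move=> mV mp Gn pM Vp.
apply: (@leb_integrable_parts _ _ _ (fun s => (n / 2 * (expR (- n) * \int[mu]_m (p m * p (n - m)))) * expR (lam * n * s))).
- exact: measurable_itv.
- exact: cmeasurable_src.
- apply: intZl => //; apply: integrable_cont_itv => s.
  exact: (is_derive_continuous (is_derive_expRM (lam * n) s)).
move=> s; rewrite /= in_itv/= => st.
apply: (le_trans (src_le mV mp Gn pM (fun m => Vp s m st))).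
by rewrite wtE le_eqVlt; apply/orP; left; apply/eqP; ring.
Qed.

Lemma conv1_ge0 (p : R -> R) n : (forall m, 0 <= p m) -> 0 <= \int[mu]_m (p m * p (n - m)).
Proof. by move=> p0; apply: Rintegral_ge0 => m _; rewrite mulr_ge0. Qed.

Lemma timeS s t : 0 <= t <= T -> 0 <= s <= t -> 0 <= s <= T.
Proof. by move=> /andP[_ tT] /andP[-> st]; rewrite (le_trans st tT). Qed.

Lemma initial_le t n : 0 <= t -> 0 <= n -> normc (g0 n) <= wt t n * (expR n * normc (g0 n)).
Proof.
move=> t0 n0; rewrite mulrA ler_peMl ?normc_ge0// /wt -expRD -[leLHS]expR0 ler_expR.
have -> : - (1 - lam * t) * n + n = lam * t * n by ring.
by apply: mulr_ge0 => //; apply: mulr_ge0 => //; exact: ltW.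
Qed.

Lemma Vn_le k t n : 0 <= t <= T -> normc (Vn k t n) <= wt t n * majorant k n.
Proof.
elim: k t n => [|k IH] t n tT; first by have -> : Vn 0 t n = 0 by []; rewrite normc_0 mulr0.
have [Gn|nG] := pselect (G n); last by rewrite Vn_out// majorant_out// mulr0 normc_0.
have n0 := Gpos Gn; have /andP[t0 _] := tT.
have E : Vn k.+1 t n = g0 n + cint mu `[0, t] (src (Vn k) n) by exact: duhamel_in.
rewrite majorantS// E; apply: (le_trans (normcD _ _)).
set K := \int[mu]_m (majorant k m * majorant k (n - m)).
have K0 : 0 <= K by apply: conv1_ge0 => m; exact: majorant_ge0.
have h := @src_int_le (src (Vn k) n) n t K n0 t0 (cmeasurable_src n (jmeas_Vn k)) K0.
have {}h : normc (cint mu `[0, t] (src (Vn k) n)) <=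
  wt t n * ((2 * lam)^-1 * K) - expR (- n) * ((2 * lam)^-1 * K).
  apply: h => s st; apply: src_le => //; first exact: jmeas_Vn.
  - exact: measurable_majorant.
  - exact: majorant_bounds.
  - by move=> m; apply: IH; exact: timeS st.
have h0 := initial_le t0 (ltW n0).
have K1 : 0 <= expR (- n) * ((2 * lam)^-1 * K) by rewrite !mulr_ge0 ?expR_ge0 ?lam2_ge0.
by rewrite mulrDr; lra.
Qed.

Lemma VnS_le k t n : 0 <= t <= T ->
  normc (Vn k.+1 t n - Vn k t n) <= wt t n * (majorant k.+1 n - majorant k n).
Proof.
elim: k t n => [|k IH] t n tT.
  by rewrite /Vn -/(Vn 1) !subr0; exact: (Vn_le 1).
have [Gn|nG] := pselect (G n); last by rewrite !Vn_out// !majorant_out// !subrr mulr0 normc_0.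
have n0 := Gpos Gn; have /andP[t0 _] := tT.
have E1 : Vn k.+1 t n = g0 n + cint mu `[0, t] (src (Vn k) n) by exact: duhamel_in.
have E2 : Vn k.+2 t n = g0 n + cint mu `[0, t] (src (Vn k.+1) n) by exact: duhamel_in.
rewrite (majorantS k.+1)// (majorantS k)// E2 E1.
set K' := \int[mu]_m (majorant k.+1 m * majorant k.+1 (n - m)).
set K := \int[mu]_m (majorant k m * majorant k (n - m)).
have KK' : 0 <= K' - K.
  rewrite subr_ge0; apply: conv1_le => //; [exact: measurable_majorant|exact: measurable_majorant|exact: majorant_ge0|].
  by move=> m; rewrite majorant_mono majorant_leM.
have bV j s m : 0 <= s <= t -> normc (Vn j s m) <= wt s m * majorant j m.
  by move=> st; apply: Vn_le; exact: timeS st.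
have [i1 i2] := src_parts (jmeas_Vn k.+1) (measurable_majorant k.+1) Gn (majorant_bounds k.+1) (bV k.+1).
have [j1 j2] := src_parts (jmeas_Vn k) (measurable_majorant k) Gn (majorant_bounds k) (bV k).
have -> : g0 n + cint mu `[0, t] (src (Vn k.+1) n) - (g0 n + cint mu `[0, t] (src (Vn k) n)) =
    cint mu `[0, t] (fun s => src (Vn k.+1) n s - src (Vn k) n s).
  by rewrite cintB// opprD addrACA subrr add0r.
have mD : cmeasurable (fun s => src (Vn k.+1) n s - src (Vn k) n s).
  have h := cmeasurableM (cmeasurable_cst _ (-1)) (cmeasurable_src n (jmeas_Vn k)).
  have := cmeasurableD (cmeasurable_src n (jmeas_Vn k.+1)) h.
  by under eq_fun do rewrite mulN1r.
have h := @src_int_le _ n t (K' - K) n0 t0 mD KK'.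
have {}h : normc (cint mu `[0, t] (fun s => src (Vn k.+1) n s - src (Vn k) n s)) <=
  wt t n * ((2 * lam)^-1 * (K' - K)) - expR (- n) * ((2 * lam)^-1 * (K' - K)).
  apply: h => s st; have [iM _] := MM Gn.
  rewrite /src -mulrBr !Normc.normcM normc_cis mul1r.
  apply: ler_pM; rewrite ?normc_ge0 ?half_A ?(ltW n0)//.
  apply: (normc_convB_le (wtM s n) iM) => //.
  - exact: jmeas_slice (jmeas_osc (jmeas_Vn k)).
  - exact: jmeas_slice (jmeas_osc (jmeas_Vn k.+1)).
  - exact: measurable_majorant.
  - exact: measurable_majorant.
  - exact: majorant_bounds.
  - by move=> m; rewrite majorant_mono majorant_leM.
  - by move=> m; rewrite normc_osc bV.
  - by move=> m; rewrite normc_osc bV.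
  - move=> m; rewrite /osc -mulrBr normc_cisM; apply: IH; exact: timeS st.
have K1 : 0 <= expR (- n) * ((2 * lam)^-1 * (K' - K)) by rewrite !mulr_ge0 ?expR_ge0 ?lam2_ge0.
have -> : expR n * normc (g0 n) + (2 * lam)^-1 * K' - (expR n * normc (g0 n) + (2 * lam)^-1 * K) =
  (2 * lam)^-1 * (K' - K) by ring.
by lra.
Qed.

(** Since [n = m + (n - m)] and the convolution is symmetric, the factor [n] can be
    moved onto one of the two terms, at the cost of a factor 2 that the
    equation compensates.  There the weight turns it into [damp nu M], an
    integrable function, and the other term keeps its [L^2] majorant. *)
Lemma srcZ_le (V : R -> R -> R[i]) s n : jmeas V -> 0 <= s <= T -> G n ->
  (forall m, ~ G m -> V s m = 0) ->
  (forall m, normc (V s m) <= wt s m * M m) ->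
  (forall m, normc (V s m) <= expR (kappa * s) * Z m) ->
  normc (src V n s) <= expR (kappa * s) * \int[mu]_m (damp nu M m * Z (n - m)).
Proof.
move=> mV sT Gn Vout VM VZ; have [iM _] := MM Gn; have [iZ _] := MZ Gn.
have n0 := Gpos Gn.
pose v m := normc (V s m).
have mv : measurable_fun setT v by apply: measurable_normc; exact: jmeas_slice.
have v0 m : 0 <= v m by exact: normc_ge0.
have nu0 : 0 <= nu by rewrite /nu subr_ge0.
have vd m : 0 <= m -> m * v m <= damp nu M m.
  move=> m0; rewrite /damp -mulrA; apply: ler_wpM2l => //.
  by apply: (le_trans (VM m)); rewrite ler_wpM2r// wt_le.
have vM m : 0 <= v m <= M m.
  rewrite v0; have [Gm|nG] := pselect (G m); last by rewrite /v Vout// normc_0 M0.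
  apply: (le_trans (VM m)); rewrite ler_piMl//.
  rewrite (le_trans (wt_le sT (ltW (Gpos Gm))))// -[leRHS]expR0 ler_expR.
  by rewrite mulNr oppr_le0 mulr_ge0// ltW// Gpos.
have ivv := integrable_conv1 iM mv mv vM vM.
have hc : normc (conv (osc V s) n) <= \int[mu]_m (v m * v (n - m)).
  apply: leb_normc_cint_le => //; last by move=> m _; rewrite Normc.normcM !normc_osc.
  by apply: cmeasurable_conv1; exact: jmeas_slice (jmeas_osc mV).
pose d m := damp nu M m * Z (n - m).
have vz m : v m = 0 \/ 0 <= m.
  have [Gm|nG] := pselect (G m); first by right; apply: ltW; exact: Gpos.
  by left; rewrite /v Vout// normc_0.
have dM0 m : 0 <= damp nu M m.
  have [Gm|nG] := pselect (G m); last by rewrite /damp Mout// mulr0.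
  by rewrite /damp !mulr_ge0 ?expR_ge0// ltW// Gpos.
have mvv_le m : `|m * (v m * v (n - m))| <= expR (kappa * s) * d m.
  have [->|m0] := vz m.
    rewrite mul0r mulr0 normr0 /d; apply: mulr_ge0; first exact: expR_ge0.
    exact: mulr_ge0.
  rewrite ger0_norm; last by apply: mulr_ge0 => //; exact: mulr_ge0.
  rewrite mulrA /d mulrCA; apply: ler_pM => //; last exact: VZ.
  - exact: mulr_ge0.
  - exact: vd.
have im : mu.-integrable setT (EFin \o (fun m => m * (v m * v (n - m)))).
  apply: (integrable_dominated measurableT _ (intZl (expR (kappa * s)) measurableT iZ)).
    by apply: measurable_funM => //; exact: measurable_conv1.
  by move=> m _; exact: mvv_le.
(* [n = m + (n - m)], and the reflection of [m] into [n - m] *)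
have hsym : n * \int[mu]_m (v m * v (n - m)) = 2 * \int[mu]_m (m * (v m * v (n - m))).
  have i' : mu.-integrable setT (EFin \o (fun m => (n - m) * (v (n - m) * v m))).
    apply: eq_integrable (integrable_reflect n im) => // m _ /=.
    by rewrite subKr.
  have e' : \int[mu]_m ((n - m) * (v (n - m) * v m)) = \int[mu]_m (m * (v m * v (n - m))).
    rewrite -(@Rintegral_reflect _ (fun m => m * (v m * v (n - m))) n); last first.
      by apply: measurable_funM => //; exact: measurable_conv1.
    by apply: eq_Rintegral => m _; rewrite subKr.
  rewrite mulr_natl mulr2n -{2}e' -RintegralD// -RintegralZl//.
  by apply: eq_Rintegral => m _; ring.
have hd : \int[mu]_m (m * (v m * v (n - m))) <= expR (kappa * s) * \int[mu]_m d m.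
  rewrite -RintegralZl//; apply: le_Rintegral => //; first exact: intZl.
  by move=> m _; apply: (le_trans _ (mvv_le m)); exact: ler_norm.
rewrite srcE; apply: (@le_trans _ _ (n / 2 * \int[mu]_m (v m * v (n - m)))).
  by apply: ler_pM; rewrite ?normc_ge0 ?half_A ?(ltW n0).
rewrite -mulrA (mulrC 2^-1) mulrA hsym mulrAC divff// mul1r.
exact: hd.
Qed.

Lemma Vn_leZ k t n : 0 <= t <= T -> normc (Vn k t n) <= expR (kappa * t) * Z n.
Proof.
elim: k t n => [|k IH] t n tT; first by have -> : Vn 0 t n = 0 by []; rewrite normc_0 mulr_ge0 ?expR_ge0.
have [Gn|nG] := pselect (G n); last by rewrite Vn_out// normc_0 mulr_ge0 ?expR_ge0.
have /andP[t0 _] := tT; have [iZ hZ] := MZ Gn.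
have E : Vn k.+1 t n = g0 n + cint mu `[0, t] (src (Vn k) n) by exact: duhamel_in.
rewrite E; apply: (le_trans (normcD _ _)).
move: hZ; set S := \int[mu]_k0 _ => hZ.
have S0 : 0 <= S.
  apply: Rintegral_ge0 => m _; apply: mulr_ge0 => //.
  have [Gm|nG] := pselect (G m); last by rewrite /damp Mout// mulr0.
  by rewrite /damp !mulr_ge0 ?expR_ge0// ltW// Gpos.
have h : normc (cint mu `[0, t] (src (Vn k) n)) <= S * ((expR (kappa * t) - 1) / kappa).
  apply: normc_cint_exp => //; first exact: cmeasurable_src (jmeas_Vn k).
  move=> s st; have sT := timeS tT st; rewrite mulrC; apply: srcZ_le => //.
  - exact: jmeas_Vn.
  - by move=> m; exact: Vn_out.
  - by move=> m; apply: (le_trans (Vn_le k m sT)); rewrite ler_wpM2l ?wt_ge0 ?majorant_leM.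
  - by move=> m; exact: IH.
have e1 : 1 <= expR (kappa * t) by rewrite -[leLHS]expR0 ler_expR mulr_ge0// ltW.
have g00 := normc_ge0 (g0 n).
have h2 : S * ((expR (kappa * t) - 1) / kappa) = (expR (kappa * t) - 1) * (kappa^-1 * S) by ring.
have a0 : 0 <= kappa^-1 * S by rewrite mulr_ge0// invr_ge0 ltW.
rewrite h2 in h; move: h hZ e1 g00 a0.
move: (kappa^-1 * S) (expR _) (normc (g0 n)) (normc (cint _ _ _)) (Z n) => a e u c z h hz e1 u0 a0.
have : 0 <= e * (z - (u + a)) by rewrite mulr_ge0 ?subr_ge0// (le_trans _ e1).
have : 0 <= (e - 1) * u by rewrite mulr_ge0// subr_ge0.
by lra.
Qed.

(** Freezing the time outside [0 <= t <= T] makes the limit below exist, with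
    its bounds, for all real [t]. *)
Definition clamp t : R := Num.max 0 (Num.min t T).

Lemma clamp_itv t : 0 <= clamp t <= T.
Proof. by rewrite /clamp le_max lexx/= ge_max ge_min lexx orbT andbT ltW. Qed.

Lemma clamp_id t : 0 <= t <= T -> clamp t = t.
Proof. by move=> /andP[t0 tT]; rewrite /clamp min_l// max_r. Qed.

Lemma clamp_lipschitz t s : `|clamp t - clamp s| <= `|t - s|.
Proof.
rewrite /clamp; have T1 := T0.
case: (leP t T) => h1; case: (leP s T) => h2.
- by case: (leP 0 t) => h3; case: (leP 0 s) => h4; rewrite ?subrr ?normr0//; rewrite !ler_norml; apply/andP; split; have := ler_norm (t - s); have := ler_norm (s - t); rewrite (distrC s); lra.
- by rewrite (max_r (ltW T1)); case: (leP 0 t) => h3; rewrite !ler_norml; apply/andP; split; have := ler_norm (t - s); have := ler_norm (s - t); rewrite (distrC s); lra.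
- by rewrite (max_r (ltW T1)); case: (leP 0 s) => h3; rewrite !ler_norml; apply/andP; split; have := ler_norm (t - s); have := ler_norm (s - t); rewrite (distrC s); lra.
- by rewrite subrr normr0.
Qed.

Lemma measurable_clamp : measurable_fun setT clamp.
Proof. by apply: measurable_maxr => //; exact: measurable_minr. Qed.

(** Pointwise limit of the Picard iterates; convergence holds at every
    frequency, as the majorants are finite on [G] and vanish off [G]. *)
Definition VL t n : R[i] :=
  limn (fun k => complex.Re (Vn k (clamp t) n)) +i* limn (fun k => complex.Im (Vn k (clamp t) n)).

Lemma wt_le1 t n : 0 <= t <= T -> 0 <= n -> wt t n <= 1.
Proof.
move=> tT n0; rewrite (le_trans (wt_le tT n0))// -[leRHS]expR0 ler_expR.
by rewrite mulNr oppr_le0 mulr_ge0// /nu subr_ge0.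
Qed.

Lemma cvg_Vn t n : ccvg (fun k => Vn k (clamp t) n) (VL t n).
Proof.
have tT := clamp_itv t; have w0 := wt_ge0 (clamp t) n.
split => /=.
- apply: (@cvg_of_dominated_increments _ _ (fun k => wt (clamp t) n * majorant k n) (wt (clamp t) n * M n)).
  + by move=> k; rewrite -cReB -mulrBr (le_trans (norm_Re_le _))// VnS_le.
  + by move=> k; rewrite (le_trans (norm_Re_le _))// Vn_le.
  + by move=> k; rewrite ler_wpM2l// majorant_leM.
- apply: (@cvg_of_dominated_increments _ _ (fun k => wt (clamp t) n * majorant k n) (wt (clamp t) n * M n)).
  + by move=> k; rewrite -cImB -mulrBr (le_trans (norm_Im_le _))// VnS_le.
  + by move=> k; rewrite (le_trans (norm_Im_le _))// Vn_le.
  + by move=> k; rewrite ler_wpM2l// majorant_leM.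
Qed.

Lemma VL_clamp t : VL (clamp t) = VL t.
Proof. by rewrite /VL (clamp_id (clamp_itv t)). Qed.

Lemma cvg_VnT t n : 0 <= t <= T -> ccvg (fun k => Vn k t n) (VL t n).
Proof. by move=> tT; have := cvg_Vn t n; rewrite clamp_id. Qed.

Lemma VL_le t n : normc (VL t n) <= wt (clamp t) n * M n.
Proof.
apply: (ccvg_normc_le (cvg_Vn t n)) => k.
by apply: (le_trans (Vn_le k n (clamp_itv t))); rewrite ler_wpM2l ?wt_ge0 ?majorant_leM.
Qed.

Lemma VL_leZ t n : normc (VL t n) <= expR (kappa * clamp t) * Z n.
Proof. by apply: (ccvg_normc_le (cvg_Vn t n)) => k; exact: Vn_leZ (clamp_itv t). Qed.

Lemma VL_out t n : ~ G n -> VL t n = 0.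
Proof.
move=> nG; have h := cvg_Vn t n.
rewrite (_ : (fun k => _) = (fun=> 0)) in h; last by apply/funext => k; exact: Vn_out.
exact: (ccvg_unique h (ccvg_cst 0)).
Qed.

Lemma Vn_leM k t n : 0 <= t <= T -> normc (Vn k t n) <= M n.
Proof.
move=> tT; have [Gn|nG] := pselect (G n); last by rewrite Vn_out// normc_0 M0.
apply: (le_trans (Vn_le k n tT)); apply: (@le_trans _ _ (1 * M n)); last by rewrite mul1r.
by apply: ler_pM; rewrite ?wt_ge0 ?majorant_ge0 ?majorant_leM ?wt_le1 ?(ltW (Gpos Gn)).
Qed.

Lemma VL_leM t n : normc (VL t n) <= M n.
Proof. by apply: (ccvg_normc_le (cvg_Vn t n)) => k; exact: Vn_leM (clamp_itv t). Qed.

Lemma jmeas_VL : jmeas VL.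
Proof.
have mV k : cmeasurable (fun p : R * R => Vn k (clamp p.1) p.2).
  apply: (@cmeasurable_comp _ _ _ _ _ (fun p : R * R => Vn k p.1 p.2)
    (fun p : R * R => (clamp p.1, p.2)) (jmeas_Vn k)).
  by apply: measurable_fun_pair => //; exact: (measurableT_comp measurable_clamp measurable_fst).
split.
- apply: (@measurable_fun_cvg _ _ _ setT (fun k p => complex.Re (Vn k (clamp p.1) p.2))).
  + by move=> k; case: (mV k).
  + by move=> [t n] _; case: (cvg_Vn t n).
- apply: (@measurable_fun_cvg _ _ _ setT (fun k p => complex.Im (Vn k (clamp p.1) p.2))).
  + by move=> k; case: (mV k).
  + by move=> [t n] _; case: (cvg_Vn t n).
Qed.

Lemma cvg_conv_Vn t n : 0 <= t <= T -> G n ->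
  ccvg (fun k => conv (osc (Vn k) t) n) (conv (osc VL t) n).
Proof.
move=> tT Gn; have [iM _] := MM Gn; apply: (cint_ccvg _ _ _ _ iM) => //.
- by move=> k; apply: cmeasurable_conv1; exact: jmeas_slice (jmeas_osc (jmeas_Vn k)).
- by apply: cmeasurable_conv1; exact: jmeas_slice (jmeas_osc jmeas_VL).
- move=> m _; apply: ccvgM; apply: ccvgM; [exact: ccvg_cst|exact: cvg_VnT|exact: ccvg_cst|exact: cvg_VnT].
- move=> k m _; rewrite Normc.normcM !normc_osc; apply: ler_pM; rewrite ?normc_ge0 ?Vn_leM//.
Qed.

Lemma src_leM V s n : jmeas V -> G n -> (forall m, normc (V s m) <= M m) ->
  normc (src V n s) <= n / 2 * \int[mu]_m (M m * M (n - m)).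
Proof.
move=> mV Gn VM; have [iM _] := MM Gn; have n0 := Gpos Gn.
rewrite srcE; apply: ler_pM; rewrite ?normc_ge0 ?half_A ?(ltW n0)//.
have h := @normc_conv_le _ (fun=> 1) M n (fun m => mulr1 1) iM (osc V s) M.
rewrite mul1r in h; apply: h => //.
- exact: jmeas_slice (jmeas_osc mV).
- by move=> m; rewrite M0 lexx.
- by move=> m; rewrite mul1r normc_osc.
Qed.

Lemma integrable_cst_itv (c a b : R) : mu.-integrable `[a, b] (EFin \o (fun=> c)).
Proof. by apply: integrable_cont_itv => s; exact: cst_continuous. Qed.

(** Dominated convergence in the frequency for the convolutions, then in time
    for the source. *)
Lemma VL_duhamel t n : 0 <= t <= T -> G n -> VL t n = g0 n + cint mu `[0, t] (src VL n).
Proof.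
move=> tT Gn.
have h1 : ccvg (fun k => Vn k.+1 t n) (VL t n).
  have [u1 u2] := cvg_VnT n tT; split.
  - by have := u1; rewrite -(cvg_shiftS (fun k => complex.Re (Vn k t n))).
  - by have := u2; rewrite -(cvg_shiftS (fun k => complex.Im (Vn k t n))).
apply: (ccvg_unique h1).
have -> : (fun k => Vn k.+1 t n) = (fun k => g0 n + cint mu `[0, t] (src (Vn k) n)).
  by apply/funext => k; exact: duhamel_in.
apply: ccvgD; first exact: ccvg_cst.
apply: (cint_ccvg _ _ _ _ (integrable_cst_itv (n / 2 * \int[mu]_m (M m * M (n - m))) 0 t)) => //.
- by move=> k; exact: cmeasurable_src (jmeas_Vn k).
- exact: cmeasurable_src jmeas_VL.
- move=> s; rewrite /= in_itv/= => st; apply: ccvgM; first exact: ccvg_cst.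
  by apply: cvg_conv_Vn => //; exact: timeS st.
- move=> k s; rewrite /= in_itv/= => st; apply: src_leM => //; first exact: jmeas_Vn.
  by move=> m; apply: Vn_leM; exact: timeS st.
Qed.

Lemma VL_initial n : G n -> VL 0 n = g0 n.
Proof.
move=> Gn; rewrite VL_duhamel//; last by rewrite lexx ltW.
rewrite (_ : cint _ _ _ = 0) ?addr0//; apply: cReP => /=;
  by rewrite set_itv1 /Rintegral integral_set1.
Qed.

Lemma conv_MM_le n : G n -> \int[mu]_m (M m * M (n - m)) <= 2 * lam * M n.
Proof.
move=> Gn; have [_ h] := MM Gn; have l2 : 0 < 2 * lam by rewrite mulr_gt0.
rewrite -ler_pdivrMl//; apply: le_trans h; rewrite lerDr.
by rewrite mulr_ge0 ?expR_ge0 ?normc_ge0.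
Qed.

(** A bound uniform in time: [M] is a supersolution, so its self-convolution is
    at most [2 * lam * M]. *)
Lemma src_VL_le s n : 0 <= s <= T -> G n -> normc (src VL n s) <= lam * damp nu M n.
Proof.
move=> sT Gn; have n0 := Gpos Gn.
have VLb m : normc (VL s m) <= wt s m * M m by have := VL_le s m; rewrite clamp_id.
have Mb m : 0 <= M m <= M m by rewrite M0 lexx.
apply: (le_trans (src_le jmeas_VL mM Gn Mb VLb)).
have -> : lam * damp nu M n = n / 2 * (expR (- nu * n) * (2 * lam * M n)).
  by rewrite /damp; field.
rewrite ler_wpM2l ?divr_ge0 ?(ltW n0)//; apply: ler_pM; rewrite ?wt_ge0 ?wt_le ?(ltW n0)//.
- exact: conv1_ge0.
- exact: conv_MM_le.
Qed.

Lemma cint_itvB (f : R -> R[i]) s t : 0 <= s -> s <= t ->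
  mu.-integrable `[0, t] (EFin \o (fun x => complex.Re (f x))) ->
  mu.-integrable `[0, t] (EFin \o (fun x => complex.Im (f x))) ->
  cint mu `[0, t] f - cint mu `[0, s] f = cint mu `]s, t] f.
Proof.
move=> s0 st f1 f2; apply: cReP; rewrite ?cReB ?cImB /cint/=;
  by rewrite Rintegral_itvB ?bnd_simp.
Qed.

Lemma VL_lipschitz_le s t n : 0 <= s -> s <= t -> t <= T ->
  normc (VL t n - VL s n) <= lam * damp nu M n * (t - s).
Proof.
move=> s0 st tT; have t0 := le_trans s0 st.
have [Gn|nG] := pselect (G n); last first.
  by rewrite !VL_out// subrr normc_0 /damp Mout// !mulr0 mul0r.
rewrite (VL_duhamel _ Gn) ?t0// (VL_duhamel _ Gn) ?s0 ?(le_trans st)//.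
have ms := cmeasurable_src n jmeas_VL.
have [i1 i2] : mu.-integrable `[0, t] (EFin \o (fun x => complex.Re (src VL n x))) /\
    mu.-integrable `[0, t] (EFin \o (fun x => complex.Im (src VL n x))).
  apply: (leb_integrable_parts _ ms (integrable_cst_itv (lam * damp nu M n) 0 t)) => //.
  move=> x; rewrite /= in_itv/= => /andP[x0 xt]; apply: src_VL_le => //.
  by rewrite x0 (le_trans xt).
rewrite opprD addrACA subrr add0r cint_itvB//.
apply: (@le_trans _ _ (\int[mu]_(x in `]s, t]) (lam * damp nu M n))).
  apply: (leb_normc_cint_le _ ms) => //.
    apply: integrableS (integrable_cst_itv (lam * damp nu M n) s t) => //.
    by apply: subset_itv; rewrite bnd_simp.
  move=> x; rewrite /= in_itv/= => /andP[x0 xt]; apply: src_VL_le => //.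
  by rewrite (le_trans s0 (ltW x0)) (le_trans xt).
rewrite Rintegral_cst//= lebesgue_measure_itv/= lte_fin.
case: ifPn => // _; by rewrite /= mulr0 mulr_ge0 ?subr_ge0// mulr_ge0 ?(ltW lam0)// /damp !mulr_ge0 ?expR_ge0// ltW// Gpos.
Qed.

Lemma VL_lipschitz s t n : normc (VL t n - VL s n) <= lam * damp nu M n * `|t - s|.
Proof.
have d0 : 0 <= lam * damp nu M n.
  apply: mulr_ge0; first exact: ltW.
  have [Gm|nG] := pselect (G n); last by rewrite /damp Mout// mulr0.
  by rewrite /damp !mulr_ge0 ?expR_ge0// ltW// Gpos.
rewrite -(VL_clamp t) -(VL_clamp s).
apply: (@le_trans _ _ (lam * damp nu M n * `|clamp t - clamp s|)); last first.
  by rewrite ler_wpM2l// clamp_lipschitz.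
have /andP[t0 tT] := clamp_itv t; have /andP[s0 sT] := clamp_itv s.
have [st|ts] := leP (clamp s) (clamp t).
  by rewrite ger0_norm ?subr_ge0//; exact: VL_lipschitz_le.
rewrite -normcN opprB distrC ger0_norm; last by rewrite subr_ge0 ltW.
by apply: VL_lipschitz_le => //; exact: ltW.
Qed.

Lemma ccvg_VL (u : R ^nat) p n : u k @[k --> \oo] --> p -> ccvg (fun k => VL (u k) n) (VL p n).
Proof.
move=> up.
have h : lam * damp nu M n * `|p - u k| @[k --> \oo] --> 0.
  rewrite -[X in _ --> X](mulr0 (lam * damp nu M n)); apply: cvgMr.
  rewrite -[X in _ --> X](@normr0 _ R) -(subrr p); apply: cvg_norm.
  by apply: cvgB => //; exact: cvg_cst.
split; apply/cvgrPdist_le => e e0; near=> k.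
- rewrite -cReB (le_trans (norm_Re_le _))// (le_trans (VL_lipschitz _ _ _))//.
  by near: k; move/cvgrPdist_le : h => /(_ e e0); apply: filterS => k; rewrite sub0r normrN => /(le_trans (ler_norm _)).
- rewrite -cImB (le_trans (norm_Im_le _))// (le_trans (VL_lipschitz _ _ _))//.
  by near: k; move/cvgrPdist_le : h => /(_ e e0); apply: filterS => k; rewrite sub0r normrN => /(le_trans (ler_norm _)).
Unshelve. all: by end_near. Qed.

Lemma ccvg_cis (u : R ^nat) p a : u k @[k --> \oo] --> p -> ccvg (fun k => cis (a * u k)) (cis (a * p)).
Proof.
move=> up; have h : a * u k @[k --> \oo] --> a * p by apply: cvgMr.
split.
- exact: (continuous_cvg _ (@continuous_cos R _) h).
- exact: (continuous_cvg _ (@continuous_sin R _) h).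
Qed.

(** The source with the time clamped is continuous on the whole line, so that
    the fundamental theorem of calculus applies at interior times. *)
Definition srcT n s := src VL n (clamp s).

Lemma ccvg_srcT (u : R ^nat) p n : G n -> u k @[k --> \oo] --> p ->
  ccvg (fun k => srcT n (u k)) (srcT n p).
Proof.
move=> Gn up; have [iM _] := MM Gn.
have cu : clamp (u k) @[k --> \oo] --> clamp p.
  apply/cvgrPdist_le => e e0; near=> k; apply: (le_trans (clamp_lipschitz _ _)).
  by near: k; move/cvgrPdist_le : up; exact.
have cosc m : ccvg (fun k => osc VL (clamp (u k)) m) (osc VL (clamp p) m).
  by apply: ccvgM; [exact: ccvg_cis|exact: ccvg_VL].
apply: ccvgM.
  apply: ccvgM; last exact: ccvg_cst.
  have := ccvg_cis (- om n) cu.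
  by rewrite mulNr; under [X in ccvg X _]eq_fun do rewrite mulNr.
apply: (cint_ccvg _ _ _ _ iM) => //.
- by move=> k; apply: cmeasurable_conv1; exact: jmeas_slice (jmeas_osc jmeas_VL).
- by apply: cmeasurable_conv1; exact: jmeas_slice (jmeas_osc jmeas_VL).
- by move=> m _; exact: ccvgM.
- by move=> k m _; rewrite Normc.normcM !normc_osc; apply: ler_pM; rewrite ?normc_ge0 ?VL_leM.
Unshelve. all: by end_near. Qed.

Lemma continuous_srcT n : G n -> continuous (fun s => complex.Re (srcT n s)) /\
  continuous (fun s => complex.Im (srcT n s)).
Proof.
move=> Gn; split=> p; apply/continuous_withinNx/cvgr_dnbhsP => u [_ up].
- by have [] := ccvg_srcT Gn up.
- by have [] := ccvg_srcT Gn up.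
Qed.

Lemma is_derive_primitive (h : R -> R) (t : R) : continuous h -> 0 < t ->
  is_derive t 1 (fun t => \int[mu]_(s in `[0, t]) h s) (h t).
Proof.
move=> ch t0.
have tt : t < t + 1 by rewrite ltrDl.
have ih : mu.-integrable `[0, t + 1] (EFin \o h) by exact: integrable_cont_itv.
have /= := continuous_FTC1_closed tt ih => /(_ t0 (ch t)) [d1 d2].
by split; [exact: d1|rewrite -derive1E; exact: d2].
Qed.

Lemma is_derive_cstD (c : R) (f : R -> R) (t d : R) : is_derive t 1 f d ->
  is_derive t 1 (fun s => c + f s) d.
Proof.
move=> h; have := @is_deriveD _ _ _ _ _ _ _ _ _ (is_derive_cst c t (1 : R)) h.
by rewrite add0r.
Qed.

Lemma is_derive_VL (n t : R) : G n -> 0 < t < T ->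
  is_derive t 1 (fun t => complex.Re (VL t n)) (complex.Re (src VL n t)) /\
  is_derive t 1 (fun t => complex.Im (VL t n)) (complex.Im (src VL n t)).
Proof.
move=> Gn /andP[t0 tT]; have [c1 c2] := continuous_srcT Gn.
have e (s : R) : 0 <= s <= T -> VL s n = g0 n + cint mu `[0, s] (srcT n).
  move=> sT; have es x : x \in `[0, s]%classic -> src VL n x = srcT n x.
    by rewrite inE/= in_itv/= => xs; rewrite /srcT (clamp_id (timeS sT xs)).
  have -> : cint mu `[0, s] (srcT n) = cint mu `[0, s] (src VL n).
    by apply: cReP; apply: eq_Rintegral => x /es ->.
  exact: VL_duhamel.
have nt : \forall s \near t, 0 <= s <= T.
  near=> s; apply/andP; split; apply: ltW; near: s; [exact: lt_nbhsr|exact: lt_nbhsl].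
have st : srcT n t = src VL n t by rewrite /srcT clamp_id// !ltW.
rewrite -st; split.
- apply: (@near_eq_is_derive R R R (fun s : R => complex.Re (g0 n) + \int[mu]_(x in `[0, s]) complex.Re (srcT n x))).
    by apply: filterS nt => s /e ->; rewrite cReD.
  exact: is_derive_cstD (is_derive_primitive c1 t0).
- apply: (@near_eq_is_derive R R R (fun s : R => complex.Im (g0 n) + \int[mu]_(x in `[0, s]) complex.Im (srcT n x))).
    by apply: filterS nt => s /e ->; rewrite cImD.
  exact: is_derive_cstD (is_derive_primitive c2 t0).
Unshelve. all: by end_near. Qed.

(** The first bound is the one of the Wiener spaces, the second gives square
    integrability, and the Lipschitz bound joint continuity. *)
Lemma volterra_solution : exists V : R -> R -> R[i],
  [/\ jmeas V, forall t n, ~ G n -> V t n = 0, forall n, G n -> V 0 n = g0 n &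
  [/\ forall t n, normc (V t n) <= wt (clamp t) n * M n,
     forall t n, normc (V t n) <= expR (kappa * clamp t) * Z n,
     forall s t n, normc (V t n - V s n) <= lam * damp nu M n * `|t - s| &
     forall n t : R, G n -> 0 < t < T ->
       is_derive t 1 (fun s => complex.Re (V s n)) (complex.Re (src V n t)) /\
       is_derive t 1 (fun s => complex.Im (V s n)) (complex.Im (src V n t))]].
Proof.
exists VL; split; [exact: jmeas_VL|exact: VL_out|exact: VL_initial|].
by split; [exact: VL_le|exact: VL_leZ|exact: VL_lipschitz|exact: is_derive_VL].
Qed.

End volterra.

(** * From the modes to the equation *)

(** [U] are the modes and [C] is a representative of their self-convolution for
    which the bounds hold at every frequency.  The weights leave room for two
    derivatives in [x] and for the dispersion relation, quadratic in [n]. *)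
Section mode_evolution.
Local Open Scope complex_scope.
Context {R : realType}.
Local Notation mu := (@lebesgue_measure R).
Local Notation Re := (@complex.Re R).
Local Notation Im := (@complex.Im R).
Local Notation normc := Normc.normc.
Variables (eps A beta T : R) (U C : R -> R -> R[i]) (B : R -> R).
Hypothesis eps0 : 0 < eps.
Hypothesis iB : mu.-integrable setT (EFin \o B).
Hypothesis mU : forall t, cmeasurable (U t).
Hypothesis mC : forall t, cmeasurable (C t).
Hypothesis U0 : forall t n, n <= 0 -> U t n = 0.
Hypothesis UB : forall t n, (1 + `|n|) ^+ 3 * normc (U t n) <= B n.
Hypothesis CB : forall t n, (1 + `|n|) * normc (C t n) <= B n.
Hypothesis Cconv : forall t, {ae mu, forall n, conv (U t) n = C t n}.
Hypothesis Ulip : forall s t n, normc (U t n - U s n) <= B n * `|t - s|.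

Definition dispersion n : R := (n + A - beta * n ^+ 2) / (2 * eps).

Definition Udot t n : R[i] := (0 +i* dispersion n) * U t n + ((A * n / 2) +i* 0) * C t n.

Hypothesis dU : forall t n : R, 0 < t < T ->
  is_derive t 1 (fun s => Re (U s n)) (Re (Udot t n)) /\
  is_derive t 1 (fun s => Im (U s n)) (Im (Udot t n)).

Definition sol x t := 2 * rsynth (U t) x.

Lemma poly_U_le t n (p : R) c : 0 <= c -> p <= c * (1 + `|n|) ^+ 3 ->
  p * normc (U t n) <= c * B n.
Proof.
move=> c0 hp; apply: (@le_trans _ _ (c * ((1 + `|n|) ^+ 3 * normc (U t n)))).
  by rewrite mulrA ler_wpM2r ?normc_ge0.
by rewrite ler_wpM2l.
Qed.

Lemma one_le_pow3 (n : R) : 1 <= (1 + `|n|) ^+ 3.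
Proof. by rewrite exprn_ege1// lerDl. Qed.

Lemma norm_le_pow3 (n : R) : `|n| <= (1 + `|n|) ^+ 3.
Proof. have := normr_ge0 n; move: `|n| => x x0; rewrite !exprS expr0; nra. Qed.

Lemma sqr_le_pow3 (n : R) : `|n| * `|n| <= (1 + `|n|) ^+ 3.
Proof. have := normr_ge0 n; move: `|n| => x x0; rewrite !exprS expr0; nra. Qed.

Lemma B_ge0 n : 0 <= B n.
Proof. by apply: (le_trans _ (UB 0 n)); rewrite mulr_ge0 ?normc_ge0// exprn_ge0// addr_ge0. Qed.

Lemma normc_U_le t n : normc (U t n) <= B n.
Proof. by have := @poly_U_le t n 1 1 ler01; rewrite !mul1r; apply; exact: one_le_pow3. Qed.

Lemma cmeasurable_imag : cmeasurable (fun n : R => (0 +i* n)).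
Proof. by apply: cmeasurable_pair => //; exact: measurable_cst. Qed.

Lemma normc_in (n : R) : normc (0 +i* n) = `|n|. Proof. exact: normc_imag. Qed.

Lemma cL1_U t : cL1 (U t).
Proof. by apply: (cL1_dominated _ iB) => // n; exact: normc_U_le. Qed.

(** The symbols of the derivative and of the Hilbert transform on the positive
    frequencies. *)
Definition dx (g : R -> R[i]) n : R[i] := (0 +i* n) * g n.

Definition hil (g : R -> R[i]) n : R[i] := (0 -i* 1) * g n.

Lemma cmeasurable_dx g : cmeasurable g -> cmeasurable (dx g).
Proof. by move=> mg; apply: cmeasurableM => //; exact: cmeasurable_imag. Qed.

Lemma cL1_dxU t : cL1 (dx (U t)).
Proof.
apply: (cL1_dominated _ iB); first exact: cmeasurable_dx.
move=> n; rewrite Normc.normcM normc_in -[leRHS]mul1r.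
by apply: poly_U_le => //; rewrite mul1r norm_le_pow3.
Qed.

Lemma cL1_dxdxU t : cL1 (dx (dx (U t))).
Proof.
apply: (cL1_dominated _ iB); first by do 2 apply: cmeasurable_dx.
move=> n; rewrite !Normc.normcM normc_in -[leRHS]mul1r mulrA.
by apply: poly_U_le => //; rewrite mul1r sqr_le_pow3.
Qed.

Lemma cL1_C t : cL1 (C t).
Proof.
apply: (cL1_dominated _ iB) => // n; apply: le_trans (CB t n).
by rewrite ler_peMl ?normc_ge0// lerDl.
Qed.

Lemma cL1_dxC t : cL1 (dx (C t)).
Proof.
apply: (cL1_dominated _ iB); first exact: cmeasurable_dx.
move=> n; rewrite Normc.normcM normc_in; apply: le_trans (CB t n).
by rewrite ler_wpM2r ?normc_ge0// lerDr.
Qed.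

Lemma is_derive_2M (f : R -> R) (x d : R) : is_derive x 1 f d ->
  is_derive x 1 (fun y => 2 * f y) (2 * d).
Proof. by move=> h; exact: (@is_deriveZ _ _ _ _ 2 _ _ _ h). Qed.

Lemma is_derive_sol (x t : R) : is_derive x 1 (sol^~ t) (2 * rsynth (dx (U t)) x).
Proof. by apply: is_derive_2M; apply: is_derive_rsynth; [exact: cL1_U|exact: cL1_dxU]. Qed.

Lemma derive1_sol t : derive1 (sol^~ t) = (fun x => 2 * rsynth (dx (U t)) x).
Proof. by apply/funext => x; have h := is_derive_sol x t; rewrite derive1E; exact: derive_val. Qed.

Lemma is_derive_sol2 (x t : R) : is_derive x 1 (derive1 (sol^~ t)) (2 * rsynth (dx (dx (U t))) x).
Proof.
rewrite derive1_sol; apply: is_derive_2M; apply: is_derive_rsynth; first exact: cL1_dxU.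
exact: cL1_dxdxU.
Qed.

Lemma derive2_sol t : derive1 (derive1 (sol^~ t)) = (fun x => 2 * rsynth (dx (dx (U t))) x).
Proof. by apply/funext => x; have h := is_derive_sol2 x t; rewrite derive1E; exact: derive_val. Qed.

Lemma two_rsynth (g : R -> R[i]) : cL1 g ->
  (fun x => 2 * rsynth g x) = rsynth (fun n => (2 +i* 0) * g n).
Proof. by move=> g1; apply/funext => x; rewrite rsynthZ. Qed.

Lemma has_hilbert_2rsynth (g : R -> R[i]) x : cL1 g -> (forall n, n <= 0 -> g n = 0) ->
  has_hilbert (fun x => 2 * rsynth g x) x /\
  hilbert (fun x => 2 * rsynth g x) x = 2 * rsynth (hil g) x.
Proof.
move=> g1 g0; rewrite two_rsynth//.
have g2 : cL1 (fun n => (2 +i* 0) * g n) by exact: cL1Z.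
have g20 n : n <= 0 -> (2 +i* 0) * g n = 0 by move=> n0; rewrite g0// mulr0.
split; first exact: has_hilbert_rsynth.
rewrite (hilbert_rsynth g2 g20) -rsynthZ; last exact: cL1Z.
have -> : (fun n => (0 -i* 1) * ((2 +i* 0) * g n)) = (fun n => (2 +i* 0) * hil g n).
  by apply/funext => n; rewrite /hil mulrCA.
by [].
Qed.

Lemma rsynth_conv t x : rsynth (hil (conv (U t))) x = rsynth (hil (C t)) x.
Proof.
have m1 := cmeasurable_synth x (cmeasurableM (cmeasurable_cst _ (0 -i* 1)) (cmeasurable_conv (mU t))).
have m2 := cmeasurable_synth x (cmeasurableM (cmeasurable_cst _ (0 -i* 1)) (mC t)).
apply: leb_ae_eq_Rintegral; [by case: m1|by case: m2|].
by apply: (leb_aeS (Cconv t)) => n; rewrite /hil => ->.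
Qed.

Lemma hilbert_sol t : hilbert (sol^~ t) = (fun x => 2 * rsynth (hil (U t)) x).
Proof. by apply/funext => x; have [_] := has_hilbert_2rsynth x (cL1_U t) (U0 t). Qed.

Lemma hilbert_sol_mul t : (fun y => hilbert (sol^~ t) y * sol y t) = (fun y => 2 * rsynth (hil (C t)) y).
Proof.
apply/funext => y; rewrite hilbert_sol -rsynth_conv /hil -rsynth_sqr ?/sol; last exact: cL1_U.
by move: (rsynth _ _) (rsynth _ _) => a b; ring.
Qed.

Lemma is_derive_hilbert_sol_mul (x t : R) :
  is_derive x 1 (fun y => hilbert (sol^~ t) y * sol y t) (2 * rsynth (dx (hil (C t))) x).
Proof.
rewrite hilbert_sol_mul; apply: is_derive_2M; apply: is_derive_rsynth.
  exact: cL1Z (cL1_C t).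
have -> : (fun n => (0 +i* n) * hil (C t) n) = (fun n => (0 -i* 1) * dx (C t) n).
  by apply/funext => n; rewrite /hil /dx mulrCA.
exact: cL1Z (cL1_dxC t).
Qed.

Definition Kd : R := (1 + `|A| + `|beta|) / (2 * eps) + `|A| + 2.

Lemma dispersion_le n : `|dispersion n| <= (1 + `|A| + `|beta|) / (2 * eps) * (1 + `|n|) ^+ 2.
Proof.
have e2 : 0 < 2 * eps by rewrite mulr_gt0.
rewrite /dispersion normrM normfV (gtr0_norm e2) mulrAC ler_pM2r ?invr_gt0//.
apply: (le_trans (ler_normB _ _)); apply: (le_trans (lerD (ler_normD _ _) (lexx _))).
rewrite normrM normrX.
have := normr_ge0 n; have := normr_ge0 A; have := normr_ge0 beta.
move: `|n| `|A| `|beta| => x a b b0 a0 x0.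
have : 0 <= a * x by exact: mulr_ge0.
have : 0 <= b * x by exact: mulr_ge0.
have : 0 <= a * x ^+ 2 by rewrite mulr_ge0// sqr_ge0.
have := sqr_ge0 x; rewrite !expr2; nra.
Qed.

Lemma cmeasurable_dispersion : cmeasurable (fun n => (0 +i* dispersion n)).
Proof.
apply: cmeasurable_pair; first exact: measurable_cst.
rewrite /dispersion; apply: measurable_funM => //.
apply: measurable_funB; first exact: measurable_funD.
by apply: measurable_funM => //; exact: measurable_funX.
Qed.

Lemma normc_Udot_le t n : normc (Udot t n) <= Kd * B n.
Proof.
have c0 : 0 <= (1 + `|A| + `|beta|) / (2 * eps) by rewrite divr_ge0 ?addr_ge0// mulr_ge0// ltW.
apply: (le_trans (normcD _ _)); rewrite !Normc.normcM normc_imag normc_real.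
have h1 : `|dispersion n| * normc (U t n) <= (1 + `|A| + `|beta|) / (2 * eps) * B n.
  apply: poly_U_le => //; apply: (le_trans (dispersion_le n)); rewrite ler_wpM2l//.
  by rewrite ler_weXn2l// lerDl.
have h2 : `|A * n / 2| * normc (C t n) <= `|A| * B n.
  apply: (@le_trans _ _ (`|A| * ((1 + `|n|) * normc (C t n)))); last by rewrite ler_wpM2l.
  rewrite mulrA ler_wpM2r ?normc_ge0// !normrM -mulrA ler_wpM2l//.
  rewrite (@ger0_norm _ 2^-1) ?invr_ge0//.
  by have := normr_ge0 n; lra.
rewrite /Kd; have := B_ge0 n; nra.
Qed.

Lemma is_derive_sol_time (x t : R) : 0 < t < T ->
  is_derive t 1 (sol x) (2 * rsynth (Udot t) x).
Proof.
move=> tT; apply: is_derive_2M.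
apply: (@is_derive_under_integral _ (fun s n => Re (U s n * cis (n * x)))
  (fun s n => Re (Udot s n * cis (n * x))) (fun n => Kd * B n) t 0 T tT).
- by move=> s _; exact: integrable_synth (cL1_U s).
- move=> s n sT; have [d1 d2] := dU n sT.
  have -> : (fun s : R => Re (U s n * cis (n * x))) =
      (fun s => cos (n * x) *: Re (U s n)) - (fun s => sin (n * x) *: Im (U s n)).
    by apply/funext => y; rewrite cReM/= mulrC [X in _ - X]mulrC.
  have h1 := @is_deriveZ _ _ _ _ (cos (n * x)) _ _ _ d1.
  have h2 := @is_deriveZ _ _ _ _ (sin (n * x)) _ _ _ d2.
  have -> : Re (Udot s n * cis (n * x)) = cos (n * x) *: Re (Udot s n) - sin (n * x) *: Im (Udot s n).
    by rewrite cReM/= mulrC [X in _ - X]mulrC.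
  exact: (@is_deriveB _ _ _ _ _ _ _ _ _ h1 h2).
- exact: intZl.
- move=> s n _; rewrite (le_trans (norm_Re_le _))// normc_Mcis; exact: normc_Udot_le.
Qed.

(** The equation at the level of symbols: every term is a multiple of a mode of
    [U t] or of [C t]. *)
Lemma Udot_modes t x : rsynth (Udot t) x =
  (2 * eps)^-1 * rsynth (dx (U t)) x - A / (2 * eps) * rsynth (hil (U t)) x
  - beta / (2 * eps) * rsynth (hil (dx (dx (U t)))) x + A / 2 * rsynth (dx (hil (C t))) x.
Proof.
have k1 := cL1_dxU t; have k2 : cL1 (hil (U t)) by exact: cL1Z (cL1_U t).
have k3 : cL1 (hil (dx (dx (U t)))) by exact: cL1Z (cL1_dxdxU t).
have k4 : cL1 (dx (hil (C t))).
  have -> : dx (hil (C t)) = (fun n => (0 -i* 1) * dx (C t) n).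
    by apply/funext => n; rewrite /hil /dx mulrCA.
  exact: cL1Z (cL1_dxC t).
have z1 := cL1Z ((2 * eps)^-1 +i* 0) k1; have z2 := cL1Z ((- (A / (2 * eps))) +i* 0) k2.
have z3 := cL1Z ((- (beta / (2 * eps))) +i* 0) k3; have z4 := cL1Z ((A / 2) +i* 0) k4.
have e0 : 2 * eps != 0 by rewrite mulf_neq0// gt_eqF.
have -> : Udot t = (fun n => ((((2 * eps)^-1 +i* 0) * dx (U t) n +
   ((- (A / (2 * eps))) +i* 0) * hil (U t) n) +
   ((- (beta / (2 * eps))) +i* 0) * hil (dx (dx (U t))) n) +
   ((A / 2) +i* 0) * dx (hil (C t)) n).
  apply/funext => n; rewrite /Udot /hil /dx /dispersion.
  case: (U t n) => a b; case: (C t n) => c d.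
  by apply: cReP; rewrite !cReE/=; field; rewrite gt_eqF.
have z12 := cL1D z1 z2; have z123 := cL1D z12 z3.
rewrite (rsynthD x z123 z4) (rsynthD x z12 z3) (rsynthD x z1 z2).
by rewrite !rsynthZ// !mulNr.
Qed.

Lemma wave_eq_sol x t : 0 < t < T -> wave_eq_at eps A beta sol x t.
Proof.
move=> tT; have ht := is_derive_sol_time x tT.
have z2 n : n <= 0 -> dx (dx (U t)) n = 0 by move=> n0; rewrite /dx U0// !mulr0.
have [hh2 e2] := has_hilbert_2rsynth x (cL1_dxdxU t) z2.
split.
- by case: ht.
- by move=> y; split; [case: (is_derive_sol y t)|case: (is_derive_sol2 y t)].
- split; first by move=> y; have [h _] := has_hilbert_2rsynth y (cL1_U t) (U0 t).
  by rewrite derive2_sol.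
- by case: (is_derive_hilbert_sol_mul x t).
have e3 : derive1 (fun y => hilbert (sol^~ t) y * sol y t) x = 2 * rsynth (dx (hil (C t))) x.
  by have h := is_derive_hilbert_sol_mul x t; rewrite derive1E; exact: derive_val.
have e4 : derive1 (sol x) t = 2 * rsynth (Udot t) x by rewrite derive1E; exact: derive_val.
rewrite derive2_sol e2 e3 e4 hilbert_sol derive1_sol Udot_modes.
move: (rsynth _ _) (rsynth _ _) (rsynth _ _) (rsynth _ _) => a b c d.
by field; rewrite gt_eqF.
Qed.

Lemma normc_cisB (a b : R) : normc (cis a - cis b) <= 2 * `|a - b|.
Proof.
apply: (le_trans (normc_le_sum _)); rewrite cReB cImB/=.
by have := lipschitz_cos a b; have := lipschitz_sin a b; lra.
Qed.

Lemma sol_lipschitz x t x' t' : `|sol x t - sol x' t'| <=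
  4 * (\int[mu]_n B n) * `|x - x'| + 2 * (\int[mu]_n B n) * `|t - t'|.
Proof.
have i1 := integrable_synth x (cL1_U t); have i2 := integrable_synth x' (cL1_U t').
rewrite /sol -mulrBr normrM (@ger0_norm _ 2)//.
have -> : 4 * (\int[mu]_n B n) * `|x - x'| + 2 * (\int[mu]_n B n) * `|t - t'| =
   2 * ((2 * `|x - x'| + `|t - t'|) * \int[mu]_n B n) by ring.
rewrite ler_pM2l// /rsynth -RintegralB//.
apply: (le_trans (le_normr_Rintegral measurableT (intB measurableT i1 i2))).
rewrite -RintegralZl//; apply: le_Rintegral => //.
- exact: integrable_norm (intB measurableT i1 i2).
- exact: intZl.
move=> n _; rewrite -cReB; apply: (le_trans (norm_Re_le _)).
have -> : U t n * cis (n * x) - U t' n * cis (n * x') =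
  (U t n - U t' n) * cis (n * x) + U t' n * (cis (n * x) - cis (n * x')) by ring.
apply: (le_trans (normcD _ _)); rewrite normc_Mcis Normc.normcM.
have h1 := Ulip t' t n.
have h2 : normc (U t' n) * normc (cis (n * x) - cis (n * x')) <= 2 * `|x - x'| * B n.
  apply: (@le_trans _ _ (normc (U t' n) * (2 * `|n * x - n * x'|))).
    by apply: ler_wpM2l; [exact: normc_ge0|exact: normc_cisB].
  rewrite -mulrBr normrM.
  have -> : normc (U t' n) * (2 * (`|n| * `|x - x'|)) = 2 * `|x - x'| * (`|n| * normc (U t' n)) by ring.
  rewrite ler_wpM2l ?mulr_ge0// -[leRHS]mul1r; apply: poly_U_le => //.
  by rewrite mul1r norm_le_pow3.
by rewrite mulrDl addrC [_ * B n as X in _ <= _ + X]mulrC; exact: lerD.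
Qed.

Lemma continuous_sol : continuous (fun p : R * R => sol p.1 p.2).
Proof.
move=> p; set K := \int[mu]_n B n.
have h : 4 * K * `|p.1 - q.1| + 2 * K * `|p.2 - q.2| @[q --> p] --> (0 : R).
  have -> : (0 : R) = 4 * K * `|p.1 - p.1| + 2 * K * `|p.2 - p.2|.
    by rewrite !subrr !normr0 !mulr0 addr0.
  apply: cvgD; apply: cvgMr; apply: cvg_norm; apply: cvgB; try exact: cvg_cst.
    exact: cvg_fst.
  exact: cvg_snd.
apply/cvgrPdist_le => e e0; near=> q.
apply: (le_trans (sol_lipschitz _ _ _ _)); near: q.
by move/cvgrPdist_le : h => /(_ e e0); apply: filterS => q; rewrite sub0r normrN => /(le_trans (ler_norm _)).
Unshelve. all: by end_near. Qed.

End mode_evolution.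

(** * Fourier and Hartley transforms *)

Section fourier_transform.
Local Open Scope complex_scope.
Context {R : realType}.
Local Notation mu := (@lebesgue_measure R).
Local Notation Re := (@complex.Re R).
Local Notation Im := (@complex.Im R).
Local Notation normc := Normc.normc.
Implicit Types (f V W : R -> R) (g : R -> R[i]).

(** The Fourier transform recovered from the Hartley transform: the cosine
    integral is its even part and the sine integral its odd part. *)
Definition hat V n : R[i] := ((V n + V (- n)) / (4 * pi)) -i* ((V n - V (- n)) / (4 * pi)).

Lemma Rintegral_cut f (phi : R -> R) N :
  \int[mu]_(x in `[- N, N]) (f x * phi x) = \int[mu]_x (cut f N x * phi x).
Proof.
rewrite Rintegral_mkcond; apply: eq_Rintegral => x _; rewrite patchE /cut indicE.
by case: ifPn => _; rewrite ?mulr1// mulr0 mul0r.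
Qed.

Lemma fourier_truncE f N n : sqint mu f -> fourier_trunc f N n = hat (hartley (cut f N)) n.
Proof.
move=> sf; have ic := integrable_cut N sf; have p0 := pi_gt0 R.
have i1 := integrable_hartley_integrand n ic; have i2 := integrable_hartley_integrand (- n) ic.
have eC : hartley (cut f N) n + hartley (cut f N) (- n) =
    2 * \int[mu]_x (cut f N x * cos (n * x)).
  rewrite /hartley -RintegralD// -RintegralZl//; last first.
    apply: (integrable_mul_bounded ic); last by move=> x; exact: norm_cos_le1.
    by under eq_fun do rewrite mulrC; exact: measurable_cosM.
  apply: eq_Rintegral => x _; rewrite /cas mulrN cosN sinN (mulrC n x); ring.
have eS : hartley (cut f N) n - hartley (cut f N) (- n) =
    2 * \int[mu]_x (cut f N x * sin (n * x)).
  rewrite /hartley -RintegralB// -RintegralZl//; last first.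
    apply: (integrable_mul_bounded ic); last by move=> x; exact: norm_sin_le1.
    by under eq_fun do rewrite mulrC; exact: measurable_sinM.
  apply: eq_Rintegral => x _; rewrite /cas mulrN cosN sinN (mulrC n x); ring.
have p1 : pi != 0 :> R by rewrite gt_eqF.
by apply: cReP; rewrite /fourier_trunc /hat/= ?eC ?eS Rintegral_cut; move: (pi : R) p1 => p p1; field.
Qed.

Lemma normc_hatB V W n : normc (hat V n - hat W n) ^+ 2 =
  (8 * pi ^+ 2)^-1 * ((V n - W n) ^+ 2 + (V (- n) - W (- n)) ^+ 2).
Proof.
have p1 : pi != 0 :> R by rewrite gt_eqF ?pi_gt0.
by rewrite sqr_normcE /hat/=; move: (pi : R) p1 => p p1; field.
Qed.

Lemma cmeasurable_hat V : measurable_fun setT V -> cmeasurable (hat V).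
Proof.
move=> mV; have mN : measurable_fun setT (fun n : R => V (- n)) by apply: measurableT_comp.
split => /=.
  by apply: measurable_funM => //; exact: measurable_funD.
apply: measurableT_comp => //; apply: measurable_funM => //; exact: measurable_funB.
Qed.

Lemma integral_normc_hatB V W : sqint mu (fun n => V n - W n) ->
  (\int[mu]_n (normc (hat V n - hat W n) ^+ 2)%:E =
   ((4 * pi ^+ 2)^-1 * \int[mu]_n ((V n - W n) ^+ 2))%:E)%E.
Proof.
move=> [mD iDD]; pose D n := (V n - W n) ^+ 2.
have {}mD : measurable_fun setT D by exact: measurable_funX.
have {}iDD : mu.-integrable setT (EFin \o D) by [].
have iDN : mu.-integrable setT (EFin \o (fun n => D (- n))).
  by have := integrable_reflect 0 iDD; apply: eq_integrable => // n _ /=; rewrite sub0r.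
have eN : \int[mu]_n D (- n) = \int[mu]_n D n by apply: Rintegral_oppr.
transitivity (\int[mu]_n ((8 * pi ^+ 2)^-1 * (D n + D (- n)))%:E)%E.
  by apply: eq_integral => n _; rewrite normc_hatB.
have iS : mu.-integrable setT (EFin \o (fun n => D n + D (- n))) by exact: intD.
have iS8 := intZl (8 * pi ^+ 2)^-1 measurableT iS.
rewrite -[LHS]fineK; last exact: integrable_fin_num.
rewrite -/(Rintegral mu setT (fun n => (8 * pi ^+ 2)^-1 * (D n + D (- n)))).
rewrite (RintegralZl (8 * pi ^+ 2)^-1 measurableT iS) (RintegralD measurableT iDD iDN) eN.
congr EFin; have p1 : pi != 0 :> R by rewrite gt_eqF ?pi_gt0.
rewrite /D; move: (Rintegral _ _ _) => I; move: (pi : R) p1 => p p1; by field.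
Qed.

Lemma hartley_lim_fourier f V : sqint mu f -> hartley_lim f V -> is_fourier f (hat V).
Proof.
move=> sf [sV cV]; have [mV _] := sV; have [h1 h2] := cmeasurable_hat mV.
split => //.
have e N : (\int[mu]_n (normc (hat V n - fourier_trunc f N n) ^+ 2)%:E =
    ((4 * pi ^+ 2)^-1 * \int[mu]_n ((V n - hartley (cut f N) n) ^+ 2))%:E)%E.
  rewrite -integral_normc_hatB; last exact: sqintB sV (sqint_hartley_cut N sf).
  by apply: eq_integral => n _; rewrite (fourier_truncE N n sf).
rewrite (funext e); apply: cvg_EFin; first exact: nearW.
rewrite /= -[X in _ --> X](mulr0 (4 * pi ^+ 2)^-1); exact: cvgMr.
Qed.

(** [cas = cos + sin] while [e^{- i n x} = cos - i sin], so [Re - Im] of the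
    Fourier transform is the Hartley transform, up to [2 * pi]. *)
Lemma fourier_hartley_lim f g : sqint mu f -> is_fourier f g ->
  hartley_lim f (fun n => 2 * pi * (Re (g n) - Im (g n))).
Proof.
move=> sf [m1 m2 cg]; set V := fun n => _.
have mV : measurable_fun setT V.
  by apply: measurable_funM => //; exact: measurable_funB.
pose E N : \bar R := (\int[mu]_n (normc (g n - fourier_trunc f N n) ^+ 2)%:E)%E.
have TN N n : V n - hartley (cut f N) n =
    2 * pi * (Re (g n - fourier_trunc f N n) - Im (g n - fourier_trunc f N n)).
  have p1 : pi != 0 :> R by rewrite gt_eqF ?pi_gt0.
  by rewrite (fourier_truncE N n sf) cReB cImB /hat/= /V; move: (hartley _ _) (hartley _ _) (pi : R) p1 => a b p p1; field.
have dN N n : (V n - hartley (cut f N) n) ^+ 2 <=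
    8 * pi ^+ 2 * normc (g n - fourier_trunc f N n) ^+ 2.
  rewrite TN sqr_normcE; move: (Re _) (Im _) => a b.
  have := sqr_ge0 (a + b); have := sqr_ge0 (pi : R); move: (pi : R) => p.
  have := sqr_ge0 (p * (a + b)); rewrite !exprMn; nra.
have mg : cmeasurable g by split.
have mtr N : cmeasurable (fourier_trunc f N).
  have mh : measurable_fun setT (hartley (cut f N)) by case: (sqint_hartley_cut N sf).
  by have := cmeasurable_hat mh; rewrite (_ : hat _ = fourier_trunc f N)//; apply/funext => n; rewrite fourier_truncE.
have mD N : measurable_fun setT (fun n => normc (g n - fourier_trunc f N n) ^+ 2).
  apply: measurable_funX; apply: measurable_normc.
  have := cmeasurableD mg (cmeasurableM (cmeasurable_cst _ (-1)) (mtr N)).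
  by under eq_fun do rewrite mulN1r.
have mVh N : measurable_fun setT (fun n => V n - hartley (cut f N) n).
  by apply: measurable_funB => //; case: (sqint_hartley_cut N sf).
have fin N : (E N < +oo)%E -> sqint mu (fun n => V n - hartley (cut f N) n) /\
    \int[mu]_n ((V n - hartley (cut f N) n) ^+ 2) <= 8 * pi ^+ 2 * fine (E N).
  move=> EN; have iD : mu.-integrable setT (EFin \o (fun n => normc (g n - fourier_trunc f N n) ^+ 2)).
    apply/integrableP; split; first exact: ((measurable_EFinP _ _).2 (mD N)).
    by under eq_integral do rewrite /= ger0_norm ?sqr_ge0//.
  have iV : mu.-integrable setT (EFin \o (fun n => (V n - hartley (cut f N) n) ^+ 2)).
    apply: (integrable_dominated measurableT _ (intZl (8 * pi ^+ 2) measurableT iD)).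
      exact: (measurable_funX 2 (mVh N)).
    by move=> n _; rewrite ger0_norm ?sqr_ge0.
  split; first by split; [exact: mVh|exact: iV].
  rewrite -[fine (E N)]/(\int[mu]_n (normc (g n - fourier_trunc f N n) ^+ 2)) -RintegralZl//.
  by apply: le_Rintegral => //; exact: intZl.
have nfin : \forall N \near +oo, (E N < +oo)%E.
  have := cg; move/fine_cvgP => [h _]; apply: filterS h => N.
  by rewrite ge0_fin_numE// integral_ge0// => n _; rewrite lee_fin sqr_ge0.
split.
  have [N /fin[s1 _]] := filter_ex nfin.
  have := sqintD s1 (sqint_hartley_cut N sf).
  by under [X in sqint _ X]eq_fun do rewrite subrK.
have /fine_cvgP[_ cf] := cg.
apply: (@squeeze_cvgr _ _ _ _ (fun=> 0) (fun N => 8 * pi ^+ 2 * fine (E N))).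
- by apply: filterS nfin => N /fin[_ ->]; rewrite andbT sqint_sq_ge0.
- exact: cvg_cst.
- rewrite -[X in _ --> X](mulr0 (8 * pi ^+ 2)); exact: cvgMr.
Qed.

(** Compare both candidates with the same truncated transforms. *)
Lemma is_fourier_unique f g g' : sqint mu f -> is_fourier f g -> is_fourier f g' ->
  {ae mu, forall n, g n = g' n}.
Proof.
move=> sf [m1 m2 cg] [m1' m2' cg'].
have mg : cmeasurable g by split. have mg' : cmeasurable g' by split.
have mtr N : cmeasurable (fourier_trunc f N).
  have mh : measurable_fun setT (hartley (cut f N)) by case: (sqint_hartley_cut N sf).
  by have := cmeasurable_hat mh; rewrite (_ : hat _ = fourier_trunc f N)//; apply/funext => n; rewrite fourier_truncE.
have mB (a b : R -> R[i]) : cmeasurable a -> cmeasurable b ->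
    measurable_fun setT (fun n => normc (a n - b n) ^+ 2).
  move=> ma mb; apply: measurable_funX; apply: measurable_normc.
  have := cmeasurableD ma (cmeasurableM (cmeasurable_cst _ (-1)) mb).
  by under eq_fun do rewrite mulN1r.
have le0 : (\int[mu]_n (normc (g n - g' n) ^+ 2)%:E <= 0)%E.
  pose F N := (2%:E * \int[mu]_n (normc (g n - fourier_trunc f N n) ^+ 2)%:E +
    2%:E * \int[mu]_n (normc (g' n - fourier_trunc f N n) ^+ 2)%:E)%E.
  have cF : F N @[N --> +oo] --> 0%E.
    rewrite -[X in _ --> X](adde0 0%E); apply: cvgeD => //.
      by rewrite -[X in _ --> X](mule0 2%:E); exact: cvgeZl.
    by rewrite -[X in _ --> X](mule0 2%:E); exact: cvgeZl.
  apply: (cvge_to_ge cF); apply: nearW => N.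
  rewrite /F -!ge0_integralZl//; last 4 first.
  - by apply/measurable_EFinP; exact: mB.
  - by move=> n _; rewrite lee_fin sqr_ge0.
  - by apply/measurable_EFinP; exact: mB.
  - by move=> n _; rewrite lee_fin sqr_ge0.
  rewrite -ge0_integralD//; last 4 first.
  - by move=> n _; rewrite -EFinM lee_fin mulr_ge0// sqr_ge0.
  - by apply/measurable_EFinP; apply: measurable_funM => //; exact: mB.
  - by move=> n _; rewrite -EFinM lee_fin mulr_ge0// sqr_ge0.
  - by apply/measurable_EFinP; apply: measurable_funM => //; exact: mB.
  apply: ge0_le_integral => //.
  - by move=> n _; rewrite lee_fin sqr_ge0.
  - by apply/measurable_EFinP; exact: mB.
  - by apply: emeasurable_funD; apply/measurable_EFinP; apply: measurable_funM => //; exact: mB.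
  move=> n _; rewrite -!EFinM -EFinD lee_fin.
  have -> : g n - g' n = (g n - fourier_trunc f N n) - (g' n - fourier_trunc f N n).
    by rewrite opprB addrA subrK.
  have := normcB (g n - fourier_trunc f N n) (g' n - fourier_trunc f N n).
  set a := normc (_ - (_ - _)); set b := normc (g n - _); set c := normc (g' n - _) => abc.
  have a0 : 0 <= a by exact: normc_ge0.
  have : a ^+ 2 <= (b + c) ^+ 2 by rewrite ler_sqr ?nnegrE// (le_trans a0).
  by have := sqr_ge0 (b - c); rewrite !expr2; move: a b c a0 abc => a b c; nra.
have m0 := mB _ _ mg mg'.
have : (\int[mu]_n (`|(normc (g n - g' n) ^+ 2)%:E|) = 0)%E.
  under eq_integral do rewrite gee0_abs ?lee_fin ?sqr_ge0//.
  by apply/eqP; rewrite eq_le le0 integral_ge0// => n _; rewrite lee_fin sqr_ge0.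
move=> /(ae_eq_integral_abs mu measurableT ((measurable_EFinP _ _).2 m0)) h.
apply: (leb_aeS h) => n /(_ Logic.I) /= [] /eqP.
by rewrite sqrf_eq0 => /eqP /Normc.eq0_normc /subr0_eq.
Qed.

(** Existence is that of the Hartley transform. *)
Lemma fourierP f : sqint mu f -> is_fourier f (fourier f).
Proof.
move=> sf; have [V [sV [_ cV]]] := hartley_L2 sf.
have h : is_fourier f (hat V) by exact: hartley_lim_fourier.
rewrite /fourier; exact: (@xgetPex _ (fun=> 0) [set g | is_fourier f g] (ex_intro _ _ h)).
Qed.

Lemma Lfun_sqint f : (f \in Lfun mu 2%:E) <-> sqint mu f.
Proof.
split=> [Lf|[mf iF]].
  split; last exact: Lfun2_integrable_sqr.
  by move: Lf; rewrite inE => /andP[+ _]; rewrite inE.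
rewrite inE; apply/andP; split; first by rewrite inE.
rewrite inE /= /finite_norm unlock /=.
apply: poweR_lty.
rewrite (_ : (\int[mu]_x _)%E = (\int[mu]_x (f x ^+ 2)%:E)%E); last first.
  apply: eq_integral => x _ /=.
  by rewrite powR_mulrn// real_normK ?num_real.
by have /integrableP[_] := iF; under eq_integral do rewrite /= ger0_norm ?sqr_ge0//.
Qed.

End fourier_transform.

(** * The spectrum of a synthesis and the initial modes *)

Section synthesis_spectrum.
Local Open Scope complex_scope.
Context {R : realType}.
Local Notation mu := (@lebesgue_measure R).
Local Notation Re := (@complex.Re R).
Local Notation Im := (@complex.Im R).
Local Notation normc := Normc.normc.
Implicit Types (U : R -> R[i]).

(** The Hartley density of [2 Re F]: the modes, given on one half line, are
    unfolded to a real density on the whole line. *)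
Definition density U n : R := (Re (U n) - Im (U n)) + (Re (U (- n)) + Im (U (- n))).

Lemma cL1_parts U : cL1 U -> mu.-integrable setT (EFin \o (fun n => Re (U n))) /\
  mu.-integrable setT (EFin \o (fun n => Im (U n))).
Proof. by move=> [mU iU]; exact: (leb_integrable_parts measurableT mU iU (fun n _ => lexx _)). Qed.

Lemma integrable_opp (f : R -> R) : mu.-integrable setT (EFin \o f) ->
  mu.-integrable setT (EFin \o (fun n => f (- n))).
Proof.
move=> iF; have := integrable_reflect 0 iF.
by apply: eq_integrable => // n _ /=; rewrite sub0r.
Qed.

Lemma integrable_density U : cL1 U -> mu.-integrable setT (EFin \o density U).
Proof.
move=> /cL1_parts[ia ib]; have iab := intB measurableT ia ib.
exact: (intD measurableT iab (integrable_opp (intD measurableT ia ib))).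
Qed.

Lemma rsynth_hartley U x : cL1 U -> 2 * rsynth U x = hartley (density U) x.
Proof.
move=> U1; have [ia ib] := cL1_parts U1.
have iab := intB measurableT ia ib; have iab' := intD measurableT ia ib.
have j1 := integrable_hartley_integrand x iab.
have j2 := integrable_hartley_integrand x (integrable_opp iab').
have j3 := integrable_hartley_integrand (- x) iab'.
have e2 : \int[mu]_n ((Re (U (- n)) + Im (U (- n))) * cas (n * x)) =
    \int[mu]_n ((Re (U n) + Im (U n)) * cas (n * - x)).
  rewrite -[RHS]Rintegral_oppr; last exact: integrable_measurable j3.
  by apply: eq_Rintegral => n _; rewrite mulrNN.
rewrite /hartley /density.
under [in RHS]eq_Rintegral do rewrite mulrDl.
rewrite RintegralD// e2 -RintegralD// /rsynth -RintegralZl//; last exact: integrable_synth.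
by apply: eq_Rintegral => n _; rewrite cReM /cas mulrN cosN sinN/=; ring.
Qed.

Lemma sqint_parts U : cmeasurable U -> sqint mu (fun n => normc (U n)) ->
  sqint mu (fun n => Re (U n)) /\ sqint mu (fun n => Im (U n)).
Proof.
move=> [m1 m2] s; split.
- by apply: (sqint_le m1 s) => n; rewrite (ger0_norm (normc_ge0 _)) norm_Re_le.
- by apply: (sqint_le m2 s) => n; rewrite (ger0_norm (normc_ge0 _)) norm_Im_le.
Qed.

Lemma sqint_opp (f : R -> R) : sqint mu f -> sqint mu (fun n => f (- n)).
Proof.
move=> [mf iF]; split; last exact: integrable_opp iF.
exact: measurableT_comp.
Qed.

Lemma sqint_density U : cmeasurable U -> sqint mu (fun n => normc (U n)) -> sqint mu (density U).
Proof.
move=> mU sU; have [s1 s2] := sqint_parts mU sU.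
by apply: sqintD; [exact: sqintB|exact: (sqint_opp (sqintD s1 s2))].
Qed.

Lemma hat_density U n : hat (fun n => 2 * pi * density U n) n =
  U n + (Re (U (- n)) -i* Im (U (- n))).
Proof.
have p1 : pi != 0 :> R by rewrite gt_eqF ?pi_gt0.
by apply: cReP; rewrite ?cReD ?cImD /hat/= /density opprK; move: (pi : R) p1 => p p1; field.
Qed.

(** By inversion, the density is the Hartley transform of the synthesis, up to
    [2 * pi]; the Fourier transform is then the Hermitian extension of [U]. *)
Lemma fourier_rsynth U : cL1 U -> sqint mu (fun n => normc (U n)) ->
  sqint mu (fun x => 2 * rsynth U x) /\
  {ae mu, forall n, fourier (fun x => 2 * rsynth U x) n = U n + (Re (U (- n)) -i* Im (U (- n)))}.
Proof.
move=> U1 sU; have [mU _] := U1.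
have -> : (fun x => 2 * rsynth U x) = hartley (density U).
  by apply/funext => x; exact: rsynth_hartley.
have id := integrable_density U1; have sd := sqint_density mU sU.
have sh := sqint_hartley id sd; split => //.
have h := hartley_lim_fourier sh (hartley_inversion id sd).
apply: (leb_aeS (is_fourier_unique sh (fourierP sh) h)) => n ->.
exact: hat_density.
Qed.

(** The Hermitian extension doubles the norm: on each half line at most one of
    its two terms is nonzero. *)
Lemma wiener_rsynth U (M : R -> R) (nu : R) : cL1 U -> sqint mu (fun n => normc (U n)) ->
  (forall n, n <= 0 -> U n = 0) -> mu.-integrable setT (EFin \o M) -> (forall n, 0 <= M n) ->
  {ae mu, forall n, expR (nu * n) * normc (U n) <= M n} ->
  wiener nu (fun x => 2 * rsynth U x) /\
  (wiener_norm nu (fun x => (2 * rsynth U x)%R) <= (2 * \int[mu]_n M n)%:E)%E.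
Proof.
move=> U1 sU U0 iM M0 UM; have [sf fE] := fourier_rsynth U1 sU.
set f := fun x => 2 * rsynth U x in sf fE *.
have [m1 m2 _] := fourierP sf.
have mg : cmeasurable (fourier f) by split.
pose w n := expR (nu * `|n|) * normc (fourier f n).
have mw : measurable_fun setT w.
  apply: measurable_funM; last exact: measurable_normc.
  apply: measurableT_comp => //; apply: measurable_funM => //.
have w0 n : 0 <= w n by rewrite mulr_ge0 ?expR_ge0 ?normc_ge0.
have iMM : mu.-integrable setT (EFin \o (fun n => M n + M (- n))).
  exact: (intD measurableT iM (integrable_opp iM)).
have eMM : \int[mu]_n (M n + M (- n)) = 2 * \int[mu]_n M n.
  rewrite RintegralD//; last exact: integrable_opp.
  rewrite Rintegral_oppr; last exact: integrable_measurable iM.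
  by rewrite mulr_natl mulr2n.
have UMN : {ae mu, forall n, expR (nu * - n) * normc (U (- n)) <= M (- n)}.
  have [N [mN N0 subN]] := UM.
  exists (-%R @^-1` N); split.
  - by rewrite -[X in measurable X]setTI; apply: (@oppr_measurable R setT).
  - have := @lebesgue_measureN R N mN; by rewrite /pushforward => ->.
  - by move=> n /= h; apply: subN => /= h'; apply: h.
have wM : {ae mu, forall n, w n <= M n + M (- n)}.
  apply: (leb_aeS (leb_aeI fE (leb_aeI UM UMN))) => n [e [h1 h2]].
  rewrite /w e; have [n0|n0] := ltP 0 n.
    have z : U (- n) = 0 by apply: U0; rewrite oppr_le0 ltW.
    have -> : U n + (Re (U (- n)) -i* Im (U (- n))) = U n.
      by rewrite z /= oppr0; exact: addr0.
    by rewrite (gtr0_norm n0); apply: (le_trans h1); rewrite lerDl.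
  have z : U n = 0 by exact: U0.
  have -> : normc (U n + (Re (U (- n)) -i* Im (U (- n)))) = normc (U (- n)).
    by rewrite z add0r !normcE/= sqrrN.
  by rewrite (ler0_norm n0); apply: (le_trans h2); rewrite lerDr.
have lew : (\int[mu]_n (w n)%:E <= (2 * \int[mu]_n M n)%:E)%E.
  rewrite -eMM /Rintegral fineK; last exact: integrable_fin_num.
  apply: ae_ge0_le_integral => //.
  - by move=> n _; rewrite lee_fin.
  - exact/measurable_EFinP.
  - by move=> n _; rewrite lee_fin addr_ge0.
  - by have /integrableP[] := iMM.
  - by apply: (leb_aeS wM) => n h _; rewrite lee_fin.
split=> //; split; first exact/Lfun_sqint.
apply/integrableP; split; first exact/measurable_EFinP.
apply: (@le_lt_trans _ _ (\int[mu]_n (w n)%:E)%E); last first.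
  by apply: le_lt_trans lew _; rewrite ltry.
rewrite le_eqVlt; apply/orP; left; apply/eqP; apply: eq_integral => n _.
by rewrite gee0_abs// lee_fin; exact: w0.
Qed.

End synthesis_spectrum.

Section initial_data.
Local Open Scope complex_scope.
Context {R : realType}.
Local Notation mu := (@lebesgue_measure R).
Local Notation Re := (@complex.Re R).
Local Notation Im := (@complex.Im R).
Local Notation normc := Normc.normc.

(** The modes are read off from [h = Re - Im] of the given Fourier transform,
    which is [(2 * pi)^-1] times the Hartley transform of [f0].  Their modulus
    is bounded by the sum of the moduli at [n] and [- n], whence a weighted
    mass at most the norm of [f0] over the whole line. *)
Lemma initial_modes (f0 : R -> R) : wiener 1 f0 -> exists g0 : R -> R[i],
  [/\ cL1 g0, sqint mu (fun n => normc (g0 n)), forall n, n <= 0 -> g0 n = 0,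
      (\int[mu]_n (expR n * normc (g0 n))%:E <= wiener_norm 1 f0)%E &
      {ae mu, forall x, 2 * rsynth g0 x = f0 x}].
Proof.
move=> [/Lfun_sqint sf iw]; have hF := fourierP sf; have [m1 m2 _] := hF.
have [sV cV] := fourier_hartley_lim sf hF.
set G := fourier f0 in iw hF m1 m2 sV cV *.
have mG : cmeasurable G by split.
pose h n := Re (G n) - Im (G n).
pose E n := expR `|n| * normc (G n).
have E0 n : 0 <= E n by rewrite mulr_ge0 ?expR_ge0 ?normc_ge0.
have iE : mu.-integrable setT (EFin \o E).
  by apply: eq_integrable iw => // n _ /=; rewrite mul1r.
have GE n : normc (G n) <= E n.
  by rewrite ler_peMl ?normc_ge0// -[leLHS]expR0 ler_expR.
have mh : measurable_fun setT h by exact: measurable_funB.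
have hE n : `|h n| <= 2 * E n.
  rewrite (le_trans (ler_normB _ _))//.
  by have := norm_Re_le (G n); have := norm_Im_le (G n); have := GE n; lra.
have ih : mu.-integrable setT (EFin \o h).
  by apply: (integrable_dominated measurableT _ (intZl 2 measurableT iE)).
have sh : sqint mu h.
  have := sqintZ (2 * pi)^-1 sV; congr sqint; apply/funext => n.
  by rewrite mulrA mulVf ?mul1r// mulf_neq0 ?gt_eqF ?pi_gt0.
have rec := hartley_recover sf ih sh (conj sV cV).
pose P : set R := [set n | 0 < n].
have mP : measurable P by exact: measurable_pos.
pose hg n : R[i] := ((h n + h (- n)) / 2) -i* ((h n - h (- n)) / 2).
pose g0 n : R[i] := (\1_P n +i* 0) * hg n.
have mhN : measurable_fun setT (fun n : R => h (- n)) by exact: measurableT_comp.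
have mhg : cmeasurable hg.
  apply: cmeasurable_pair.
    by apply: measurable_funM => //; exact: measurable_funD.
  by apply: measurableT_comp => //; apply: measurable_funM => //; exact: measurable_funB.
have mg0 : cmeasurable g0.
  by apply: cmeasurableM => //; apply: cmeasurable_real; exact: measurable_indic.
have g0pos n : 0 < n -> g0 n = hg n.
  by move=> n0; rewrite /g0 indicE mem_set//; exact: mul1r.
have g0neg n : n <= 0 -> g0 n = 0.
  by move=> n0; rewrite /g0 indicE memNset//; [exact: mul0r|rewrite /P/= ltNge n0].
have sqhg n : normc (hg n) ^+ 2 = (h n ^+ 2 + h (- n) ^+ 2) / 2.
  by rewrite sqr_normcE /hg/=; field.
have hgG n : normc (hg n) <= normc (G n) + normc (G (- n)).
  rewrite -(@ler_sqr R) ?nnegrE ?addr_ge0 ?normc_ge0// sqhg.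
  have hh k : h k ^+ 2 <= 2 * normc (G k) ^+ 2.
    by rewrite sqr_normcE /h; have := sqr_ge0 (Re (G k) + Im (G k)); rewrite !expr2; nra.
  have := hh n; have := hh (- n); have := mulr_ge0 (normc_ge0 (G n)) (normc_ge0 (G (- n))).
  by rewrite sqrrD; lra.
have g0le n : normc (g0 n) <= normc (hg n).
  have [n0|n0] := ltP 0 n; first by rewrite g0pos.
  by rewrite g0neg// normc_0 normc_ge0.
have g0E n : normc (g0 n) <= E n + E (- n).
  by apply: (le_trans (g0le n)); apply: (le_trans (hgG n)); apply: lerD.
have g01 : cL1 g0.
  exact: (cL1_dominated mg0 (intD measurableT iE (integrable_opp iE)) g0E).
exists g0; split => //.
- have s2 : sqint mu (fun n => `|h n| + `|h (- n)|).
    have sN (k : R -> R) : sqint mu k -> sqint mu (fun n => `|k n|).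
      move=> sk; have [mk _] := sk; apply: (sqint_le _ sk); first exact: measurableT_comp.
      by move=> n; rewrite normr_id.
    by apply: sqintD; apply: sN => //; exact: sqint_opp.
  apply: (sqint_le _ s2); first exact: measurable_normc.
  move=> n; rewrite (ger0_norm (normc_ge0 _)) ger0_norm ?addr_ge0//.
  apply: (le_trans (g0le n)); rewrite -(@ler_sqr R) ?nnegrE ?addr_ge0 ?normc_ge0// sqhg.
  move: (h n) (h (- n)) => a b; rewrite sqrrD !real_normK ?num_real//.
  have := mulr_ge0 (normr_ge0 a) (normr_ge0 b).
  by have := sqr_ge0 a; have := sqr_ge0 b; lra.
- pose k n := \1_P n * (E n + E (- n)).
  have iEE := intD measurableT iE (integrable_opp iE).
  have i1 (e : R -> R) : mu.-integrable setT (EFin \o e) -> mu.-integrable setT (EFin \o (fun n => \1_P n * e n)).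
    move=> ie; have me := integrable_measurable ie.
    apply: (integrable_dominated measurableT _ (integrable_norm ie)).
      by apply: measurable_funM => //; exact: measurable_indic.
    move=> n _; rewrite indicE normrM; case: (_ \in _); rewrite ?normr1 ?mul1r ?normr0 ?mul0r//=.
  have -> : wiener_norm 1 f0 = (\int[mu]_n E n)%:E.
    rewrite /wiener_norm /Rintegral fineK; last exact: integrable_fin_num.
    by apply: eq_integral => n _; rewrite mul1r.
  apply: (@le_trans _ _ (\int[mu]_n k n)%:E); last first.
    rewrite lee_fin /k; under eq_Rintegral do rewrite mulrDr.
    have iN : mu.-integrable setT (EFin \o (fun n => \1_P (- n) * E n)).
      by have := integrable_opp (i1 _ (integrable_opp iE)); apply: eq_integrable => // n _ /=; rewrite opprK.
    rewrite RintegralD//; [|exact: i1|exact: (i1 _ (integrable_opp iE))].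
    have -> : \int[mu]_n (\1_P n * E (- n)) = \int[mu]_n (\1_P (- n) * E n).
      rewrite -[RHS]Rintegral_oppr; last exact: integrable_measurable iN.
      by apply: eq_Rintegral => n _; rewrite opprK.
    rewrite -RintegralD//; last exact: i1.
    apply: le_Rintegral => //; first by apply: intD => //; exact: i1.
    move=> n _; rewrite -mulrDl ler_piMl// !indicE.
    have [n0|n0] := ltP 0 n.
      by rewrite [_ \in _]mem_set// [(- n) \in _]memNset ?addr0//= /P/= oppr_gt0 ltNge ltW.
    by rewrite [n \in _]memNset ?add0r; [case: (_ \in _)|rewrite /P/= ltNge n0].
  have ik := i1 _ iEE.
  rewrite /Rintegral fineK; last exact: integrable_fin_num.
  apply: ge0_le_integral => //.
  + by move=> n _; rewrite lee_fin mulr_ge0 ?expR_ge0 ?normc_ge0.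
  + apply/measurable_EFinP; apply: measurable_funM; last exact: measurable_normc.
    exact: measurable_expR.
  + by have /integrableP[] := ik.
  move=> n _; rewrite lee_fin /k indicE; have [n0|n0] := ltP 0 n; last first.
    by rewrite g0neg// normc_0 mulr0 mulr_ge0// addr_ge0.
  rewrite mem_set// mul1r g0pos// /E normrN (gtr0_norm n0) -mulrDr.
  by rewrite ler_wpM2l ?expR_ge0.
apply: (leb_aeS rec) => x ->; rewrite rsynth_hartley//.
have id := integrable_density g01.
apply: (@Rintegral_eq_except _ _ _ 0).
- exact: integrable_measurable (integrable_hartley_integrand x id).
- exact: integrable_measurable (integrable_hartley_integrand x ih).
move=> n n0; congr (_ * _); rewrite /density.
have [np|nn] := ltP 0 n.
  rewrite g0pos// (g0neg (- n)) ?oppr_le0 ?(ltW np)//= /hg/=; by field.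
have nN : 0 < - n by rewrite oppr_gt0 lt_neqAle n0.
by rewrite g0neg// g0pos// /hg/= opprK; field.
Qed.

End initial_data.

(** * Existence of the modes and of the solution *)

Section construction.
Local Open Scope complex_scope.
Context {R : realType}.
Local Notation mu := (@lebesgue_measure R).
Local Notation Re := (@complex.Re R).
Local Notation Im := (@complex.Im R).
Local Notation normc := Normc.normc.

Lemma pow3_decay (nu : R) : 0 < nu -> exists b, 1 <= b /\
  forall n, 0 <= n -> (1 + `|n|) ^+ 3 * expR (- nu * n) <= b.
Proof.
move=> nu0; pose a := nu / 3; have a0 : 0 < a by rewrite divr_gt0.
exists ((1 + a^-1) ^+ 3); split.
  by rewrite exprn_ege1// lerDl invr_ge0 ltW.
move=> n n0; rewrite (ger0_norm n0).
have -> : expR (- nu * n) = expR (- a * n) ^+ 3.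
  by rewrite -expRM_natl /a; congr expR; field.
rewrite -exprMn; apply: lerXn2r; rewrite ?nnegrE ?mulr_ge0 ?addr_ge0 ?expR_ge0 ?invr_ge0 ?(ltW a0)//.
have h := exp_decay_bound a0 n0; rewrite mulrDl mul1r lerD//.
by rewrite -[leRHS]expR0 ler_expR mulNr oppr_le0 mulr_ge0// ltW.
Qed.

Lemma is_derive_rotation (om t : R) (V : R -> R[i]) (dV : R[i]) :
  is_derive t 1 (fun s => Re (V s)) (Re dV) -> is_derive t 1 (fun s => Im (V s)) (Im dV) ->
  is_derive t 1 (fun s => Re (cis (om * s) * V s))
    (Re ((0 +i* om) * (cis (om * t) * V t) + cis (om * t) * dV)) /\
  is_derive t 1 (fun s => Im (cis (om * s) * V s))
    (Im ((0 +i* om) * (cis (om * t) * V t) + cis (om * t) * dV)).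
Proof.
move=> h1 h2; have h3 := is_derive_cosM om t; have h4 := is_derive_sinM om t.
have k1 := @is_deriveM _ _ _ _ _ _ _ _ h3 h1; have k2 := @is_deriveM _ _ _ _ _ _ _ _ h4 h2.
have k3 := @is_deriveM _ _ _ _ _ _ _ _ h3 h2; have k4 := @is_deriveM _ _ _ _ _ _ _ _ h4 h1.
split.
- have -> : (fun s : R => Re (cis (om * s) * V s)) =
    ((fun y : R => cos (om * y)) * (fun s => Re (V s)) - (fun y : R => sin (om * y)) * (fun s => Im (V s))).
    by apply/funext => s; rewrite cReM.
  have k := @is_deriveB _ _ _ _ _ _ _ _ _ k1 k2.
  apply: (@is_derive_eq _ _ _ _ _ _ _ _ k).
  by rewrite /GRing.scale/= !cReE/=; ring.
- have -> : (fun s : R => Im (cis (om * s) * V s)) =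
    ((fun y : R => cos (om * y)) * (fun s => Im (V s)) + (fun y : R => sin (om * y)) * (fun s => Re (V s))).
    by apply/funext => s; rewrite cImM.
  have k := @is_deriveD _ _ _ _ _ _ _ _ _ k3 k4.
  apply: (@is_derive_eq _ _ _ _ _ _ _ _ k).
  by rewrite /GRing.scale/= !cReE/=; ring.
Qed.

End construction.

Section solution.
Local Open Scope complex_scope.
Context {R : realType}.
Local Notation mu := (@lebesgue_measure R).
Local Notation Re := (@complex.Re R).
Local Notation Im := (@complex.Im R).
Local Notation normc := Normc.normc.
Variables (eps A beta T m lam : R) (g0 : R -> R[i]).
Hypothesis eps0 : 0 < eps.
Hypothesis A1 : `|A| <= 1.
Hypothesis T0 : 0 < T.
Hypothesis lam0 : 0 < lam.
Hypothesis lamT : lam * T < 1.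
Hypothesis mlam : 4 * m <= lam.
Hypothesis mg0 : cmeasurable g0.
Hypothesis sg0 : sqint mu (fun n => normc (g0 n)).
Hypothesis g0neg : forall n, n <= 0 -> g0 n = 0.
Hypothesis g0m : (\int[mu]_n (expR n * normc (g0 n))%:E <= m%:E)%E.

(** All bounds reduce to the finiteness of [(1 + n) ^ 3 * e^{- nu n}] for
    [nu = 1 - lam T > 0], and [B] is accordingly a constant multiple of [M].
    The convolution is cut off outside the good frequencies to obtain a
    representative bounded everywhere. *)
Lemma exists_modes : exists (U C : R -> R -> R[i]) (B M : R -> R) (Z : R -> R),
  [/\ [/\ mu.-integrable setT (EFin \o B), forall t, cmeasurable (U t),
     forall t, cmeasurable (C t), forall t n, n <= 0 -> U t n = 0 &
     {ae mu, forall n, U 0 n = g0 n}],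
   [/\ forall t n, (1 + `|n|) ^+ 3 * normc (U t n) <= B n,
     forall t n, (1 + `|n|) * normc (C t n) <= B n,
     forall t, {ae mu, forall n, conv (U t) n = C t n} &
     forall s t n, normc (U t n - U s n) <= B n * `|t - s|],
   (forall t n : R, 0 < t < T ->
     is_derive t 1 (fun s => Re (U s n)) (Re (Udot eps A beta U C t n)) /\
     is_derive t 1 (fun s => Im (U s n)) (Im (Udot eps A beta U C t n))) &
   [/\ mu.-integrable setT (EFin \o M), forall n, 0 <= M n, \int[mu]_n M n <= 2 * m,
     sqint mu Z &
     forall t n, 0 <= t <= T -> normc (U t n) <= Z n /\
       normc (U t n) <= expR (- (1 - lam * t) * n) * M n]].
Proof.
pose nu := 1 - lam * T; have nu0 : 0 < nu by rewrite subr_gt0.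
have [G [M [Z [kappa [[mG Gpos aeG] k0 [mM M0 iM MC Mout] [sZ Z0 MM MZ]]]]]] :=
  wiener_majorants (fun n => normc_ge0 (g0 n)) sg0 g0m lam0 mlam nu0.
pose om := dispersion eps A beta.
have mom : measurable_fun setT om by have [] := cmeasurable_dispersion eps A beta.
have [V [jV Vout V0 [Vw VZ Vlip dV]]] := volterra_solution A1 T0 (ltW lamT) lam0 k0 mom mg0 mG
  Gpos mM M0 Mout Z0 MM MZ.
have [b [b1 bP]] := pow3_decay nu0.
have b0 : 0 <= b by rewrite (le_trans _ b1).
pose c0 := (1 + `|A| + `|beta|) / (2 * eps).
have c00 : 0 <= c0 by rewrite divr_ge0 ?addr_ge0// mulr_ge0// ltW.
(* the four terms serve the modes, their convolution, and the two parts,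
   rotation and Duhamel term, of the increments in time *)
pose K := (1 + 2 * lam + 2 * c0 + lam) * b.
have l0 := ltW lam0.
pose B n := K * M n.
have B0 n : 0 <= B n by rewrite !mulr_ge0// !addr_ge0// mulr_ge0.
have cT t := clamp_itv T0 t.
have VM t n : G n -> normc (V t n) <= expR (- nu * n) * M n.
  move=> Gn; apply: (le_trans (Vw t n)); rewrite ler_wpM2r//.
  exact: (wt_le lam0 (cT t) (ltW (Gpos n Gn))).
have pb (p : R) n : G n -> p <= (1 + `|n|) ^+ 3 -> p * expR (- nu * n) <= b.
  move=> Gn hp; apply: le_trans (bP n (ltW (Gpos n Gn))); rewrite ler_wpM2r// expR_ge0.
have one3 (n : R) : 1 <= (1 + `|n|) ^+ 3 by rewrite exprn_ege1// lerDl.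
have KM c n : c <= 1 + 2 * lam + 2 * c0 + lam -> c * b * M n <= B n.
  by move=> hc; rewrite /B /K; apply: ler_wpM2r => //; exact: ler_wpM2r.
pose U t n := osc om V t n.
have jU : jmeas U by exact: jmeas_osc.
have UV t n : normc (U t n) = normc (V t n) by exact: normc_cisM.
have Uout t n : ~ G n -> U t n = 0 by move=> nG; rewrite /U /osc Vout// mulr0.
have mU t : cmeasurable (U t) by exact: (jmeas_slice t jU).
pose C t n : R[i] := (\1_G n +i* 0) * conv (U t) n.
have CE t n : G n -> C t n = conv (U t) n.
  by move=> Gn; rewrite /C indicE mem_set//; exact: mul1r.
have Cout t n : ~ G n -> C t n = 0.
  by move=> nG; rewrite /C indicE memNset//; exact: mul0r.
have conv_le t n : G n -> normc (conv (U t) n) <= expR (- nu * n) * (2 * lam * M n).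
  move=> Gn; have [iMM _] := MM n Gn.
  have h := @normc_conv_le _ (wt lam (clamp T t)) M n (wtM lam (clamp T t) n) iMM (U t) M (mU t) mM.
  have Mb k : 0 <= M k <= M k by rewrite M0 lexx.
  have Ub k : normc (U t k) <= wt lam (clamp T t) k * M k by rewrite UV.
  apply: (le_trans (h Mb Ub)); apply: ler_pM; rewrite ?expR_ge0//.
  - exact: conv1_ge0.
  - exact: (wt_le lam0 (cT t) (ltW (Gpos n Gn))).
  - exact: (conv_MM_le lam0 MM Gn).
have om_le n : `|om n| <= c0 * (1 + `|n|) ^+ 2 by exact: dispersion_le.
exists U, C, B, M, (fun n => expR (kappa * T) * Z n); split.
- split => //.
  + exact: intZl.
  + move=> t; apply: cmeasurableM; last exact: cmeasurable_conv.
    by apply: cmeasurable_real; exact: measurable_indic.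
  + by move=> t n n0; apply: Uout => /Gpos; rewrite ltNge n0.
  apply: (leb_aeS aeG) => n Gn; have [n0|n0] := ltP 0 n.
    by rewrite /U /osc /rot mulr0 cis0 mul1r V0//; exact: Gn.
  by rewrite g0neg//; apply: Uout => /Gpos; rewrite ltNge n0.
- split.
  + move=> t n; have [Gn|nG] := pselect (G n); last by rewrite Uout// normc_0 mulr0.
    rewrite UV; apply: (@le_trans _ _ (1 * b * M n)); last by apply: KM; lra.
    apply: (@le_trans _ _ ((1 + `|n|) ^+ 3 * (expR (- nu * n) * M n))).
      by rewrite ler_wpM2l ?VM// exprn_ge0// addr_ge0.
    by rewrite mulrA mul1r ler_wpM2r// pb.
  + move=> t n; have [Gn|nG] := pselect (G n); last by rewrite Cout// normc_0 mulr0.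
    rewrite CE//; apply: (@le_trans _ _ (2 * lam * b * M n)); last by apply: KM; lra.
    apply: (@le_trans _ _ ((1 + `|n|) * (expR (- nu * n) * (2 * lam * M n)))).
      by rewrite ler_wpM2l ?conv_le// addr_ge0.
    have -> : (1 + `|n|) * (expR (- nu * n) * (2 * lam * M n)) =
      ((1 + `|n|) * expR (- nu * n)) * (2 * lam * M n) by ring.
    have -> : 2 * lam * b * M n = b * (2 * lam * M n) by ring.
    rewrite ler_wpM2r ?mulr_ge0// pb//.
    by rewrite -[leLHS]expr1; apply: ler_weXn2l => //; rewrite lerDl.
  + move=> t; apply: (leb_aeS aeG) => n Gn; have [n0|n0] := ltP 0 n; first by rewrite CE//; exact: Gn.
    rewrite Cout; last by move=> /Gpos; rewrite ltNge n0.
    have z k : U t k * U t (n - k) = 0.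
      have [k0'|k0'] := ltP 0 k; last by rewrite (Uout t k) ?mul0r// => /Gpos; rewrite ltNge k0'.
      rewrite (Uout t (n - k)) ?mulr0// => /Gpos; rewrite subr_gt0 => kn.
      by have := lt_trans k0' kn; rewrite ltNge n0.
    apply: cReP => /=.
      by rewrite -[RHS](Rintegral_cst0 setT); apply: eq_Rintegral => k _; rewrite z.
    by rewrite -[RHS](Rintegral_cst0 setT); apply: eq_Rintegral => k _; rewrite z.
  + move=> s t n; have [Gn|nG] := pselect (G n); last first.
      by rewrite !Uout// subrr normc_0 mulr_ge0.
    have -> : U t n - U s n = (rot om t n - rot om s n) * V t n + rot om s n * (V t n - V s n).
      by rewrite /U /osc mulrBl mulrBr addrA subrK.
    apply: (le_trans (normcD _ _)); rewrite normc_cisM Normc.normcM.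
    apply: (@le_trans _ _ ((2 * c0 + lam) * b * M n * `|t - s|)); last first.
      by rewrite ler_wpM2r//; apply: KM; lra.
    have -> : (2 * c0 + lam) * b * M n * `|t - s| =
      2 * (c0 * b) * M n * `|t - s| + lam * (b * M n) * `|t - s| by ring.
    apply: lerD.
      apply: (@le_trans _ _ (2 * (`|om n| * `|t - s|) * (expR (- nu * n) * M n))).
        apply: ler_pM; rewrite ?normc_ge0 ?VM//.
        by apply: (le_trans (normc_cisB _ _)); rewrite -mulrBr normrM.
      have -> : 2 * (`|om n| * `|t - s|) * (expR (- nu * n) * M n) =
        2 * (`|om n| * expR (- nu * n)) * M n * `|t - s| by ring.
      rewrite ler_wpM2r// ler_wpM2r// ler_pM2l//.
      apply: (@le_trans _ _ (c0 * ((1 + `|n|) ^+ 2 * expR (- nu * n)))).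
        by rewrite mulrA ler_wpM2r ?expR_ge0.
      by rewrite ler_wpM2l// pb// ler_weXn2l// lerDl.
    apply: (le_trans (Vlip s t n)); rewrite ler_wpM2r// ler_pM2l// /damp.
    rewrite ler_wpM2r// pb//; apply: (le_trans (ler_norm n)); exact: norm_le_pow3.
- move=> t n tT; have [Gn|nG] := pselect (G n); last first.
    have -> : (fun s : R => Re (U s n)) = cst 0 by apply/funext => s; rewrite Uout.
    have -> : (fun s : R => Im (U s n)) = cst 0 by apply/funext => s; rewrite Uout.
    by rewrite /Udot Uout// Cout// !mulr0 addr0; split; exact: is_derive_cst.
  have [d1 d2] := dV n t Gn tT.
  have [e1 e2] := @is_derive_rotation _ (om n) t (V^~ n) _ d1 d2.
  have E : Udot eps A beta U C t n =
      (0 +i* om n) * (cis (om n * t) * V t n) + cis (om n * t) * src A om V n t.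
    rewrite /Udot CE//; congr (_ + _).
    by rewrite /src !mulrA -cisD subrr cis0 mul1r.
  by rewrite E; split; [exact: e1|exact: e2].
split => //; first exact: sqintZ.
move=> t n /[dup] tT /andP[t0 t1]; rewrite UV; split.
  apply: (le_trans (VZ t n)); rewrite clamp_id// ler_wpM2r// ler_expR.
  by rewrite ler_pM2l.
by have := Vw t n; rewrite clamp_id.
Qed.

End solution.

Section main.
Context {R : realType}.
Local Notation mu := (@lebesgue_measure R).
Local Notation normc := Normc.normc.

(** A vanishing norm imposes no rate; any [lam] with [lam T < 1] serves then, as
    the iteration requires a positive one. *)
Lemma decay_rate (m T : R) : 0 <= m -> 0 < T -> (T%:E < (4%:E * m%:E)^-1)%E ->
  exists lam : R, [/\ 0 < lam, lam * T < 1, 4 * m <= lam & m = 0 \/ lam = 4 * m].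
Proof.
move=> m0 T0; have [->|mn0] := eqVneq m 0.
  move=> _; exists (2 * T)^-1; split; [|  |  |by left].
  - by rewrite invr_gt0 mulr_gt0.
  - by rewrite invfM -mulrA mulVf ?gt_eqF// mulr1 invf_lt1// ltr1n.
  - by rewrite mulr0 invr_ge0 mulr_ge0// ltW.
have mp : 0 < m by rewrite lt_neqAle eq_sym mn0.
have m4 : 0 < 4 * m by rewrite mulr_gt0.
rewrite -EFinM inver gt_eqF// lte_fin => h.
exists (4 * m); split => //; last by right.
by rewrite -ltr_pdivlMl// mulr1.
Qed.

End main.

Theorem theorem6p2 (R : realType) (eps A beta : R) (f0 : R -> R)
    (heps : 0 < eps) (hA : -1 <= A <= 1) (hbeta : 0 <= beta)
    (hf0 : wiener 1 f0) (T : R) (hT0 : 0 < T)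
    (hT : (T%:E < (4%:E * wiener_norm 1 f0)^-1)%E) :
  exists f : R -> R -> R,
    wave_solution eps A beta T f0 f /\
    Linfty_wiener T (fun t => 1 - 4 * fine (wiener_norm 1 f0) * t) f.
Proof.
have wfin : (wiener_norm 1 f0 \is a fin_num)%E.
  by have [_ iw] := hf0; exact: integrable_fin_num.
set m := fine (wiener_norm 1 f0).
have mE : wiener_norm 1 f0 = m%:E by rewrite fineK.
have m0 : 0 <= m.
  by apply: fine_ge0; apply: integral_ge0 => n _; rewrite lee_fin mulr_ge0 ?expR_ge0 ?normc_ge0.
rewrite mE in hT; have [lam [lam0 lamT mlam mcase]] := decay_rate m0 hT0 hT.
have [g0 [[mg0 ig0] sg0 g0neg g0m f0E]] := initial_modes hf0.
rewrite mE in g0m; have A1 : `|A| <= 1 by rewrite ler_norml.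
have [U [C [B [M [Z [[iB mU mC U0 Uinit] [UB CB Cconv Ulip] dU [iM M0 MC sZ UZ]]]]]]] :=
  @exists_modes R eps A beta T m lam g0 heps A1 hT0 lam0 lamT mlam mg0 sg0 g0neg g0m.
exists (sol U); split.
  split.
  - by apply: continuous_subspaceT; exact: (continuous_sol iB mU UB Ulip).
  - apply: (leb_aeS f0E) => x <-; rewrite /sol; congr (_ * _).
    have [m1 _] := cmeasurable_synth x (mU 0); have [m2 _] := cmeasurable_synth x mg0.
    by apply: leb_ae_eq_Rintegral => //; apply: (leb_aeS Uinit) => n ->.
  - by move=> x t tT; exact: (wave_eq_sol heps iB mU mC U0 UB CB Cconv dU).
have key t : 0 <= t <= T -> wiener (1 - 4 * m * t) ((sol U)^~ t) /\
    (wiener_norm (1 - 4 * m * t) ((sol U)^~ t) <= (2 * \int[lebesgue_measure]_n M n)%:E)%E.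
  move=> tT; have sU : sqint lebesgue_measure (fun n => Normc.normc (U t n)).
    apply: (sqint_le _ sZ); first exact: measurable_normc.
    move=> n; rewrite (ger0_norm (normc_ge0 _)); have [h _] := UZ t n tT.
    exact: le_trans h (ler_norm _).
  apply: wiener_rsynth => //; first exact: (cL1_U iB mU UB).
    exact: U0.
  (* a zero datum keeps the width 1, but then almost all modes vanish *)
  have [mz|lm] := mcase.
    have M00 : \int[lebesgue_measure]_n `|M n| = 0.
      apply/eqP; rewrite eq_le; apply/andP; split.
        by under eq_Rintegral do rewrite ger0_norm//; rewrite (le_trans MC)// mz mulr0.
      by apply: Rintegral_ge0.
    have aeM : {ae lebesgue_measure, forall n, M n = 0}.
      have iM' : (\int[lebesgue_measure]_n `|(M n)%:E| = 0)%E.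
        have := integrable_norm iM => /(integrable_fin_num measurableT) fn.
        by rewrite -[LHS]fineK//; congr EFin; rewrite -[RHS]M00.
      have mM : measurable_fun setT (EFin \o M) by have /integrableP[] := iM.
      move/(ae_eq_integral_abs lebesgue_measure measurableT mM) : iM' => h.
      by apply: (leb_aeS h) => n /(_ Logic.I) /= [].
    apply: (leb_aeS aeM) => n Mn; have [_ h] := UZ t n tT; move: h; rewrite Mn mulr0 => h.
    have -> : Normc.normc (U t n) = 0 by apply/eqP; rewrite eq_le h normc_ge0.
    by rewrite mulr0.
  apply: aeW => n; have [_ h] := UZ t n tT.
  apply: (@le_trans _ _ (expR ((1 - 4 * m * t) * n) * (expR (- (1 - lam * t) * n) * M n))).
    by rewrite ler_wpM2l ?expR_ge0.
  rewrite mulrA -expRD lm.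
  have -> : (1 - 4 * m * t) * n + - (1 - 4 * m * t) * n = 0 by ring.
  by rewrite expR0 mul1r.
split.
  apply: aeW => t; rewrite in_itv/= => /andP[t0 tT].
  by have [] := key t _ => //; rewrite !ltW.
apply: (@le_lt_trans _ _ (2 * \int[lebesgue_measure]_n M n)%:E%E); last exact: ltry.
apply/ess_supP; apply: aeW => t; rewrite patchE; case: ifPn => [|_].
  rewrite inE/= in_itv/= => /andP[t0 tT].
  by have [] := key t _ => //; rewrite !ltW.
by rewrite lee_fin mulr_ge0// Rintegral_ge0.
Qed.
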